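(* For each $\varepsilon>0$, there exists some $k_0$ such that, for each $k\geq k_0$, in almost every $n$-vertex random graph process $\{G_M\}_{M\geq 0}$, the following holds for each $0\leq M\leq \binom{n}{2}$: if $G_M^{(k)}\neq \emptyset$, then $G_M^{(k)}$ is $(1/2-\varepsilon)$-resiliently Hamiltonian, but not $(1/2+\varepsilon)$-resiliently Hamiltonian.
   Context: The $n$-vertex random graph process $\{G_M\}_{M\geq 0}$: $G_0$ is the empty graph on vertex set $[n]$, and $G_M$ is obtained from $G_{M-1}$ by adding an edge chosen uniformly at random among the non-edges, until the complete graph is reached. ''In almost every random graph process'' means with probability tending to $1$ as $n\to\infty$. For a graph $G$, the $k$-core $G^{(k)}$ is the (possibly empty) maximal subgraph of $G$ with minimum degree at least $k$. A graph $G$ is $\alpha$-resiliently Hamiltonian if for every subgraph $H\subset G$ with $d_H(v)\le \alpha d_G(v)$ for every $v\in V(G)$, the graph $G-H$ (same vertex set, edge set $E(G)\setminus E(H)$) is Hamiltonian. *)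

(* Defs.v *)
From HB Require Import structures.
From mathcomp Require Import all_boot all_order all_algebra.
From mathcomp Require Import zify.
From mathcomp Require Import all_classical all_reals all_analysis.
Set Implicit Arguments.
Unset Strict Implicit.
Unset Printing Implicit Defensive.
Import Order.TTheory GRing.Theory Num.Theory.
Import numFieldNormedType.Exports.
Local Open Scope ring_scope.

Section Graphs.
Variable T : finType.
Implicit Types (v : T) (e : {set T}).

(* A graph carries its own vertex set, because the k-core of a graph on [n]
   usually has fewer than n vertices. *)
Definition wf_graph (p : {set T} * {set {set T}}) : bool :=
  [forall e in p.2, (e \subset p.1) && (#|e| == 2)%N].

Record graph := Graph {
  graph_val :> {set T} * {set {set T}};
  _ : wf_graph graph_val }.

HB.instance Definition _ := [isSub for graph_val].
HB.instance Definition _ := [Finite of graph by <:].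

Implicit Types G H K L : graph.

Definition vset G : {set T} := (graph_val G).1.
Definition eset G : {set {set T}} := (graph_val G).2.

Lemma edgeP G e : e \in eset G -> (e \subset vset G) && (#|e| == 2)%N.
Proof. exact: (forall_inP (valP G)). Qed.

Definition adj G : rel T := fun x y => [set x; y] \in eset G.

Definition degree G v : nat := #|[set e in eset G | v \in e]|.

Definition subgraph H G : bool :=
  (vset H \subset vset G) && (eset H \subset eset G).

Fact wf_edgeless (V : {set T}) : wf_graph (V, finset.set0).
Proof. by apply/forall_inP => e; rewrite inE. Qed.

Definition edgeless (V : {set T}) : graph := Graph (wf_edgeless V).

Definition nonedges G : {set {set T}} :=
  [set e : {set T} | [&& e \subset vset G, #|e| == 2%N & e \notin eset G]].

Definition adds_edge G e G' : bool :=
  (vset G' == vset G) && (eset G' == e |: eset G).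

Fact wf_remove_edges G H : wf_graph (vset G, eset G :\: eset H).
Proof.
apply/forall_inP => e /=; rewrite inE => /andP[_]; exact: edgeP.
Qed.

Definition remove_edges G H : graph := Graph (wf_remove_edges G H).

Definition min_degree_ge (k : nat) G : Prop :=
  forall v, v \in vset G -> (k <= degree G v)%N.

Definition is_kcore (k : nat) G K : Prop :=
  [/\ subgraph K G, min_degree_ge k K
    & forall L, subgraph L G -> min_degree_ge k L -> subgraph K L -> L = K].

Definition hamiltonian G : Prop :=
  exists c : seq T,
    [/\ (3 <= size c)%N, ucycle (adj G) c & c =i vset G].

Definition resiliently_hamiltonian (R : realType) (alpha : R) G : Prop :=
  forall H, subgraph H G ->
    (forall v, v \in vset G -> (degree H v)%:R <= alpha * (degree G v)%:R) ->
    hamiltonian (remove_edges G H).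

Lemma graph_eq G H : vset G = vset H -> eset G = eset H -> G = H.
Proof.
move=> eV eE; apply: val_inj => /=.
by rewrite [LHS]surjective_pairing [RHS]surjective_pairing; congr pair.
Qed.

Lemma subgraph_degree H G v : subgraph H G -> (degree H v <= degree G v)%N.
Proof.
case/andP=> _ sE; apply/subset_leq_card/fintype.subsetP => e.
by rewrite !inE => /andP[/(fintype.subsetP sE) -> ->].
Qed.

Fact wf_union G H : wf_graph (vset G :|: vset H, eset G :|: eset H).
Proof.
apply/forall_inP => e /=; rewrite inE => /orP[] /edgeP/andP[se ->].
  by rewrite andbT (fintype.subset_trans se) // finset.subsetUl.
by rewrite andbT (fintype.subset_trans se) // finset.subsetUr.
Qed.

Definition graph_union G H : graph := Graph (wf_union G H).

Lemma is_kcore_max k G K L :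
  is_kcore k G K -> subgraph L G -> min_degree_ge k L -> subgraph L K.
Proof.
move=> [/andP[KV KE] Kd Kmax] /andP[LV LE] Ld.
have subl : subgraph K (graph_union K L).
  by apply/andP; split; apply: finset.subsetUl.
have subr : subgraph L (graph_union K L).
  by apply/andP; split; apply: finset.subsetUr.
suff <- : graph_union K L = K by [].
apply: Kmax => //.
  by apply/andP; rewrite /vset /eset /= !finset.subUset; split; apply/andP.
move=> v; rewrite inE => /orP[/Kd|/Ld] kv; apply: leq_trans kv _;
  exact: subgraph_degree.
Qed.

Lemma is_kcore_unique k G K L : is_kcore k G K -> is_kcore k G L -> K = L.
Proof.
move=> hK [LG Ld Lmax]; have [KG Kd _] := hK.
by apply: Lmax => //; apply: (is_kcore_max hK).
Qed.

Lemma is_kcore_exists k G : exists K, is_kcore k G K.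
Proof.
pose P K := subgraph K G && [forall v in vset K, k <= degree K v]%N.
have P0 : P (edgeless finset.set0).
  apply/andP; split; first by apply/andP; split; apply: finset.sub0set.
  by apply/forall_inP => v; rewrite inE.
case: (@arg_maxnP _ (edgeless finset.set0) P (fun K => #|vset K| + #|eset K|)%N P0)
  => K /andP[KG /forall_inP Kd] Kmax.
exists K; split=> // L LG Ld KL.
have /Kmax : P L by rewrite /P LG; apply/forall_inP.
move/andP: KL => [sV sE] le.
have lV := subset_leq_card sV; have lE := subset_leq_card sE.
have eV : #|vset L| = #|vset K| by move: le lV lE => /=; lia.
have eE : #|eset L| = #|eset K| by move: le lV lE => /=; lia.
apply/esym/graph_eq; apply/eqP.
  by rewrite eqEcard sV eV leqnn.
by rewrite eqEcard sE eE leqnn.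
Qed.

End Graphs.

Section RandomGraphProcess.
Variables (R : realType) (n : nat).

Definition process := {ffun 'I_('C(n, 2)).+1 -> graph 'I_n}.

(* Transition probability: uniform over the non-edges of G. *)
Definition step_prob (G G' : graph 'I_n) : R :=
  if [exists e in nonedges G, adds_edge G e G']
  then (#|nonedges G|%:R)^-1 else 0.

(* Probability of a trajectory: G_0 is the empty graph on [n] and each step
   follows step_prob conditionally on the past. *)
Definition process_weight (G : process) : R :=
  (G ord0 == edgeless finset.setT)%:R *
  \prod_(M < 'C(n, 2)) step_prob (G (widen_ord (leqnSn _) M)) (G (lift ord0 M)).

Definition process_prob (A : set process) : R :=
  \sum_(G : process | G \in A) process_weight G.

End RandomGraphProcess.

Definition almost_every_process (R : realType)
    (A : forall n : nat, set (process n)) : Prop :=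
  ((fun n => process_prob R (A n)) @ \oo --> (1 : R))%classic.

(* Main.v *)
Require Import Defs.
From mathcomp Require Import all_boot all_order all_algebra.
From mathcomp Require Import zify ring lra.
From mathcomp Require Import all_classical all_reals all_analysis.
From mathcomp Require Import fintype finset bigop.
Set Implicit Arguments.
Unset Strict Implicit.
Unset Printing Implicit Defensive.
Import Order.TTheory GRing.Theory Num.Theory.

(** Upper bound. By a theorem of Stiebitz, a graph with degrees [d(v) > a(v) + b(v)] splits into
    two nonempty parts in which every vertex keeps at least [a(v)], respectively [b(v)], neighbours.
    With [a] and [b] just below [d/2], deleting the edges of the cut disconnects the k-core while
    removing at most a [1/2 + eps] proportion of the edges at each vertex.

    Lower bound. The marginal of the process at time [M] is the uniform graph with [M] edges, which
    costs a factor [N + 1], with [N = binom(n, 2)], over the binomial graph of density [p = M / N];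
    a union bound over [M] costs another [N + 1], so it suffices that the bad event has probability
    [O(n^-5)] for each [p]. Write [D = p n]. If [D < k / 6] the core is empty. Otherwise it has
    linearly many vertices, all but [n / D^2] of which have degree at least [D / 100]. Let [F] be
    the core minus [H]. A few edges chosen at each vertex and a random sparse subset of [F] form a
    sparse subgraph of [F] in which small sets expand. Adding a longest path of [F], with vertex
    set [V], Posa rotations give linearly many starting points [s], each with linearly many ends
    [t] of Hamiltonian paths on [V]. Now fix this sparse graph [S] in advance: since [S] has at
    most [delta p n^2] edges, a union bound over all [S] still shows that the remaining edges of
    the random graph are well distributed among the pairs that rotate or close one of these
    paths. As [H] has less than half of the edges at each vertex, one more rotation along an edge
    of [F] reaches more than half of the core as endpoints, hence [F] contains an edge closing some
    path into a cycle on [V]; as [V] is the vertex set of a longest path and [F] is connected,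
    this cycle is Hamiltonian. *)

Lemma setDDS (T : finType) (A B : {set T}) : A \subset B -> B :\: (B :\: A) = A.
Proof. by move=> sAB; rewrite setDDr setDv set0U (setIidPr sAB). Qed.

Section DegreeIn.
Variables (T : finType) (r : rel T).
Implicit Types (A B X : {set T}) (x y : T).

Definition deg_in X x : nat := #|[set u in X | r x u]|.

Lemma deg_inS A B x : A \subset B -> deg_in A x <= deg_in B x.
Proof.
move=> sAB; apply/subset_leq_card/subsetP => u; rewrite !inE.
by case/andP=> /(subsetP sAB) -> ->.
Qed.

Lemma deg_in_le_card A x : deg_in A x <= #|A|.
Proof. by apply/subset_leq_card/subsetP => u; rewrite inE => /andP[]. Qed.

Lemma deg_in_sum A x : deg_in A x = \sum_(u in A) r x u.
Proof.
rewrite /deg_in -sum1dep_card big_mkcondr /=.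
by apply: eq_bigr => u _; case: (r x u).
Qed.

Lemma deg_inU A B x : [disjoint A & B] -> deg_in (A :|: B) x = deg_in A x + deg_in B x.
Proof.
by move=> dAB; rewrite !deg_in_sum -bigU //; apply: eq_bigl => u; rewrite !inE.
Qed.

Lemma deg_in_setD A B x : A \subset B -> deg_in B x = deg_in A x + deg_in (B :\: A) x.
Proof. by move=> sAB; rewrite !deg_in_sum (big_setID A) /= (setIidPr sAB). Qed.

Lemma deg_inD1 A x y : deg_in A x <= (deg_in (A :\ y) x).+1.
Proof.
have [yA|yA] := boolP (y \in A); last first.
  by rewrite (setDidPl _) ?leqnSn // disjoint_sym disjoints1.
rewrite (deg_in_setD x (_ : [set y] \subset A)) ?sub1set //.
by rewrite -add1n leq_add2r -(cards1 y) deg_in_le_card.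
Qed.

End DegreeIn.

(** * Partitions into two parts of prescribed minimum degrees (Stiebitz) *)

Section Stiebitz.
Variables (T : finType) (r : rel T) (V : {set T}).
Hypothesis r_sym : symmetric r.
Hypothesis r_irr : irreflexive r.
Implicit Types (A B X Y : {set T}) (f a b : T -> nat) (x y : T).

Notation dg := (deg_in r).

Definition satisfactory f A : bool := [forall x in A, f x <= dg A x].

Definition degenerate f A : bool :=
  [forall X : {set T}, (X \subset A) && (X != set0) ==> [exists x in X, dg X x <= f x]].

Definition feasible a b A B : bool :=
  [&& A != set0, B != set0, A \subset V, B \subset V, [disjoint A & B],
      satisfactory a A & satisfactory b B].

Definition degenerate_partition a b A : bool :=
  [&& A \subset V, A != set0, V :\: A != set0, degenerate a A & degenerate b (V :\: A)].

Definition cut A : nat := \sum_(x in A) dg (V :\: A) x.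

Definition partition_weight a b A : nat :=
  cut A + \sum_(x in A) a x + \sum_(x in V :\: A) b x.

Lemma degenerateS f A B : A \subset B -> degenerate f B -> degenerate f A.
Proof.
move=> sAB /forallP dB; apply/forallP => X; apply/implyP => /andP[sXA X0].
by have /implyP := dB X; apply; rewrite X0 (subset_trans sXA).
Qed.

Lemma degenerate_low_degree f A : degenerate f A -> A != set0 ->
  exists2 x, x \in A & dg A x <= f x.
Proof.
by move=> /forallP/(_ A); rewrite subxx => /implyP + A0 => /(_ A0)/exists_inP.
Qed.

Lemma not_satisfactory f A : ~~ satisfactory f A -> exists2 x, x \in A & dg A x < f x.
Proof.
by rewrite negb_forall_in => /exists_inP[x xA]; rewrite -ltnNge; exists x.
Qed.

Lemma degenerateU1 f A x : degenerate f A -> ~~ degenerate f (x |: A) ->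
  exists X, [/\ X \subset x |: A, x \in X & {in X, forall y, f y < dg X y}].
Proof.
move=> dA; rewrite negb_forall => /existsP[X].
rewrite negb_imply negb_exists_in => /andP[/andP[sX X0] /forall_inP X_large].
exists X; split=> [//||y /X_large]; last by rewrite -ltnNge.
apply: contraT => xX; have sXA : X \subset A.
  apply/subsetP => u uX; have := subsetP sX u uX; rewrite !inE => /orP[/eqP ux|//].
  by rewrite -ux uX in xX.
by have [y /X_large/negP] := degenerate_low_degree (degenerateS sXA dA) X0.
Qed.

Lemma feasible_satisfactory a b A : A \subset V -> A != set0 -> satisfactory a A ->
  (forall B, ~~ feasible a b A B) -> degenerate b (V :\: A).
Proof.
move=> sA A0 tA no_feasible; apply/forallP => X; apply/implyP => /andP[].
rewrite subsetD => /andP[sX dXA] X0; have := no_feasible X.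
rewrite /feasible A0 X0 sA sX disjoint_sym dXA tA /= => /not_satisfactory[x xX /ltnW le_x].
by apply/exists_inP; exists x.
Qed.

Lemma cutC A : A \subset V -> cut (V :\: A) = cut A.
Proof.
move=> sA; rewrite /cut setDDS //.
rewrite (eq_bigr _ (fun x _ => deg_in_sum r A x)) exchange_big /=.
by apply: eq_bigr => x _; rewrite deg_in_sum; apply: eq_bigr => y _; rewrite r_sym.
Qed.

Lemma cut_setD1 A x : A \subset V -> x \in A ->
  cut (A :\ x) + dg (V :\: A) x = cut A + dg (A :\ x) x.
Proof.
move=> sA xA; rewrite /cut [in RHS](big_setD1 x xA) /= addnC -addnA; congr (_ + _).
have -> : V :\: (A :\ x) = x |: (V :\: A).
  by apply/setP=> u; rewrite !inE; have [->|] := eqVneq u x; rewrite //= (subsetP sA).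
have x_notin : [disjoint [set x] & V :\: A] by rewrite disjoints1 !inE xA.
rewrite (eq_bigr _ (fun y _ => deg_inU r y x_notin)) big_split /= addnC; congr (_ + _).
by rewrite deg_in_sum; apply: eq_bigr => y _; rewrite deg_in_sum big_set1 r_sym.
Qed.

Lemma degenerate_partitionC a b A : A \subset V ->
  degenerate_partition b a (V :\: A) = degenerate_partition a b A.
Proof.
move=> sA; rewrite /degenerate_partition subsetDl setDDS // sA.
by rewrite /= andbCA [in LHS](andbC (degenerate b _)).
Qed.

Lemma partition_weightC a b A : A \subset V ->
  partition_weight b a (V :\: A) = partition_weight a b A.
Proof.
move=> sA; rewrite /partition_weight cutC // setDDS //.
by rewrite -!addnA [X in _ + X]addnC.
Qed.

Section PrescribedDegrees.
Variables a b : T -> nat.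
Hypothesis V0 : V != set0.
Hypothesis a_gt0 : {in V, forall x, 0 < a x}.
Hypothesis b_gt0 : {in V, forall x, 0 < b x}.
Hypothesis large_degree : {in V, forall x, a x + b x < dg V x}.

Lemma feasibleU1 A B x : feasible a b A B -> x \in V :\: A -> dg (V :\: A) x < b x ->
  x \notin B /\ feasible a b (x |: A) B.
Proof.
case/and5P=> A0 B0 sA sB /and3P[dAB /forall_inP tA tB] xVA x_low.
have /andP[xA xV] : (x \notin A) && (x \in V) by rewrite -in_setD.
have xB : x \notin B.
  apply: contraL x_low => xB; rewrite -leqNgt; apply: leq_trans (forall_inP tB x xB) _.
  by apply: deg_inS; rewrite subsetD sB disjoint_sym.
have x_high : a x <= dg A x.
  by have := large_degree xV; rewrite (deg_in_setD r x sA); move: x_low; clear; lia.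
split=> //; rewrite /feasible B0 sB tB subUset sub1set xV sA /= andbT; apply/and3P; split.
- by apply/set0Pn; exists x; rewrite setU11.
- by rewrite disjoints_subset subUset sub1set inE xB -disjoints_subset.
- apply/forall_inP => u; rewrite in_setU1 => /predU1P[->|uA].
    exact: leq_trans x_high (deg_inS _ _ (subsetUr _ _)).
  exact: leq_trans (tA _ uA) (deg_inS _ _ (subsetUr _ _)).
Qed.

Lemma feasible_extends A B : feasible a b A B -> exists A', feasible a b A' (V :\: A').
Proof.
have [m] := ubnP #|V :\: A|; elim: m A => // m IH A; rewrite ltnS => leAm fAB.
have /and5P[A0 B0 sA sB /and3P[dAB tA _]] := fAB.
have [tVA|/not_satisfactory[x xVA x_low]] := boolP (satisfactory b (V :\: A)).
  exists A; rewrite /feasible A0 sA subsetDl tA tVA !andbT /=; apply/andP; split.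
    by apply: contraNneq B0 => VA0; rewrite -subset0 -VA0 subsetD sB disjoint_sym.
  by rewrite disjoint_sym disjoints_subset setDE subsetIr.
have [xB fxAB] := feasibleU1 fAB xVA x_low; apply: IH fxAB; apply: leq_trans leAm.
by rewrite -setDDl setDDl setUC -setDDl [X in _ < X](cardsD1 x) xVA.
Qed.

Lemma minset_satisfactory_tight A :
  minset (fun A' => [&& A' != set0, A' \subset V & satisfactory a A']) A ->
  exists2 x, x \in A & dg A x = a x.
Proof.
case/minsetP => /and3P[/set0Pn[y yA] sA /forall_inP tA] A_min.
have yV := subsetP sA y yA.
have Ay0 : A :\ y != set0.
  apply/eqP => Ay0; have := tA y yA; rewrite -(setD1K yA) Ay0 setU0 deg_in_sum big_set1 r_irr.
  by rewrite leqNgt a_gt0.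
have : ~~ satisfactory a (A :\ y).
  apply/negP => tAy; have := A_min (A :\ y).
  rewrite Ay0 tAy (subset_trans (subD1set _ _)) // subD1set => /(_ isT isT)/setP/(_ y).
  by rewrite !inE eqxx yA.
case/not_satisfactory => x /setD1P[_ xA] x_low; exists x => //; apply/eqP.
by rewrite eqn_leq (tA x xA) andbT (leq_trans _ x_low) // deg_inD1.
Qed.

Lemma exists_degenerate_partition :
  (forall A B, ~~ feasible a b A B) -> exists A, degenerate_partition a b A.
Proof.
move=> no_feasible.
pose P A := [&& A != set0, A \subset V & satisfactory a A].
have PV : P V.
  rewrite /P V0 subxx; apply/forall_inP => x /large_degree; apply: leq_trans.
  by rewrite ltnW // ltnS leq_addr.
have [A minA sAV] := minset_exists PV.
have [x xA x_tight] := minset_satisfactory_tight minA.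
have [/and3P[A0 sA tA] A_min] := minsetP minA.
exists A; apply/and5P; split=> //.
- apply: contraTneq (large_degree (subsetP sA x xA)) => /eqP; rewrite setD_eq0 => sVA.
  have -> : V = A by apply/eqP; rewrite eqEsubset sVA.
  by rewrite x_tight -leqNgt leq_addr.
- apply/forallP => X; apply/implyP => /andP[sXA X0].
  have [XA|XA] := eqVneq X A; first by apply/exists_inP; exists x; rewrite XA ?x_tight.
  have : ~~ P X by apply: contraNN XA => /A_min ->.
  rewrite /P X0 (subset_trans sXA) //= => /not_satisfactory[z zX /ltnW z_low].
  by apply/exists_inP; exists z.
- exact: feasible_satisfactory sA A0 tA (no_feasible A).
Qed.

(* Otherwise moving [x] across would give a degenerate partition of smaller weight. *)
Lemma min_weight_partition A x : degenerate_partition a b A ->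
  (forall A', degenerate_partition a b A' -> partition_weight a b A <= partition_weight a b A') ->
  x \in A -> dg A x <= a x ->
  exists X, [/\ X \subset x |: (V :\: A), x \in X & {in X, forall y, b y < dg X y}].
Proof.
move=> /and5P[sA A0 B0 dA dB] A_min xA x_low; have xV := subsetP sA x xA.
apply: (degenerateU1 dB); apply/negP => dBx.
have VAx : V :\: (A :\ x) = x |: (V :\: A).
  by apply/setP=> u; rewrite !inE; have [->|] := eqVneq u x.
have Ax0 : A :\ x != set0.
  have [y yB y_low] := degenerate_low_degree dB B0.
  apply/eqP => Ax0; have := large_degree (subsetP (subsetDl _ _) y yB).
  have := a_gt0 (subsetP (subsetDl _ _) y yB).
  have := deg_in_le_card r A y; rewrite -{2}(setD1K xA) Ax0 setU0 cards1.
  by rewrite (deg_in_setD r y sA); move: y_low; clear; lia.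
have /A_min : degenerate_partition a b (A :\ x).
  rewrite /degenerate_partition VAx dBx Ax0 (subset_trans (subD1set _ _) sA).
  rewrite (degenerateS (subD1set _ _) dA) /= andbT.
  by apply/set0Pn; exists x; rewrite setU11.
rewrite /partition_weight VAx (big_setU1 x) ?inE ?xA //= (big_setD1 x xA) /=.
have := cut_setD1 sA xA; have := large_degree xV; rewrite (deg_in_setD r x sA).
have := deg_inS r x (subD1set A x); move: x_low; clear; lia.
Qed.

Lemma feasible_large_parts A x y X Y :
  A \subset V -> x \in A -> y \in V :\: A ->
  X \subset x |: (V :\: A) -> x \in X -> {in X, forall z, b z < dg X z} ->
  Y \subset y |: A -> y \in Y -> {in Y, forall z, a z < dg Y z} ->
  feasible a b (Y :\ x) (X :\ y).
Proof.
move=> sA xA; rewrite inE => /andP[yA yV] sX xX X_large sY yY Y_large.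
have xy : x != y by apply: contraNneq yA => <-.
rewrite /feasible; apply/and5P; split.
- by apply/set0Pn; exists y; rewrite !inE eq_sym xy.
- by apply/set0Pn; exists x; rewrite !inE xy.
- apply/subsetP=> u /setD1P[_ /(subsetP sY)]; rewrite in_setU1.
  by case/predU1P => [->|/(subsetP sA)].
- apply/subsetP=> u /setD1P[_ /(subsetP sX)]; rewrite !inE.
  by case/predU1P => [->|/andP[//]]; apply: (subsetP sA).
apply/and3P; split.
- rewrite disjoints_subset; apply/subsetP => u; rewrite !inE => /andP[ux /(subsetP sY)].
  rewrite in_setU1 negb_and negbK => /predU1P[->|uA]; first by rewrite eqxx.
  by apply/orP; right; apply/negP => /(subsetP sX); rewrite !inE (negbTE ux) uA.
- apply/forall_inP => u /setD1P[_ uY]; rewrite -ltnS.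
  exact: leq_trans (Y_large u uY) (deg_inD1 _ _ _ _).
- apply/forall_inP => u /setD1P[_ uX]; rewrite -ltnS.
  exact: leq_trans (X_large u uX) (deg_inD1 _ _ _ _).
Qed.

End PrescribedDegrees.

Theorem Stiebitz_partition a b :
  V != set0 -> {in V, forall x, 0 < a x} -> {in V, forall x, 0 < b x} ->
  {in V, forall x, a x + b x < dg V x} ->
  exists A, feasible a b A (V :\: A).
Proof.
move=> V0 a_gt0 b_gt0 large_ab.
have large_ba : {in V, forall x, b x + a x < dg V x}.
  by move=> x xV; rewrite addnC large_ab.
have [/existsP[A /existsP[B]]|/existsPn no_feasible] :=
    boolP [exists A : {set T}, exists B : {set T}, feasible a b A B].
  exact: feasible_extends.
have {}no_feasible A B : ~~ feasible a b A B by apply/existsPn: B; apply: no_feasible.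
have [A0 dpA0] := exists_degenerate_partition V0 a_gt0 large_ab no_feasible.
have [A dpA A_min] := @arg_minnP _ A0 (degenerate_partition a b) (partition_weight a b) dpA0.
have /and5P[sA An0 Bn0 dA dB] := dpA; have sB := subsetDl V A.
have dpB : degenerate_partition b a (V :\: A) by rewrite degenerate_partitionC.
have B_min B' : degenerate_partition b a B' ->
    partition_weight b a (V :\: A) <= partition_weight b a B'.
  move=> dpB'; have /and5P[sB' _ _ _ _] := dpB'.
  by rewrite partition_weightC // -(partition_weightC b a sB') A_min // degenerate_partitionC.
have [x xA x_low] := degenerate_low_degree dA An0.
have [y yB y_low] := degenerate_low_degree dB Bn0.
have [X [sX xX X_large]] := min_weight_partition a_gt0 large_ab dpA A_min xA x_low.
have [Y [sY yY Y_large]] := min_weight_partition b_gt0 large_ba dpB B_min yB y_low.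
rewrite setDDS // in sY.
have /negP[] := no_feasible (Y :\ x) (X :\ y).
exact: (feasible_large_parts sA xA yB sX xX X_large sY yY Y_large).
Qed.

End Stiebitz.

(** * Rotations of Hamiltonian paths (Posa) *)

Section Consecutive.
Variable T : eqType.
Implicit Types (c u w : seq T) (x y : T).

Lemma infix2P x y c : reflect (exists u w, c = u ++ x :: y :: w) (infix [:: x; y] c).
Proof. exact: (@infixP T [:: x; y] c). Qed.

Lemma infix2_rev x y c : infix [:: x; y] (rev c) = infix [:: y; x] c.
Proof. by rewrite -[RHS]infix_rev. Qed.

Lemma infix2_cat x y z u w : infix [:: x; y] (rcons u z ++ w) ->
  [\/ infix [:: x; y] (rcons u z), infix [:: x; y] w | x = z /\ ohead w = Some y].
Proof.
elim: u => [|v u IH].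
  case: w => [|v w] /=; first by constructor 1.
  by case/orP=> [/and3P[/eqP -> /eqP -> _]|]; [constructor 3|constructor 2].
rewrite rcons_cons cat_cons [infix _ (v :: _)]/= => /orP[/andP[xv xy_u]|/IH[xy_u|xy_w|]].
- constructor 1; move: xy_u; rewrite /= xv.
  by case: u {IH} => [|v' u] /= /andP[->]; rewrite !prefix0s.
- by constructor 1; rewrite /= xy_u orbT.
- by constructor 2.
- by constructor 3.
Qed.

Lemma infix2_index x y c : uniq c -> infix [:: x; y] c -> index y c = (index x c).+1.
Proof.
move=> c_uniq /infix2P[u [w cE]]; move: c_uniq; rewrite cE uniq_catC /= => /and3P[].
rewrite !inE !mem_cat !negb_or => /and3P[xy _ xu] /andP[_ yu] _.
by rewrite !index_cat (negbTE xu) (negbTE yu) /= eqxx (negbTE xy) eqxx addn0 addn1.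
Qed.

Lemma infix2_next x y c : uniq c -> infix [:: x; y] c -> next c x = y.
Proof.
move=> c_uniq /infix2P[u [w cE]].
by rewrite -(next_rot (size u)) // cE rot_size_cat /= eqxx.
Qed.

Lemma infix2_prev x y c : uniq c -> infix [:: x; y] c -> prev c y = x.
Proof. by move=> c_uniq xy; rewrite -(infix2_next c_uniq xy) prev_next. Qed.

Lemma infix2_asym x y c : uniq c -> infix [:: x; y] c -> ~~ infix [:: y; x] c.
Proof.
move=> c_uniq xy; apply/negP => yx; have := infix2_index c_uniq xy.
by rewrite (infix2_index c_uniq yx); lia.
Qed.

Lemma infix2_succ s x c : x \in c -> x != last s c -> exists y, infix [:: x; y] c.
Proof.
case/splitPr => u w; rewrite last_cat /=; case: w => [|y w]; first by rewrite eqxx.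
by exists y; apply/infix2P; exists u, w.
Qed.

Lemma infix2_pred s x c : x \in c -> x != head s c -> exists y, infix [:: y; x] c.
Proof.
case/splitPr => u w; case/lastP: u => [|u y]; first by rewrite eqxx.
by exists y; apply/infix2P; exists u, w; rewrite cat_rcons.
Qed.

End Consecutive.

Section HamiltonianPaths.
Variable T : finType.
Implicit Types (c p : seq T) (V A B K : {set T}) (s t x y : T) (e f : rel T).

Definition ham_path e V s t : Prop :=
  exists p, [/\ path e s p, uniq (s :: p), last s p = t & s :: p =i V].

Definition closed_nbh e A : {set T} := A :|: [set x | [exists t in A, e t x]].

Lemma closed_nbhS e A B : A \subset B -> closed_nbh e A \subset closed_nbh e B.
Proof.
move=> sAB; apply/setUSS => //; apply/subsetP=> x; rewrite !inE.
by case/exists_inP => t /(subsetP sAB) tB etx; apply/exists_inP; exists t.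
Qed.

Lemma closed_nbh_subrel e f A : subrel e f -> closed_nbh e A \subset closed_nbh f A.
Proof.
move=> sub_ef; apply/setUS/subsetP=> x; rewrite !inE => /exists_inP[t tA /sub_ef ftx].
by apply/exists_inP; exists t.
Qed.

Definition expands e K (P : pred nat) : Prop :=
  forall A, A \subset K -> P #|A| -> 3 * #|A| < #|closed_nbh e A|.

Lemma expands_subrel e f K (P : pred nat) : subrel e f -> expands e K P -> expands f K P.
Proof.
move=> sub_ef e_exp A AK PA; apply: leq_trans (e_exp A AK PA) _.
exact/subset_leq_card/closed_nbh_subrel.
Qed.

Lemma ham_path_subrel e f V s t : subrel e f -> ham_path e V s t -> ham_path f V s t.
Proof. by move=> sub_ef [p [pp up lp pV]]; exists p; split=> //; apply: sub_path pp. Qed.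

Lemma ham_path_sym e V s t : symmetric e -> ham_path e V s t -> ham_path e V t s.
Proof.
move=> e_sym [p [pp up lp pV]]; exists (rev (belast s p)).
have revE : t :: rev (belast s p) = rev (s :: p) by rewrite [s :: p]lastI rev_rcons lp.
split.
- by rewrite -lp rev_path (eq_path (e' := e)) // => x y; rewrite e_sym.
- by rewrite revE rev_uniq.
- by case: p {pp up pV} lp revE => [|z p] //= _ _; rewrite rev_cons last_rcons.
- by move=> x; rewrite revE mem_rev pV.
Qed.

Lemma ham_path_end e V s t : ham_path e V s t -> t \in V.
Proof. by case=> p [_ _ <- <-]; apply: mem_last. Qed.

Lemma size_uniq_mem c V : uniq c -> c =i V -> size c = #|V|.
Proof. by move=> /card_uniqP <- cV; apply: eq_card. Qed.

Lemma path_rev e x w : symmetric e -> path e x w -> e (last x w) x -> path e x (rev w).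
Proof.
move=> e_sym; case: w => [|y w] //= /andP[_ path_w] lx.
rewrite lastI rev_rcons /= e_sym lx /= rev_path.
by rewrite (eq_path (e' := e)) // => u v; rewrite e_sym.
Qed.

(* Rotating [s .. x y .. t] along the edge [t x] gives [s .. x t .. y]. *)
Lemma sorted_rotation e c x w : symmetric e ->
  sorted e (c ++ x :: w) -> e (last x w) x -> sorted e (c ++ x :: rev w).
Proof.
move=> e_sym; case: c => [|y c]; first exact: path_rev.
by rewrite /= !cat_path => /and3P[-> /= -> path_w]; apply: path_rev.
Qed.

Lemma uniq_rotation c x w : uniq (c ++ x :: rev w) = uniq (c ++ x :: w).
Proof. by apply: perm_uniq; rewrite perm_cat2l perm_cons perm_rev. Qed.

Lemma mem_rotation c x w : c ++ x :: rev w =i c ++ x :: w.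
Proof. by apply: perm_mem; rewrite perm_cat2l perm_cons perm_rev. Qed.

Lemma ham_path_rotate e f V s p y : symmetric f -> subrel e f ->
  path e s p -> uniq (s :: p) -> s :: p =i V ->
  y \in V -> y != s -> f (last s p) (prev (s :: p) y) -> ham_path f V s y.
Proof.
move=> f_sym sub_ef pp up pV yV ys.
have [|x /[dup] xy /infix2P[u [w pE]]] := infix2_pred (s := s) (_ : y \in s :: p) ys.
  by rewrite pV.
rewrite (infix2_prev up xy) -[last s p]/(last s (s :: p)) pE last_cat /= => lx.
have so : sorted f (u ++ x :: rev (y :: w)).
  by apply: sorted_rotation; rewrite // -pE; apply: sub_path pp.
have [q qE] : exists q, u ++ x :: rev (y :: w) = s :: q.
  by case: (u) pE => [|z u'] [-> _]; eexists; rewrite ?cat0s ?cat_cons.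
exists q; rewrite -qE uniq_rotation -pE; split=> //.
- by move: so; rewrite qE.
- by rewrite -[last s q]/(last s (s :: q)) -qE last_cat /= rev_cons last_rcons.
- by move=> z; rewrite mem_rotation -pE pV.
Qed.

End HamiltonianPaths.

Section Posa.
Variables (T : finType) (e : rel T).
Hypothesis e_sym : symmetric e.
Implicit Types (c u w p : seq T) (V A : {set T}) (s t x y : T).

Section Rotations.
Variables (V : {set T}) (s : T) (c0 : seq T).
Hypothesis c0_sorted : sorted e c0.
Hypothesis c0_uniq : uniq c0.
Hypothesis c0_V : c0 =i V.
Hypothesis c0_head : ohead c0 = Some s.

Inductive rotated : seq T -> Prop :=
| rotated0 : rotated c0
| rotatedS u x w : rotated (u ++ x :: w) -> w != [::] -> e (last x w) x ->
    rotated (u ++ x :: rev w).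

Lemma rotated_ham c : rotated c -> [/\ sorted e c, uniq c, c =i V & ohead c = Some s].
Proof.
elim=> {c} [|u x w _ [cs cu cV ch] w0 lx]; first by split.
split; [exact: sorted_rotation|by rewrite uniq_rotation| |by case: u ch {cs cu cV}].
by move=> z; rewrite mem_rotation cV.
Qed.

Definition rotation_ends : {set T} :=
  [set t | `[< exists2 c, rotated c & last s c = t >]].

Local Notation ends := rotation_ends.

Lemma rotation_ends_ham t : t \in ends -> ham_path e V s t.
Proof.
rewrite inE => /asboolP[c /rotated_ham[cs cu cV ch] lt].
by case: c ch cs cu cV lt => // _ p [->] /= cs cu cV lt; exists p.
Qed.

Lemma rotation_end_next u x y w :
  rotated (u ++ x :: y :: w) -> e (last x (y :: w)) x -> y \in ends.
Proof.
move=> rc lx; rewrite inE; apply/asboolP; exists (u ++ x :: rev (y :: w)).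
  by apply: rotatedS.
by rewrite last_cat /= rev_cons last_rcons.
Qed.

(* A rotation deletes only an edge one of whose ends becomes an endpoint. *)
Lemma rotated_keeps_edges x y c : rotated c -> x \notin ends -> y \notin ends ->
  infix [:: x; y] c0 -> infix [:: x; y] c || infix [:: y; x] c.
Proof.
move=> rc xR yR xy; elim: rc => [|u v w rc IH w0 lv]; first by rewrite xy.
case: w w0 rc IH lv => // z w _ rc IH lv.
have zR := rotation_end_next rc lv.
have kept a b : b != z -> infix [:: a; b] (u ++ v :: z :: w) ->
    infix [:: a; b] (u ++ v :: rev (z :: w)) || infix [:: b; a] (u ++ v :: rev (z :: w)).
  rewrite -[u ++ v :: z :: w]cat_rcons -[u ++ v :: rev _]cat_rcons => bz.
  case/infix2_cat => [ab|ab|[_ [/eqP]]].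
  - by rewrite infix_catr.
  - by rewrite orbC infix_catl // infix2_rev.
  - by rewrite eq_sym (negbTE bz).
have xz : x != z by apply: contraNneq xR => ->.
have yz : y != z by apply: contraNneq yR => ->.
case/orP: IH => [|yx]; first exact: kept.
by rewrite orbC; apply: kept.
Qed.

Lemma rotated_successor t x : t \in ends -> e t x -> x \in V -> x \notin ends ->
  exists c y, [/\ rotated c, y \in ends & infix [:: x; y] c].
Proof.
move=> tR etx xV xR; move: (tR); rewrite inE => /asboolP[c rc lt].
have [_ _ cV _] := rotated_ham rc.
have [||y /[dup] xy /infix2P[u [w cE]]] := infix2_succ (s := s) (_ : x \in c) _.
- by rewrite cV.
- by rewrite lt; apply: contraNneq xR => ->.
exists c, y; split=> //; rewrite cE in rc lt.
by apply: rotation_end_next rc _; rewrite [last _ _](_ : _ = t) // -lt last_cat.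
Qed.

(* If both neighbours of [x] on [c0] were outside [ends], they would still be its neighbours on
   every rotated path. *)
Lemma rotation_ends_nbr t x : t \in ends -> e t x -> x \in V -> x \notin ends ->
  exists2 z, z \in ends & infix [:: x; z] c0 || infix [:: z; x] c0.
Proof.
move=> tR etx xV xR.
have [c [y [rc yR xy]]] := rotated_successor tR etx xV xR.
have [_ cu cV ch] := rotated_ham rc.
have not_succ z : z \notin ends -> ~~ infix [:: x; z] c.
  by apply: contraNN => xz; rewrite -(infix2_next cu xz) (infix2_next cu xy).
have [z xz] : exists z, infix [:: x; z] c0.
  apply: (infix2_succ (s := s)); first by rewrite c0_V.
  apply: contraNneq xR => ->; rewrite inE; apply/asboolP; exists c0 => //; exact: rotated0.
have [zR|zR] := boolP (z \in ends); first by exists z; rewrite ?xz.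
have := rotated_keeps_edges rc xR zR xz; rewrite (negbTE (not_succ z zR)) /= => zx_c.
have xs : x != head s c0.
  case: (c0) c0_head => [|_ p] //= [->]; apply/eqP => xs.
  by have := infix2_index cu zx_c; rewrite xs; case: (c) ch => [|_ q] //= [->]; rewrite eqxx.
have [|z' z'x] := infix2_pred _ xs; first by rewrite c0_V.
have [z'R|z'R] := boolP (z' \in ends); first by exists z'; rewrite ?z'x ?orbT.
have := rotated_keeps_edges rc z'R xR z'x; rewrite (negbTE (not_succ z' z'R)) orbF => z'x_c.
have zz' : z = z' by rewrite -(infix2_prev cu zx_c) (infix2_prev cu z'x_c).
by have /negP[] := infix2_asym c0_uniq xz; rewrite zz'.
Qed.

Lemma card_rotation_ends :
  (forall t x, t \in ends -> e t x -> x \in V) -> #|closed_nbh e ends| <= 3 * #|ends|.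
Proof.
move=> nbh_in_V.
have /subset_leq_card/leq_trans : closed_nbh e ends \subset
    ends :|: (next c0 @: ends :|: prev c0 @: ends).
  apply/subsetP => x; rewrite !in_setU; have [//|xR] := boolP (x \in ends).
  rewrite !orFb inE => /exists_inP[t tR etx].
  have [z zR] := rotation_ends_nbr tR etx (nbh_in_V _ _ tR etx) xR.
  case/orP => [/(infix2_prev c0_uniq) <-|/(infix2_next c0_uniq) <-].
    by rewrite [X in _ || X]imset_f ?orbT.
  by rewrite imset_f.
apply; apply: leq_trans (leq_card_setU _ _) _.
have := leq_trans (leq_card_setU (next c0 @: ends) (prev c0 @: ends))
  (leq_add (leq_imset_card (next c0) ends) (leq_imset_card (prev c0) ends)).
by clear; lia.
Qed.

End Rotations.

Theorem Posa_endpoints V s t a :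
  ham_path e V s t ->
  (forall t' x, ham_path e V s t' -> e t' x -> x \in V) ->
  expands e V (fun m => 0 < m <= a) ->
  exists2 S : {set T}, #|S| = a.+1 & forall t', t' \in S -> ham_path e V s t'.
Proof.
move=> [p [pp up lp pV]] nbh_in_V e_exp; pose ends := rotation_ends s (s :: p).
have ends_ham t' : t' \in ends -> ham_path e V s t' by apply: rotation_ends_ham.
have last_end : last s p \in ends.
  by rewrite inE; apply/asboolP; exists (s :: p) => //; apply: rotated0.
have many_ends : a < #|ends|.
  rewrite ltnNge; apply/negP => few_ends; have : 3 * #|ends| < #|closed_nbh e ends|.
    apply: e_exp; first by apply/subsetP => x /ends_ham/ham_path_end.
    by rewrite few_ends andbT card_gt0; apply/set0Pn; exists (last s p).
  rewrite ltnNge (card_rotation_ends (V := V)) // => t' x /ends_ham; exact: nbh_in_V.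
have /set0Pn[S] : [set S : {set T} | S \subset ends & #|S| == a.+1] != set0.
  by rewrite -card_gt0 cards_draws bin_gt0.
by rewrite inE => /andP[sS /eqP cS]; exists S => // t' /(subsetP sS)/ends_ham.
Qed.

End Posa.

Section LongestPath.
Variables (T : finType) (e : rel T) (K : {set T}).
Hypothesis e_sym : symmetric e.
Hypothesis e_in_K : forall x y, e x y -> x \in K.
Implicit Types (c p : seq T) (V A : {set T}) (s t v x : T).

Definition longest V : Prop :=
  V \subset K /\ forall c, sorted e c -> uniq c -> {subset c <= K} -> size c <= #|V|.

Lemma longest_end_nbr V s t x : longest V -> ham_path e V s t -> e t x -> x \in V.
Proof.
move=> [VK V_max] [p [pp up lp pV]] etx; apply: contraT => xV.
have := V_max (rcons (s :: p) x); rewrite size_rcons (size_uniq_mem up pV) ltnn => -> //.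
- by rewrite rcons_cons /= rcons_path pp lp.
- by rewrite rcons_uniq pV xV.
- move=> y; rewrite mem_rcons in_cons => /predU1P[->|]; last by rewrite pV => /(subsetP VK).
  by apply: e_in_K; rewrite e_sym; apply: etx.
Qed.

(* A cycle on [V] with an edge leaving [V] contains a longer path. *)
Lemma longest_cycle_closed V s t v x :
  longest V -> ham_path e V s t -> e t s -> v \in V -> e v x -> x \in V.
Proof.
move=> [VK V_max] [p [pp up lp pV]] ets vV evx; apply: contraT => xV.
have cp : cycle e (s :: p) by rewrite /= rcons_path pp lp.
have [|i q rotE] := @rot_to _ (s :: p) v; first by rewrite pV.
have cq : cycle e (v :: q) by rewrite -rotE rot_cycle.
have uq : uniq (v :: q) by rewrite -rotE rot_uniq.
have qV : v :: q =i V by move=> y; rewrite -rotE mem_rot pV.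
have := V_max (x :: v :: q).
rewrite -[size _]/((size (v :: q)).+1) (size_uniq_mem uq qV) ltnn => -> //.
- by move: cq; rewrite /= rcons_path [e x v]e_sym evx => /andP[-> _].
- by rewrite cons_uniq qV xV.
- move=> y; rewrite in_cons => /predU1P[->|]; last by rewrite qV => /(subsetP VK).
  by apply: e_in_K; rewrite e_sym; apply: evx.
Qed.

Lemma longest_cycle_spans V s t :
  longest V -> ham_path e V s t -> e t s ->
  (forall A, A \proper K -> A != set0 -> exists t' x, [/\ t' \in A, x \in K :\: A & e t' x]) ->
  V = K.
Proof.
move=> V_longest Vst ets connected; have [VK _] := V_longest; apply/eqP.
apply: contraT => VneqK; have [||v [x [vV]]] := connected V.
- by rewrite properEneq VneqK.
- by apply/set0Pn; exists t; apply: ham_path_end Vst.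
- by rewrite inE => /andP[/negP xV _] /(longest_cycle_closed V_longest Vst ets vV).
Qed.

Lemma exists_longest_path : K != set0 ->
  exists s p, [/\ path e s p, uniq (s :: p) & longest [set x in s :: p]].
Proof.
move=> /set0Pn[v vK].
pose P m := `[< exists c, [/\ sorted e c, uniq c, {subset c <= K} & size c = m] >].
have P_one : P 1%N by apply/asboolP; exists [:: v]; split=> // x; rewrite inE => /eqP ->.
have bounded_P m : P m -> m <= #|T|.
  by move=> /asboolP[c [_ /card_uniqP <- _ <-]]; apply: max_card.
have [m /asboolP[c [cs cu cK cm]] m_max] := ex_maxnP (ex_intro _ 1%N P_one) bounded_P.
have m_gt0 := m_max _ P_one.
case: c cs cu cK cm => [|s p] cs cu cK cm; first by rewrite -cm in m_gt0.
exists s, p; split=> //; split; first by apply/subsetP => x; rewrite inE => /cK.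
move=> c c_sorted c_uniq cK'; rewrite -(size_uniq_mem cu (V := [set x in s :: p])); last first.
  by move=> x; rewrite in_set.
by rewrite cm m_max //; apply/asboolP; exists c.
Qed.

End LongestPath.

(** * Estimates *)

Section Estimates.
Local Open Scope ring_scope.
Variable R : realType.
Implicit Types (x z : R) (n s : nat).

Lemma expR_le_quadratic x : 0 <= x <= 1/2 -> expR x <= 1 + x + 2 * x ^+ 2.
Proof.
case/andP=> x0 x1; have : (1 - x) * expR x <= 1.
  by rewrite -ler_pdivlMr ?expR_gt0 // div1r -expRN expR_ge1Dx.
rewrite mulrC -ler_pdivlMr ?subr_gt0; last by lra.
move=> /le_trans; apply; rewrite ler_pdivrMr ?subr_gt0; last by lra.
have : 0 <= x ^+ 2 * (1 - 2 * x) by rewrite mulr_ge0 ?sqr_ge0 //; lra.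
by rewrite !expr2; lra.
Qed.

Lemma expR1_ge2 : 2 <= expR 1 :> R.
Proof. by have := @expR_ge1Dx R 1; lra. Qed.

Lemma exprn2_le_expR n : 2 ^+ n <= expR n%:R :> R.
Proof. by rewrite -[n%:R]mulr1 expRM_natl lerXn2r ?nnegrE ?expR_ge0 ?expR1_ge2. Qed.

Lemma expRN_le_quadratic x : 0 <= x -> expR (- x) <= 1 - x + x ^+ 2.
Proof.
move=> x0; have : expR (- x) * (1 + x) <= 1.
  by rewrite expRN mulrC ler_pdivrMr ?expR_gt0 // mul1r expR_ge1Dx.
rewrite -ler_pdivlMr ?ltr_wpDr // => /le_trans; apply.
rewrite ler_pdivrMr ?ltr_wpDr // !expr2.
by have := mulr_ge0 x0 (mulr_ge0 x0 x0); lra.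
Qed.

Lemma expR1_le4 : expR 1 <= 4 :> R.
Proof.
have half_le2 : expR (1/2) <= 2 :> R.
  by apply: le_trans (expR_le_quadratic _) _; rewrite ?expr2; lra.
have -> : 1 = 2%:R * (1/2) :> R by field.
rewrite expRM_natl expr2; apply: le_trans (ler_pM _ _ half_le2 half_le2) _ => //; lra.
Qed.

Lemma card_set_type (T : finType) : #|{set T}| = (2 ^ #|T|)%N.
Proof. by rewrite -[LHS]cardsT -powersetT card_powerset cardsT. Qed.

Lemma bin2_le_half_sqr n : 'C(n, 2)%:R <= n%:R ^+ 2 / 2 :> R.
Proof.
rewrite ler_pdivlMr // -natrM -natrX ler_nat bin2 muln2.
apply: leq_trans (_ : n * n.-1 <= _)%N; last by rewrite -mulnn leq_mul2l leq_pred orbT.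
by rewrite -[leqRHS]odd_double_half leq_addl.
Qed.

Lemma bin_expn_le n s : (s <= n)%N -> 'C(n, s)%:R * (s%:R / n%:R) ^+ s <= 4 ^+ s :> R.
Proof.
case: n => [|n] sn; first by move: sn; rewrite leqn0 => /eqP ->; rewrite bin0 !expr0 mulr1.
set x : R := s%:R / n.+1%:R; have x0 : 0 <= x by rewrite divr_ge0.
have : 'C(n.+1, s)%:R * x ^+ s <= (x + 1) ^+ n.+1.
  rewrite exprD1n (bigD1 (Ordinal (sn : (s < n.+2)%N))) //= mulr_natl lerDl.
  by apply: sumr_ge0 => i _; rewrite mulrn_wge0 ?exprn_ge0.
move=> /le_trans; apply; apply: (@le_trans _ _ (expR x ^+ n.+1)).
  by rewrite lerXn2r ?nnegrE ?addr_ge0 ?expR_ge0 // addrC expR_ge1Dx.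
rewrite -expRM_natl mulrC /x divfK ?pnatr_eq0 // -[s%:R]mulr1 expRM_natl.
by rewrite lerXn2r ?nnegrE ?expR_ge0 ?expR1_le4.
Qed.

Lemma bin_le_expn n s x : (0 < s <= n)%N -> n%:R <= s%:R * x -> 'C(n, s)%:R <= (4 * x) ^+ s.
Proof.
case/andP=> s0 sn n_le; have n0 : 0 < n%:R :> R by rewrite ltr0n (leq_trans s0).
have s0r : 0 < s%:R :> R by rewrite ltr0n.
have x0 : 0 < x by rewrite -(pmulr_rgt0 _ s0r) (lt_le_trans n0).
apply: (@le_trans _ _ ('C(n, s)%:R * (s%:R / n%:R * x) ^+ s)).
  by rewrite ler_peMr // exprn_ege1 // mulrAC ler_pdivlMr // mul1r.
by rewrite [leRHS]exprMn [(_ * x) ^+ s]exprMn mulrA ler_wpM2r ?exprn_ge0 ?(ltW x0) // bin_expn_le.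
Qed.

Lemma expn_self_le (A : R) n s : (0 < s)%N -> 0 < A * s%:R / n%:R <= 1/2 ->
  (A * s%:R / n%:R) ^+ s <= A / n%:R.
Proof.
case: s => // s _ /andP[w0 w1]; set w := A * _ / _ in w0 w1 *.
have small : s.+1%:R * w ^+ s <= 1.
  apply: le_trans (_ : s.+1%:R * (1/2) ^+ s <= _).
    by rewrite ler_wpM2l // lerXn2r ?nnegrE // ltW.
  rewrite expr_div_n expr1n mul1r ler_pdivrMr ?exprn_gt0 // mul1r -natrX ler_nat.
  by rewrite ltn_expl.
have A0 : 0 <= A / n%:R by rewrite -(pmulr_lge0 _ (ltr0Sn R s)) mulrAC ltW.
have -> : w ^+ s.+1 = (A / n%:R) * (s.+1%:R * w ^+ s) by rewrite exprS {1}/w; ring.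
by rewrite ler_piMr.
Qed.

Lemma exists_lt_average (K : finType) (w f : K -> R) (c : R) :
  (forall i, 0 <= w i) -> \sum_i w i = 1 -> \sum_i w i * f i < c ->
  exists2 i, 0 < w i & f i < c.
Proof.
move=> w0 w1; apply: contraPP => no_i; apply/negP; rewrite -leNgt -[leLHS]mul1r -w1 mulr_suml.
apply: ler_sum => i _; have [fi|fi] := leP c (f i); first exact: ler_wpM2l.
have [wi|wi] := ltP 0 (w i); first by case: no_i; exists i.
have -> : w i = 0 by apply/eqP; rewrite eq_le wi w0.
by rewrite !mul0r.
Qed.

Lemma ler_sum_card (J : finType) (F : J -> R) x :
  (forall i, F i <= x) -> \sum_i F i <= #|J|%:R * x.
Proof. by move=> F_le; rewrite mulr_natl -sumr_const; apply: ler_sum. Qed.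

Lemma sum_invbin_card (T : finType) :
  \sum_(X : {set T} | X != set0) 'C(#|T|, #|X|)%:R^-1 = #|T|%:R :> R.
Proof.
rewrite (partition_big (fun X : {set T} => inord #|X| : 'I_#|T|.+1) predT) //=.
rewrite big_ord_recl big_pred0 ?add0r => [|X]; last first.
  have [->|X0] := eqVneq X set0; rewrite //= -val_eqE /= inordK ?ltnS ?max_card //.
  by rewrite cards_eq0 (negbTE X0).
rewrite (eq_bigr (fun=> 1)) => [|s _]; first by rewrite sumr_const card_ord.
have sizeE (X : {set T}) : (X != set0) && (inord #|X| == lift ord0 s) = (#|X| == s.+1).
  rewrite -[inord _ == _]val_eqE /= inordK ?ltnS ?max_card // -card_gt0.
  by case: eqP => [->|]; rewrite ?andbF.
rewrite (eq_bigl _ _ sizeE) (eq_bigr (fun=> 'C(#|T|, s.+1)%:R^-1)) => [|X /eqP -> //].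
rewrite sumr_const; have -> : #|[pred X : {set T} | #|X| == s.+1]| = 'C(#|T|, s.+1).
  by rewrite -card_draws; apply: eq_card => X; rewrite !inE.
by rewrite -[LHS]mulr_natl mulfV // pnatr_eq0 -lt0n bin_gt0.
Qed.

Lemma sum_expn_small_subsets (I : finType) (U : {set I}) (p z g : R) : 0 <= p -> 0 < z <= 1 ->
  \sum_(S : {set I} | (S \subset U) && (#|S|%:R <= g)) p ^+ #|S| <=
  expR (p * z * #|U|%:R + g * ln z^-1).
Proof.
move=> p0 /andP[z0 z1]; have pz0 : 0 <= p * z by rewrite mulr_ge0 // ltW.
have lnz : 0 <= ln z^-1 by rewrite ln_ge0 // invf_ge1.
have small_le (S : {set I}) : #|S|%:R <= g -> p ^+ #|S| <= (p * z) ^+ #|S| * expR (g * ln z^-1).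
  move=> Sg; rewrite exprMn -mulrA ler_peMr ?exprn_ge0 //.
  have -> : z ^+ #|S| = expR (- (#|S|%:R * ln z^-1)).
    by rewrite lnV ?posrE // mulrN opprK expRM_natl lnK.
  by rewrite -expRD -[leLHS]expR0 ler_expR addrC subr_ge0 ler_wpM2r.
apply: (@le_trans _ _ (\sum_(S : {set I})
    expR (g * ln z^-1) * \prod_e (if e \in S then (if e \in U then p * z else 0) else 1))).
  rewrite big_mkcond /=; apply: ler_sum => S _; case: ifP => [/andP[SU /small_le]|_].
    rewrite mulrC => /le_trans; apply; rewrite ler_wpM2l ?expR_ge0 // -prodr_const big_mkcond /=.
    by apply: ler_prod => e _; case: ifP => [/(subsetP SU) ->|_]; rewrite ?pz0 lexx ?ler01.
  by rewrite mulr_ge0 ?expR_ge0 // prodr_ge0 // => e _; do 2![case: ifP => // _].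
rewrite -mulr_sumr -bigA_distr /= addrC expRD ler_wpM2l ?expR_ge0 //.
apply: (@le_trans _ _ (\prod_e (if e \in U then expR (p * z) else 1))).
  apply: ler_prod => e _; case: ifP => _; last by rewrite add0r lexx ler01.
  by rewrite addr_ge0 //= addrC expR_ge1Dx.
by rewrite -big_mkcond /= prodr_const -expRM_natl mulrC.
Qed.

Lemma expRN_le_divX m : exists c : R, forall x, 0 < x -> expR (- x) <= c / x ^+ m.+1.
Proof.
exists (m.+1)`!%:R => x x_gt0; rewrite expRN -[leRHS]invrK lef_pV2 ?posrE ?expR_gt0 //; last first.
  by rewrite invr_gt0 divr_gt0 ?exprn_gt0 // ltr0n fact_gt0.
by rewrite invf_div; apply: le_trans (expR_ge1Dxn m (ltW x_gt0)); rewrite lerDr.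
Qed.

Lemma expRN_sqrt_le_divX a m : 0 < a ->
  exists c : R, forall x, 0 < x -> expR (- (Num.sqrt x / a)) <= c / x ^+ m.+1.
Proof.
move=> a_gt0; have [c expR_le] := expRN_le_divX (2 * m).+1.
exists (c * a ^+ (2 * m.+1)) => x x_gt0.
have sqrt_gt0 : 0 < Num.sqrt x / a by rewrite divr_gt0 // sqrtr_gt0.
apply: le_trans (expR_le _ sqrt_gt0) _; have -> : ((2 * m).+2 = 2 * m.+1)%N by rewrite mulnS.
by rewrite expr_div_n [Num.sqrt x ^+ _]exprM sqr_sqrtr ?(ltW x_gt0) // invf_div mulrA.
Qed.

End Estimates.

(** * Random subsets *)

Section RandomSubset.
Local Open Scope ring_scope.
Variables (R : realType) (I : finType) (p : R) (U : {set I}).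
Hypothesis p01 : 0 <= p <= 1.
Implicit Types (E Q W S : {set I}) (A B : pred {set I}) (e : I) (l x : R).

Let p_ge0 : 0 <= p. Proof. by case/andP: p01. Qed.
Let p_le1 : p <= 1. Proof. by case/andP: p01. Qed.

(* Elements of [U] are kept independently with probability [p], the others never. *)
Definition bernoulli_weight E : R :=
  \prod_(e : I) (if e \in E then (if e \in U then p else 0) else (if e \in U then 1 - p else 1)).

Definition Pr A : R := \sum_(E : {set I} | A E) bernoulli_weight E.

Lemma bernoulli_weight_ge0 E : 0 <= bernoulli_weight E.
Proof.
apply: prodr_ge0 => e _; case: ifP => _; case: ifP => _ //.
by rewrite subr_ge0.
Qed.

Lemma bernoulli_weight_support E : ~~ (E \subset U) -> bernoulli_weight E = 0.
Proof.
case/subsetPn => e eE eU; rewrite /bernoulli_weight (bigD1 e) //= eE (negbTE eU).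
by rewrite mul0r.
Qed.

Lemma expectation_prod (c d : I -> R) :
  \sum_(E : {set I}) bernoulli_weight E * \prod_(e : I) (if e \in E then c e else d e) =
  \prod_(e in U) (p * c e + (1 - p) * d e) * \prod_(e in ~: U) d e.
Proof.
transitivity (\prod_(e : I)
    ((if e \in U then p else 0) * c e + (if e \in U then 1 - p else 1) * d e)).
  rewrite bigA_distr; apply: eq_bigr => E _.
  by rewrite /bernoulli_weight -big_split /=; apply: eq_bigr => e _; case: (e \in E).
rewrite (bigID (mem U)) /=; congr (_ * _); first by apply: eq_bigr => e ->.
apply: eq_big => [e|e /negbTE ->]; first by rewrite inE.
by rewrite mul0r add0r mul1r.
Qed.

Lemma sum_bernoulli_weight : \sum_(E : {set I}) bernoulli_weight E = 1.
Proof.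
have := expectation_prod (fun=> 1) (fun=> 1).
rewrite (eq_bigr bernoulli_weight); last first.
  by move=> E _; rewrite big1 ?mulr1 // => e _; case: ifP.
move=> ->; rewrite [X in _ * X]big1 // mulr1 big1 // => e _.
by rewrite !mulr1 addrC subrK.
Qed.

Lemma expectation_mem e : e \in U ->
  \sum_(E : {set I}) bernoulli_weight E * (e \in E)%:R = p.
Proof.
move=> eU; have := expectation_prod (fun=> 1) (fun i => (i != e)%:R).
rewrite [X in _ = _ * X]big1 ?mulr1; last first.
  by move=> i; rewrite inE => iU; rewrite (contraNneq _ iU) // => ->.
rewrite (bigD1 e eU) /= eqxx /= mulr0 addr0 [X in _ = _ * X]big1 ?mulr1; last first.
  by move=> i /andP[_ ->]; rewrite mulr1 addrC subrK.
move=> <-; apply: eq_bigr => E _; congr (_ * _); have [eE|eE] := boolP (e \in E).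
  by rewrite big1 // => i _; case: ifP => // /negbT iE; rewrite (contraNneq _ iE) // => ->.
by rewrite (bigD1 e) //= (negbTE eE) eqxx mul0r.
Qed.

Lemma expectation_card S : S \subset U ->
  \sum_(E : {set I}) bernoulli_weight E * #|E :&: S|%:R = p * #|S|%:R.
Proof.
move=> SU; transitivity (\sum_(E : {set I}) \sum_(e in S) bernoulli_weight E * (e \in E)%:R).
  apply: eq_bigr => E _; rewrite -mulr_sumr; congr (_ * _).
  rewrite -natr_sum -big_mkcondr sum1_card; congr (_ %:R).
  by apply: eq_card => e; rewrite !inE andbC.
rewrite exchange_big /= (eq_bigr (fun=> p)) => [|e /(subsetP SU)/expectation_mem //].
by rewrite sumr_const mulr_natr.
Qed.

Lemma Pr_ge0 A : 0 <= Pr A.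
Proof. by apply: sumr_ge0 => E _; apply: bernoulli_weight_ge0. Qed.

Lemma Pr_le A B : (forall E, E \subset U -> A E -> B E) -> Pr A <= Pr B.
Proof.
move=> AB; rewrite /Pr big_mkcond [leRHS]big_mkcond /=; apply: ler_sum => E _.
have [sE|/bernoulli_weight_support ->] := boolP (E \subset U); last by do 2!case: ifP.
by case: ifP => [/(AB E sE) ->//|_]; case: ifP => // _; apply: bernoulli_weight_ge0.
Qed.

Lemma Pr_or A B : Pr (fun E => A E || B E) <= Pr A + Pr B.
Proof.
rewrite /Pr [X in X + _]big_mkcond [X in _ + X]big_mkcond -big_split /= [leLHS]big_mkcond /=.
apply: ler_sum => E _; have := bernoulli_weight_ge0 E.
by case: (A E); case: (B E) => /= w0; rewrite ?addr0 ?add0r // lerDl.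
Qed.

Lemma Pr_exists (J : finType) (P : pred J) (A : J -> pred {set I}) :
  Pr (fun E => [exists (i | P i), A i E]) <= \sum_(i | P i) Pr (A i).
Proof.
rewrite /Pr (exchange_big_dep predT) //= [leLHS]big_mkcond /=; apply: ler_sum => E _.
rewrite sumr_const; case: ifP => [/exists_inP[i Pi AE]|_].
  rewrite -[leLHS]mulr1n ler_wpMn2l ?bernoulli_weight_ge0 //.
  by apply/card_gt0P; exists i; rewrite unfold_in Pi.
by rewrite mulrn_wge0 ?bernoulli_weight_ge0.
Qed.

Lemma Pr_le_prod A (k : R) (c d : I -> R) :
  0 <= k -> (forall e, 0 <= c e) -> (forall e, 0 <= d e) ->
  (forall E, E \subset U -> A E -> 1 <= k * \prod_(e : I) (if e \in E then c e else d e)) ->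
  Pr A <= k * (\prod_(e in U) (p * c e + (1 - p) * d e) * \prod_(e in ~: U) d e).
Proof.
move=> k0 c0 d0 A_large; rewrite -expectation_prod mulr_sumr /Pr big_mkcond /=.
apply: ler_sum => E _; rewrite mulrCA.
have prod_ge0 : 0 <= k * \prod_(e : I) (if e \in E then c e else d e).
  by rewrite mulr_ge0 // prodr_ge0 // => e _; case: ifP.
have [sE|/bernoulli_weight_support ->] := boolP (E \subset U); last by rewrite mul0r; case: ifP.
case: ifP => [/(A_large E sE) ge1|_]; last by rewrite mulr_ge0 ?bernoulli_weight_ge0.
by rewrite ler_peMr ?bernoulli_weight_ge0.
Qed.

Lemma Pr_disjoint W : W \subset U -> Pr (fun E => E :&: W == set0) = (1 - p) ^+ #|W|.
Proof.
move=> WU; transitivity (\sum_(E : {set I}) bernoulli_weight E *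
    \prod_(e : I) (if e \in E then (e \notin W)%:R else 1)).
  rewrite /Pr big_mkcond /=; apply: eq_bigr => E _; have [/setP EW|/set0Pn[e]] := eqVneq.
    rewrite big1 ?mulr1 // => e _; case: ifP => // eE.
    by have := EW e; rewrite !inE eE => /= ->.
  by rewrite inE => /andP[eE eW]; rewrite (bigD1 e) //= eE eW mul0r mulr0.
rewrite expectation_prod [X in _ * X]big1 ?mulr1 // -prodr_const (big_setID W) /=.
rewrite (setIidPr WU) [X in _ * X]big1 ?mulr1; last first.
  by move=> e; rewrite inE => /andP[-> _]; rewrite mulr1 addrC subrK.
by apply: eq_bigr => e ->; rewrite mulr0 add0r.
Qed.

Lemma prodr_if_mem S W x : \prod_(e in S) (if e \in W then x else 1) = x ^+ #|S :&: W|.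
Proof.
rewrite -big_mkcondr /= prodr_const; congr (_ ^+ _).
by apply: eq_card => e; rewrite !inE.
Qed.

Lemma expR_card_setI S E l :
  expR (l * #|E :&: S|%:R) = \prod_(e : I) (if e \in E then (if e \in S then expR l else 1) else 1).
Proof. by rewrite mulrC expRM_natl -prodr_if_mem big_mkcond. Qed.

Lemma prod_le_expR S W (f : I -> R) x : S \subset W -> (forall e, 0 <= f e) ->
  (forall e, e \in W -> f e <= if e \in S then expR x else 1) ->
  \prod_(e in W) f e <= expR (#|S|%:R * x).
Proof.
move=> SW f0 f_le; rewrite expRM_natl -(setIidPr SW) -prodr_if_mem.
by apply: ler_prod => e eW; rewrite f0 f_le.
Qed.

(* The Chernoff bound comes with the factor [p ^+ #|S|], which pays for the union bound over [S]. *)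
Lemma Pr_superset_few S Q l x : S \subset U -> Q \subset U -> 0 <= l ->
  Pr (fun E => (S \subset E) && (#|E :&: Q|%:R <= x)) <=
  p ^+ #|S| * expR (l * x - p * #|Q :\: S|%:R * (l - l ^+ 2)).
Proof.
move=> SU QU l0.
pose c e : R := if e \in Q :\: S then expR (- l) else 1.
pose d e : R := (e \notin S)%:R.
have c0 e : 0 <= c e by rewrite /c; case: ifP; rewrite ?expR_ge0.
apply: le_trans (Pr_le_prod (k := expR (l * x)) (c := c) (d := d) _ _ _ _) _ => //.
  move=> E _ /andP[SE few]; rewrite (eq_bigr (fun e => if e \in E then c e else 1)).
    rewrite -expR_card_setI -expRD -[leLHS]expR0 ler_expR mulNr -mulrBr mulr_ge0 // subr_ge0.
    by apply: le_trans few; rewrite ler_nat subset_leq_card // setIS // subsetDl.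
  by move=> e _; case: ifP => // /negbT eE; rewrite /d (contraNN (subsetP SE e) eE).
rewrite [X in _ * (_ * X)]big1 ?mulr1; last first.
  by move=> e; rewrite inE /d => eU; rewrite (contraNN (subsetP SU e) eU).
rewrite (big_setID S) /= (setIidPr SU) (eq_bigr (fun=> p)); last first.
  by move=> e eS; rewrite /c /d inE eS /= mulr1 mulr0 addr0.
rewrite prodr_const mulrCA ler_wpM2l ?exprn_ge0 // expRD ler_wpM2l ?expR_ge0 //.
have -> : - (p * #|Q :\: S|%:R * (l - l ^+ 2)) = #|Q :\: S|%:R * - (p * (l - l ^+ 2)) by ring.
apply: prod_le_expR; first exact: setSD.
  by move=> e; rewrite addr_ge0 // mulr_ge0 // subr_ge0.
move=> e; rewrite inE => /andP[eS _]; rewrite /d eS mulr1 /c.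
case: ifP => _; last by rewrite mulr1 addrC subrK.
have := ler_wpM2l p_ge0 (expRN_le_quadratic l0).
by have := expR_ge1Dx (- (p * (l - l ^+ 2))); lra.
Qed.

Lemma Pr_many Q l x : Q \subset U -> 0 <= l ->
  Pr (fun E => x <= #|E :&: Q|%:R) <= expR (p * #|Q|%:R * (expR l - 1) - l * x).
Proof.
move=> QU l0; pose c e : R := if e \in Q then expR l else 1.
have c0 e : 0 <= c e by rewrite /c; case: ifP; rewrite ?expR_ge0.
apply: le_trans (Pr_le_prod (k := expR (- (l * x))) (c := c) (d := fun=> 1) _ _ _ _) _ => //.
  move=> E _ many; rewrite -expR_card_setI -expRD -[leLHS]expR0 ler_expR addrC -mulrBr.
  by rewrite mulr_ge0 // subr_ge0.
rewrite [X in _ * (_ * X)]big1 ?mulr1 // [in leRHS]addrC expRD ler_wpM2l ?expR_ge0 //.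
rewrite [p * _]mulrC -mulrA; apply: prod_le_expR => // e.
  by rewrite addr_ge0 ?subr_ge0 // mulr_ge0.
rewrite /c; case: ifP => _ _; last by rewrite mulr1 addrC subrK.
by have := expR_ge1Dx (p * (expR l - 1)); lra.
Qed.

End RandomSubset.

Section HittingSubset.
Local Open Scope ring_scope.
Variables (R : realType) (I J : finType) (F : {set I}) (W : J -> {set I}) (P : pred J).
Variable q : R.
Hypothesis q_gt0 : 0 < q.
Hypothesis q_le1 : q <= 1.
Hypothesis sWF : forall j, P j -> W j \subset F.

Let q01 : 0 <= q <= 1. Proof. by rewrite ltW. Qed.

Definition missed (E : {set I}) : {set J} := [set j | P j & E :&: W j == set0].

Lemma expectation_missed :
  \sum_(E : {set I}) bernoulli_weight q F E * #|missed E|%:R = \sum_(j | P j) (1 - q) ^+ #|W j|.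
Proof.
transitivity (\sum_(E : {set I}) \sum_(j | P j) bernoulli_weight q F E * (E :&: W j == set0)%:R).
  apply: eq_bigr => E _; rewrite -mulr_sumr; congr (_ * _).
  rewrite -natr_sum -big_mkcondr sum1_card; congr (_ %:R).
  by apply: eq_card => j; rewrite !inE.
rewrite exchange_big /=; apply: eq_bigr => j /sWF /(Pr_disjoint q) <-.
rewrite /Pr [in RHS]big_mkcond /=; apply: eq_bigr => E _.
by case: ifP; rewrite ?mulr1 ?mulr0.
Qed.

Lemma exists_hitting_subset (B mu : R) : 0 < B -> #|F|%:R <= B -> 0 < mu ->
  \sum_(j | P j) (1 - q) ^+ #|W j| <= mu ->
  exists F' : {set I}, [/\ F' \subset F, #|F'|%:R <= 3 * q * B & #|missed F'|%:R < 2 * mu].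
Proof.
move=> B0 FB mu0 sum_mu.
have B3 : 0 < 3 * q * B by rewrite !mulr_gt0.
have mu2 : 0 < 2 * mu by rewrite mulr_gt0.
pose f (E : {set I}) : R := #|E :&: F|%:R / (3 * q * B) + #|missed E|%:R / (2 * mu).
have average_f : \sum_E bernoulli_weight q F E * f E < 1.
  under eq_bigr do rewrite mulrDr !mulrA.
  rewrite big_split /= -!mulr_suml expectation_card // expectation_missed.
  have few_kept : q * #|F|%:R / (3 * q * B) <= 1 / 3.
    by rewrite ler_pdivrMr // mulrC; have := ler_wpM2l (ltW q_gt0) FB; lra.
  have few_missed : (\sum_(j | P j) (1 - q) ^+ #|W j|) / (2 * mu) <= 1 / 2.
    by rewrite ler_pdivrMr //; lra.
  by apply: le_lt_trans (lerD few_kept few_missed) _; lra.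
have [F' w_gt0 fF'] := exists_lt_average (bernoulli_weight_ge0 F q01)
  (sum_bernoulli_weight q F) average_f.
have sF' : F' \subset F by apply: contraLR w_gt0 => /bernoulli_weight_support ->; rewrite ltxx.
exists F'; split=> //; move: fF'; rewrite /f (setIidPl sF') => f_lt1.
- rewrite -[leRHS]mul1r -ler_pdivrMr //; apply: le_trans (ltW f_lt1).
  by rewrite lerDl divr_ge0 // ltW.
- rewrite -[ltRHS]mul1r -ltr_pdivrMr //; apply: le_lt_trans f_lt1.
  by rewrite lerDr divr_ge0 // ltW.
Qed.

Lemma exprn_subr_le_expR (m : nat) (x : R) : x <= m%:R -> (1 - q) ^+ m <= expR (- (q * x)).
Proof.
move=> x_le; apply: (@le_trans _ _ (expR (- q) ^+ m)).
  by rewrite lerXn2r ?nnegrE ?expR_ge0 ?subr_ge0 // expR_ge1Dx.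
by rewrite -expRM_natl ler_expR mulrN lerN2 mulrC ler_wpM2r // ltW.
Qed.

End HittingSubset.

(** * Edge counts of random graphs *)

Section Pairs.
Variable T : finType.
Implicit Types (A X : {set T}) (E : {set {set T}}).

Definition pairs : {set {set T}} := [set e : {set T} | #|e| == 2%N].
Definition edges_in E X : {set {set T}} := [set e in E | e \subset X].
Definition edges_meeting E X : {set {set T}} := [set e in E | ~~ [disjoint e & X]].

Lemma card_pairs : #|pairs| = 'C(#|T|, 2).
Proof. exact: card_draws. Qed.

Lemma card_edges_in_pairs X : #|edges_in pairs X| = 'C(#|X|, 2).
Proof. by rewrite -cards_draws; apply: eq_card => e; rewrite !inE andbC. Qed.

Lemma edges_in_pairs X : edges_in pairs X \subset pairs.
Proof. by apply/subsetP=> e; rewrite inE => /andP[]. Qed.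

Lemma edges_meeting_pairs X : edges_meeting pairs X \subset pairs.
Proof. by apply/subsetP=> e; rewrite inE => /andP[]. Qed.

Lemma edges_inE E X : E \subset pairs -> edges_in E X = E :&: edges_in pairs X.
Proof.
move=> sE; apply/setP=> e; rewrite !inE.
by case: (boolP (e \in E)) => //= /(subsetP sE); rewrite inE => ->.
Qed.

Lemma edges_meetingE E X : E \subset pairs -> edges_meeting E X = E :&: edges_meeting pairs X.
Proof.
move=> sE; apply/setP=> e; rewrite !inE.
by case: (boolP (e \in E)) => //= /(subsetP sE); rewrite inE => ->.
Qed.

Definition star_pairs A (X : T -> {set T}) : {set T * T} :=
  [set u | (u.1 \in A) && (u.2 \in X u.1)].

Definition stars A (X : T -> {set T}) : {set {set T}} :=
  [set [set u.1; u.2] | u in star_pairs A (fun t => X t :\: A)].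

Lemma star_pairs_inj A (X : T -> {set T}) :
  {in star_pairs A (fun t => X t :\: A) &, injective (fun u : T * T => [set u.1; u.2])}.
Proof.
move=> [a b] [c d]; rewrite !inE /= => /and3P[aA bA _] /and3P[cA dA _] /setP eq_set.
have := eq_set a; have := eq_set b; rewrite !inE !eqxx /= orbT => /esym b_in /esym a_in.
congr (_, _).
  by case/orP: a_in => /eqP // ad; rewrite -ad aA in dA.
by case/orP: b_in => /eqP // bc; rewrite bc cA in bA.
Qed.

Lemma stars_sub_pairs A (X : T -> {set T}) : stars A X \subset pairs.
Proof.
apply/subsetP=> e /imsetP[[a b]]; rewrite !inE /= => /and3P[aA bA _] ->; rewrite cards2.
by rewrite (_ : a != b) //; apply: contraNneq bA => <-.
Qed.

Lemma card_star_pairs A (X : T -> {set T}) : #|star_pairs A X| = \sum_(t in A) #|X t|.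
Proof.
rewrite -sum1_card (eq_bigl (fun u : T * T => (u.1 \in A) && (u.2 \in X u.1))).
  rewrite -(pair_big_dep (mem A) (fun t => mem (X t)) (fun _ _ => 1)) /=.
  by apply: eq_bigr => t _; rewrite sum1_card.
by move=> u; rewrite inE.
Qed.

Lemma card_stars A (X : T -> {set T}) : #|stars A X| = \sum_(t in A) #|X t :\: A|.
Proof. by rewrite card_in_imset ?card_star_pairs //; apply: star_pairs_inj. Qed.

Lemma card_edges_meeting_pairs X : #|X| * (#|T| - #|X|) <= #|edges_meeting pairs X|.
Proof.
rewrite -cardsT -sum_nat_const -cardsDS ?subsetT // -(card_stars X (fun=> setT)).
apply/subset_leq_card/subsetP => e e_star; rewrite inE (subsetP (stars_sub_pairs _ _) _ e_star).
case/imsetP: e_star => -[x y]; rewrite inE /= => /andP[xX _] ->.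
by apply/pred0Pn; exists x; rewrite !inE eqxx xX.
Qed.

End Pairs.

Section RandomGraph.
Local Open Scope ring_scope.
Variables (R : realType) (T : finType) (p : R).
Hypothesis p01 : 0 <= p <= 1.
Implicit Types (E S Q : {set {set T}}) (X Y : {set T}) (J : finType).

Let p_ge0 : 0 <= p. Proof. by case/andP: p01. Qed.
Let p_le1 : p <= 1. Proof. by case/andP: p01. Qed.

Notation n := #|T|.
Notation pairs := (pairs T).
Notation Pr := (Pr p pairs).
Notation B := (p * n%:R ^+ 2 : R).

Lemma card_pairs_le : #|pairs|%:R <= n%:R ^+ 2 :> R.
Proof.
rewrite card_pairs; apply: le_trans (bin2_le_half_sqr _ _) _.
by rewrite ler_pdivrMr // ler_peMr ?exprn_ge0 // ler1n.
Qed.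

Lemma Pr_dense_set X (h y : R) (m : nat) : m%:R <= h -> 0 < y <= 1 -> 2 * #|X|%:R * p <= h * y ->
  Pr (fun E => h * #|X|%:R <= #|E :&: edges_in pairs X|%:R) <= y ^+ (m * #|X|).
Proof.
move=> mh /andP[y0 y1] hy; set s : R := #|X|%:R in hy *.
have s0 : 0 <= s by rewrite /s.
have y4 : 1 <= 4 / y by rewrite ler_pdivlMr // mul1r; lra.
apply: le_trans (Pr_many p01 (h * s) (edges_in_pairs X) (ln_ge0 y4)) _.
rewrite lnK ?posrE ?divr_gt0 //; set L := ln (4 / y).
have mean_le : p * #|edges_in pairs X|%:R * (4 / y - 1) <= h * s.
  apply: le_trans (_ : p * (s ^+ 2 / 2) * (4 / y) <= _).
    apply: ler_pM; rewrite ?mulr_ge0 ?subr_ge0 //; last by rewrite lerBlDr lerDl.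
    by rewrite ler_wpM2l // card_edges_in_pairs bin2_le_half_sqr.
  have -> : p * (s ^+ 2 / 2) * (4 / y) = s * (2 * s * p) / y by field; rewrite gt_eqF.
  by rewrite ler_pdivrMr //; have := ler_wpM2l s0 hy; lra.
have eL : expR (1 - L) <= y.
  rewrite expRB lnK ?posrE ?divr_gt0 // invf_div mulrA ler_pdivrMr // mulrC.
  by rewrite ler_wpM2l ?expR1_le4 // ltW.
have L1 : 1 - L <= 0 by rewrite -ler_expR expR0; apply: le_trans y1.
apply: le_trans (_ : expR ((m * #|X|)%:R * (1 - L)) <= _); last first.
  by rewrite expRM_natl lerXn2r ?nnegrE ?expR_ge0 // ltW.
have := ler_wnM2r L1 (ler_wpM2r s0 mh).
by rewrite ler_expR natrM -/s; lra.
Qed.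

Lemma dense_term_le (A b w : R) (j s : nat) : (0 < s <= n)%N -> 0 < A -> b <= 1/2 ->
  4 * A * b ^+ j <= 1 -> w = A * s%:R / n%:R -> w <= b ->
  w ^+ ((2 * j + 1) * s) <= 'C(n, s)%:R^-1 * (A / n%:R) ^+ j.
Proof.
case/andP=> s0 sn A0 b12 Ab wE wb.
have n0 : 0 < n%:R :> R by rewrite ltr0n (leq_trans s0).
have w0 : 0 < w by rewrite wE !mulr_gt0 ?invr_gt0 // ltr0n.
have b0 : 0 <= b by apply: le_trans (ltW w0) wb.
have Cw : 'C(n, s)%:R * w ^+ s <= (4 * A) ^+ s.
  rewrite wE -mulrA [(A * _) ^+ s]exprMn mulrCA [leRHS]exprMn [leRHS]mulrC.
  by rewrite ler_wpM2l ?exprn_ge0 ?(ltW A0) ?bin_expn_le.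
have -> : w ^+ ((2 * j + 1) * s) = w ^+ s * (w ^+ j) ^+ s * (w ^+ s) ^+ j.
  by rewrite -!exprM -!exprD; congr (_ ^+ _); clear; lia.
rewrite -ler_pdivrMl ?invr_gt0 ?ltr0n ?bin_gt0 // invrK !mulrA -[leRHS]mul1r.
apply: ler_pM; rewrite ?mulr_ge0 ?exprn_ge0 ?(ltW w0) //.
  apply: (@le_trans _ _ ((4 * A) ^+ s * (b ^+ j) ^+ s)).
    apply: ler_pM; rewrite ?mulr_ge0 ?exprn_ge0 ?(ltW w0) //.
    by do 2!rewrite lerXn2r ?nnegrE ?exprn_ge0 ?(ltW w0) ?b0 //.
  by rewrite -exprMn exprn_ile1 // !mulr_ge0 ?exprn_ge0 ?(ltW A0).
rewrite lerXn2r ?nnegrE ?exprn_ge0 ?divr_ge0 ?(ltW w0) ?(ltW A0) // wE.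
by apply: expn_self_le; rewrite // -wE w0 (le_trans wb).
Qed.

Definition has_dense_subset (h : R) (P : pred nat) E : bool :=
  [exists X : {set T}, [&& X != set0, P #|X| & h * #|X|%:R <= #|edges_in E X|%:R]].

Lemma Pr_has_dense_subset (h A b : R) (j : nat) (P : pred nat) :
  (2 * (2 * j + 1))%:R <= h -> 0 < A -> b <= 1/2 -> 4 * A * b ^+ j <= 1 ->
  (forall s, (0 < s <= n)%N -> P s -> (2 * s%:R * p / h) ^+ 2 <= A * s%:R / n%:R <= b) ->
  Pr (has_dense_subset h P) <= n%:R * (A / n%:R) ^+ j.
Proof.
move=> jh A0 b12 Ab dense_le; have h0 : 0 < h by apply: lt_le_trans jh; rewrite ltr0n addn1.
have A_ge0 : 0 <= (A / n%:R) ^+ j by rewrite exprn_ge0 // divr_ge0 // ltW.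
pose candidate (X : {set T}) := (X != set0) && P #|X|.
apply: (@le_trans _ _ (Pr (fun E =>
    [exists (X | candidate X), h * #|X|%:R <= #|E :&: edges_in pairs X|%:R]))).
  apply: Pr_le => // E sE /existsP[X /and3P[X0 PX X_dense]].
  by apply/exists_inP; exists X; rewrite ?/candidate ?X0 -?edges_inE.
apply: le_trans (Pr_exists _ p01 _ _) _; rewrite -[X in X * _ ^+ j]sum_invbin_card mulr_suml.
rewrite big_mkcond [leRHS]big_mkcond; apply: ler_sum => X _; rewrite /candidate.
case: ifP => [/andP[X0 PX]|_]; last by case: ifP => // _; rewrite mulr_ge0 ?invr_ge0.
have Xn : (0 < #|X| <= n)%N by rewrite card_gt0 X0 max_card.
have [n0 X_gt0] : 0 < n%:R :> R /\ 0 < #|X|%:R :> R.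
  by case/andP: Xn => X1 X2; rewrite !ltr0n X1 (leq_trans X1).
rewrite X0; have /andP[w_ge w_le] := dense_le _ Xn PX; set w := A * _ / _ in w_ge w_le.
have w0 : 0 < w by rewrite /w !mulr_gt0 ?invr_gt0.
apply: le_trans (dense_term_le Xn A0 b12 Ab erefl w_le).
have -> : w ^+ ((2 * j + 1) * #|X|) = Num.sqrt w ^+ (2 * (2 * j + 1) * #|X|).
  by rewrite -mulnA [in RHS]exprM sqr_sqrtr // ltW.
apply: Pr_dense_set jh _ _.
  by rewrite sqrtr_gt0 w0 -[leRHS]sqrtr1 ler_wsqrtr //; lra.
rewrite [leRHS]mulrC -ler_pdivrMr // -[leLHS]ger0_norm; last first.
  by rewrite divr_ge0 ?(ltW h0) // !mulr_ge0.
by rewrite -sqrtr_sqr ler_wsqrtr.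
Qed.

Definition has_few_edges_at (m : nat) (x : R) E : bool :=
  [exists X : {set T}, (#|X| == m) && (#|edges_meeting E X|%:R <= x)].

Lemma Pr_few_edges_meeting X (D : R) : (3 * #|X| <= n)%N -> D = p * n%:R ->
  Pr (fun E => #|E :&: edges_meeting pairs X|%:R <= #|X|%:R * D / 100) <=
  expR (- (#|X|%:R * D / 15)).
Proof.
move=> Xn DE; pose few E := #|E :&: edges_meeting pairs X|%:R <= #|X|%:R * D / 100.
apply: (@le_trans _ _ (Pr (fun E => (set0 \subset E) && few E))).
  by apply: Pr_le => // E _; rewrite /few sub0set.
apply: le_trans (Pr_superset_few p01 _ (sub0set _) (edges_meeting_pairs X) (_ : 0 <= 1/2)) _ => //.
rewrite cards0 expr0 mul1r ler_expR setD0.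
have many_pairs : #|X|%:R * n%:R * (2/3) <= #|edges_meeting pairs X|%:R :> R.
  apply: le_trans (_ : (#|X| * (n - #|X|))%:R <= _); last first.
    by rewrite ler_nat card_edges_meeting_pairs.
  rewrite natrM natrB ?max_card //; have : (3 * #|X|)%:R <= n%:R :> R by rewrite ler_nat.
  by rewrite natrM => Xn'; have := ler_wpM2l (ler0n R #|X|) Xn'; lra.
have := ler_wpM2l p_ge0 many_pairs; rewrite DE expr2.
by have := mulr_ge0 p_ge0 (mulr_ge0 (ler0n R #|X|) (ler0n R n)); lra.
Qed.

Lemma Pr_has_few_edges_at (m : nat) (D : R) :
  (0 < m)%N -> (3 * m <= n)%N -> D = p * n%:R -> n%:R <= m%:R * D ^+ 2 ->
  4 * D ^+ 2 <= expR (D / 30) ->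
  Pr (has_few_edges_at m (m%:R * D / 100)) <= expR (- (m%:R * D / 30)).
Proof.
move=> m0 mn DE n_le D_large.
apply: (@le_trans _ _ (Pr (fun E => [exists (X : {set T} | #|X| == m),
    #|E :&: edges_meeting pairs X|%:R <= m%:R * D / 100]))).
  apply: Pr_le => // E sE /existsP[X /andP[Xm X_few]].
  by apply/exists_inP; exists X; rewrite -?edges_meetingE.
apply: le_trans (Pr_exists _ p01 _ _) _.
apply: (@le_trans _ _ (\sum_(X : {set T} | #|X| == m) expR (- (m%:R * D / 15)))).
  by apply: ler_sum => X /eqP Xm; rewrite -Xm Pr_few_edges_meeting // Xm.
rewrite sumr_const; have -> : #|[pred X : {set T} | #|X| == m]| = 'C(n, m).
  by rewrite -card_draws; apply: eq_card => X; rewrite !inE.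
have sn : (0 < m <= n)%N by rewrite m0 (leq_trans _ mn) // leq_pmull.
rewrite -[leLHS]mulr_natl.
apply: le_trans (_ : expR (D / 30) ^+ m * expR (- (m%:R * D / 15)) <= _).
  rewrite ler_wpM2r ?expR_ge0 //; apply: le_trans (bin_le_expn sn n_le) _.
  by rewrite lerXn2r ?nnegrE ?expR_ge0 // mulr_ge0 ?sqr_ge0.
by rewrite -expRM_natl -expRD ler_expR; lra.
Qed.

Definition has_deficient_set J (Q : {set {set T}} -> J -> {set {set T}}) (g eta : R) E : bool :=
  [exists S : {set {set T}}, exists i : J, [&& S \subset E, #|S|%:R <= g &
     #|E :&: Q S i|%:R <= p * #|Q S i|%:R - eta * B]].

Lemma Pr_superset_deficient S Q (delta eta : R) : S \subset pairs -> Q \subset pairs ->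
  #|S|%:R <= delta * B -> 0 < eta <= 1 -> 0 <= delta <= eta / 4 ->
  Pr (fun E => (S \subset E) && (#|E :&: Q|%:R <= p * #|Q|%:R - eta * B)) <=
  p ^+ #|S| * expR (- (B * (eta ^+ 2 / 8))).
Proof.
move=> sS sQ S_le /andP[eta0 eta1] /andP[delta0 delta_le].
have half_eta : 0 <= eta / 2 by rewrite divr_ge0 // ltW.
apply: le_trans (Pr_superset_few p01 _ sS sQ half_eta) _.
rewrite ler_wpM2l ?exprn_ge0 // ler_expR.
have B_ge0 : 0 <= B by rewrite mulr_ge0 // exprn_ge0.
have Q_le : #|Q|%:R - delta * B <= #|Q :\: S|%:R.
  rewrite lerBlDr; apply: (@le_trans _ _ (#|Q :\: S|%:R + #|S|%:R)); last by rewrite lerD2l.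
  by rewrite -natrD ler_nat -[leqLHS](cardsID S) addnC leq_add2l subset_leq_card // subsetIr.
have mean_le : p * #|Q|%:R <= B.
  by rewrite ler_wpM2l // (le_trans _ card_pairs_le) // ler_nat subset_leq_card.
have slope_ge0 : 0 <= eta / 2 - (eta / 2) ^+ 2.
  have -> : eta / 2 - (eta / 2) ^+ 2 = eta / 2 * (1 - eta / 2) by ring.
  by rewrite mulr_ge0 // subr_ge0; lra.
have mean_S : p * (#|Q|%:R - delta * B) * (eta / 2 - (eta / 2) ^+ 2) <=
              p * #|Q :\: S|%:R * (eta / 2 - (eta / 2) ^+ 2).
  by rewrite ler_wpM2r // ler_wpM2l.
have S_cost : p * (delta * B) * (eta / 2 - (eta / 2) ^+ 2) <= eta / 4 * B * (eta / 2).
  apply: ler_pM; rewrite ?mulr_ge0 //; last by rewrite lerBlDr lerDl sqr_ge0.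
  by apply: le_trans (ler_wpM2r B_ge0 delta_le); rewrite ler_piMl ?mulr_ge0.
have mean_eta : p * #|Q|%:R * (eta * eta) <= B * (eta * eta).
  by rewrite ler_wpM2r // mulr_ge0 // ltW.
move: mean_S S_cost mean_eta; rewrite !expr2.
by move: (#|Q|%:R) (#|_ :\: _|%:R) (p * (n%:R * n%:R)) => q qS b; lra.
Qed.

(* Union bound over all small subgraphs [S] of the random graph: the sets [Q S i] may depend
   on edges already exposed through [S]. *)
Lemma Pr_has_deficient_set J (Q : {set {set T}} -> J -> {set {set T}}) (delta eta z : R) :
  (forall S i, Q S i \subset pairs) -> 0 < z <= 1 -> 0 < eta <= 1 -> 0 <= delta <= eta / 4 ->
  Pr (has_deficient_set Q (delta * B) eta) <=
  #|J|%:R * expR (B * (z + delta * ln z^-1 - eta ^+ 2 / 8)).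
Proof.
move=> sQ z01 eta01 delta01.
apply: (@le_trans _ _ (Pr (fun E =>
    [exists (S : {set {set T}} | (S \subset pairs) && (#|S|%:R <= delta * B)),
      [exists (i | predT i), (S \subset E) && (#|E :&: Q S i|%:R <= p * #|Q S i|%:R - eta * B)]]))).
  apply: Pr_le => // E sE /existsP[S /existsP[i /and3P[SE S_le deficient]]].
  apply/exists_inP; exists S; first by rewrite S_le (subset_trans SE).
  by apply/exists_inP; exists i; rewrite // SE.
apply: le_trans (Pr_exists _ p01 _ _) _.
apply: (@le_trans _ _ (\sum_(S : {set {set T}} | (S \subset pairs) && (#|S|%:R <= delta * B))
    #|J|%:R * (p ^+ #|S| * expR (- (B * (eta ^+ 2 / 8)))))).
  apply: ler_sum => S /andP[sS S_le]; apply: le_trans (Pr_exists _ p01 _ _) _.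
  apply: ler_sum_card => i.
  exact: Pr_superset_deficient sS (sQ S i) S_le eta01 delta01.
rewrite -mulr_sumr -mulr_suml ler_wpM2l //.
apply: le_trans (ler_wpM2r (expR_ge0 _) (sum_expn_small_subsets _ _ p_ge0 z01)) _.
rewrite -expRD ler_expR; case/andP: z01 => z0 _.
have := ler_wpM2l (mulr_ge0 p_ge0 (ltW z0)) card_pairs_le.
by move: (n%:R ^+ 2) (#|pairs|%:R) (ln _) => N N2 L; lra.
Qed.

Definition has_excessive_set J (Q : J -> {set {set T}}) (eta : R) E : bool :=
  [exists i : J, p * #|Q i|%:R + eta * B <= #|E :&: Q i|%:R].

Lemma Pr_has_excessive_set J (Q : J -> {set {set T}}) (eta : R) :
  (forall i, Q i \subset pairs) -> 0 < eta <= 1 ->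
  Pr (has_excessive_set Q eta) <= #|J|%:R * expR (- (B * eta ^+ 2 / 8)).
Proof.
move=> sQ /andP[eta0 eta1].
apply: (@le_trans _ _ (Pr (fun E => [exists (i | predT i),
    p * #|Q i|%:R + eta * B <= #|E :&: Q i|%:R]))).
  by apply: Pr_le => // E sE /existsP[i excessive]; apply/exists_inP; exists i.
apply: le_trans (Pr_exists _ p01 _ _) _.
have quarter_eta : 0 <= eta / 4 by rewrite divr_ge0 // ltW.
apply: ler_sum_card => i; apply: le_trans (Pr_many p01 _ (sQ i) quarter_eta) _.
have mean_ge0 : 0 <= p * #|Q i|%:R by rewrite mulr_ge0.
have mean_le : p * #|Q i|%:R <= B.
  by rewrite ler_wpM2l // (le_trans _ card_pairs_le) // ler_nat subset_leq_card.
have exp_le : expR (eta / 4) - 1 <= eta / 4 + 2 * (eta / 4) ^+ 2.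
  have : 0 <= eta / 4 <= 1/2 by rewrite quarter_eta /=; lra.
  by move/expR_le_quadratic; lra.
have mean_eta : p * #|Q i|%:R * (eta * eta) <= B * (eta * eta).
  by rewrite ler_wpM2r // mulr_ge0 // ltW.
have := ler_wpM2l mean_ge0 exp_le; move: mean_eta; rewrite ler_expR !expr2.
by move: (#|Q i|%:R) (n%:R * n%:R) (expR _) => q N y; lra.
Qed.

End RandomGraph.

(** * Edge sets as adjacency relations *)

Lemma sum_card_exchange (I J : finType) (A : {set I}) (B : {set J}) (P : I -> J -> bool) :
  \sum_(i in A) #|[set j in B | P i j]| = \sum_(j in B) #|[set i in A | P i j]|.
Proof.
have cardE (K : finType) (C : {set K}) (Q : pred K) : #|[set k in C | Q k]| = \sum_(k in C) Q k.
  by rewrite -sum1dep_card big_mkcondr; apply: eq_bigr => k _; case: (Q k).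
rewrite (eq_bigr _ (fun i _ => cardE _ B (P i))) exchange_big /=.
by apply: eq_bigr => j _; rewrite cardE.
Qed.

Section EdgeSets.
Variable T : finType.
Implicit Types (E S F M : {set {set T}}) (A B K V X : {set T}) (s t v x y : T).

Definition edge_rel S : rel T := fun x y => [set x; y] \in S.

Lemma edge_rel_sym S : symmetric (edge_rel S).
Proof. by move=> x y; rewrite /edge_rel setUC. Qed.

Lemma edge_rel_neq S x y : S \subset pairs T -> edge_rel S x y -> x != y.
Proof. by move=> sS /(subsetP sS); rewrite inE cards2; case: (x == y). Qed.

Lemma edge_rel_sub S F : S \subset F -> subrel (edge_rel S) (edge_rel F).
Proof. by move=> sSF x y; apply: (subsetP sSF). Qed.

Lemma edge_rel_in K F x y : {in F, forall e : {set T}, e \subset K} -> edge_rel F x y ->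
  (x \in K) && (y \in K).
Proof. by move=> FK /FK; rewrite subUset !sub1set. Qed.

Lemma set2_inj v x y : v != x -> v != y -> [set v; x] = [set v; y] -> x = y.
Proof.
move=> vx vy /setP/(_ x); rewrite !inE eqxx orbT [x == v]eq_sym (negbTE vx) /=.
by move/esym/eqP.
Qed.

Lemma deg_in_edges S X v : S \subset pairs T -> v \in X ->
  deg_in (edge_rel S) X v = #|[set e in edges_in S X | v \in e]|.
Proof.
move=> sS vX; rewrite /deg_in -(@card_in_imset _ _ (fun u => [set v; u])); last first.
  move=> x y; rewrite !inE => /andP[_ /(edge_rel_neq sS) vx] /andP[_ /(edge_rel_neq sS) vy].
  exact: set2_inj.
apply: eq_card => e; apply/imsetP/idP => [[u]|].
  by rewrite inE => /andP[uX vu] ->; rewrite !inE eqxx /= subUset !sub1set vX uX !andbT.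
rewrite !inE => /andP[/andP[eS eX] ve].
have /cards2P[x [y [_ eE]]] : #|e| == 2 by have := subsetP sS e eS; rewrite inE.
rewrite eE in eS eX ve *; move: ve; rewrite !inE => /orP[/eqP vx|/eqP vy].
  by exists y; rewrite vx // inE /edge_rel eS (subsetP eX) // !inE eqxx orbT.
exists x; last by rewrite vy setUC.
by rewrite vy inE /edge_rel setUC eS (subsetP eX) // !inE eqxx.
Qed.

Lemma deg_in_edge_setD E F X v : F \subset E ->
  deg_in (edge_rel E) X v = deg_in (edge_rel F) X v + deg_in (edge_rel (E :\: F)) X v.
Proof.
move=> sFE; rewrite !deg_in_sum -big_split /=; apply: eq_bigr => u _; rewrite /edge_rel inE.
by case: (boolP ([set v; u] \in F)) => [/(subsetP sFE) ->|].
Qed.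

Lemma sum_incident_le A (C : T -> {set {set T}}) M : M \subset pairs T ->
  (forall v, v \in A -> C v \subset M) -> (forall v e, v \in A -> e \in C v -> v \in e) ->
  \sum_(v in A) #|C v| <= 2 * #|M|.
Proof.
move=> sM CM C_at.
rewrite (eq_bigr (fun v => \sum_(e in M) (e \in C v))) => [|v vA]; last first.
  rewrite -sum1_card [RHS]big_mkcond [LHS]big_mkcond; apply: eq_bigr => e _.
  by have := subsetP (CM v vA) e; case: (e \in C v) => [/(_ isT) ->//|_]; case: ifP.
rewrite exchange_big /= mulnC -sum_nat_const; apply: leq_sum => e eM.
have /eqP <- : #|e| == 2 by have := subsetP sM e eM; rewrite inE.
rewrite -sum1_card [leqLHS]big_mkcond [leqRHS]big_mkcond /=; apply: leq_sum => v _.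
case: ifP => // vA; have := C_at v e vA; case: (e \in C v) => [/(_ isT) ->//|_].
by case: ifP.
Qed.

Lemma sum_deg_in_le E A : E \subset pairs T ->
  \sum_(v in A) deg_in (edge_rel E) A v <= 2 * #|edges_in E A|.
Proof.
move=> sE; rewrite (eq_bigr _ (fun v vA => deg_in_edges sE vA)).
apply: sum_incident_le => [|v _|v e _]; last by rewrite inE => /andP[].
  by apply: subset_trans sE; apply/subsetP => e; rewrite inE => /andP[].
by apply/subsetP => e; rewrite inE => /andP[].
Qed.

Lemma card_setI_stars E A (X : T -> {set T}) :
  #|E :&: stars A X| = \sum_(t in A) deg_in (edge_rel E) (X t :\: A) t.
Proof.
have -> : E :&: stars A X =
    [set [set u.1; u.2] | u in star_pairs A (fun t => [set x in X t :\: A | edge_rel E t x])].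
  apply/setP=> e; rewrite inE; apply/andP/imsetP => [[eE /imsetP[u uS eu]]|[u uS ->]].
    by exists u => //; move: uS; rewrite !inE => /and3P[-> -> ->]; rewrite /edge_rel -eu.
  move: uS; rewrite !inE => /and3P[uA /andP[uN uX] adj_u]; split=> //.
  by apply/imsetP; exists u; rewrite // !inE uA uN.
rewrite card_in_imset ?card_star_pairs //.
move=> u w uS wS; apply: (@star_pairs_inj T A X).
  by move: uS; rewrite !inE => /and3P[-> -> _].
by move: wS; rewrite !inE => /and3P[-> -> _].
Qed.

Lemma card_stars_ge A (X : T -> {set T}) :
  \sum_(t in A) #|X t| <= #|stars A X| + #|A| * #|A|.
Proof.
rewrite card_stars -sum_nat_const -big_split /=; apply: leq_sum => t _.
by rewrite -(cardsID A (X t)) addnC leq_add2l subset_leq_card // subsetIr.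
Qed.

Lemma sub_closed_nbh S A v (e : {set T}) : S \subset pairs T -> v \in A -> e \in S -> v \in e ->
  e \subset closed_nbh (edge_rel S) A.
Proof.
move=> sS vA eS ve; apply/subsetP=> u ue; rewrite !inE.
have [->|uv] := eqVneq u v; first by rewrite vA.
apply/orP; right; apply/exists_inP; exists v => //; rewrite /edge_rel.
rewrite [[set v; u]](_ : _ = e) //; apply/eqP; rewrite eqEcard subUset !sub1set ve ue cards2.
by rewrite eq_sym uv; have := subsetP sS e eS; rewrite inE => /eqP ->.
Qed.

Lemma path_edges_sparse F s p : path (edge_rel F) s p ->
  exists2 S : {set {set T}}, S \subset F & #|S| <= size p /\ path (edge_rel S) s p.
Proof.
elim: p s => [|x p IH] s /=; first by exists set0; rewrite ?sub0set ?cards0.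
case/andP=> sx /IH[S SF [S_size path_S]]; exists ([set s; x] |: S).
  by rewrite subUset sub1set SF andbT.
split; first by rewrite cardsU1 -add1n leq_add // leq_b1.
rewrite {1}/edge_rel setU11 /=; apply: sub_path path_S; apply: edge_rel_sub; exact: subsetUr.
Qed.

Definition ham_tail (e : rel T) V s t : seq T :=
  if pselect (ham_path e V s t) is left st_path then sval (cid st_path) else [::].

Lemma ham_tailP (e : rel T) V s t : ham_path e V s t -> let p := ham_tail e V s t in
  [/\ path e s p, uniq (s :: p), last s p = t & s :: p =i V].
Proof. by rewrite /ham_tail; case: pselect => // st_path _; apply: (svalP (cid st_path)). Qed.

Lemma prev_ham_tail_in (e : rel T) V s t y : ham_path e V s t -> y \in V ->
  prev (s :: ham_tail e V s t) y \in V.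
Proof. by move=> /ham_tailP[_ _ _ pV]; rewrite -!pV mem_prev. Qed.

End EdgeSets.

(** * Distribution of the edges in cuts *)

Section WellDistributed.
Local Open Scope ring_scope.
Variables (R : realType) (T : finType) (p eta : R) (E : {set {set T}}).
Implicit Types (A K X Y : {set T}) (J : finType) (F S : {set {set T}}).
Notation n := #|T|.
Notation B := (p * n%:R ^+ 2 : R).
Notation dE := (deg_in (edge_rel E)).

Definition cut_pairs (i : {set T} * {set T}) : {set {set T}} := stars i.1 (fun=> i.2).

Definition well_distributed : bool :=
  [&& ~~ has_excessive_set p cut_pairs eta E,
      ~~ has_excessive_set p (@edges_in T (pairs T)) eta E &
      ~~ has_deficient_set p (fun=> cut_pairs) 0 eta E].

Hypothesis p_ge0 : 0 <= p.
Hypothesis sE : E \subset pairs T.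

Lemma not_excessive J (Q : J -> {set {set T}}) (x : R) i :
  ~~ has_excessive_set p Q x E -> #|E :&: Q i|%:R < p * #|Q i|%:R + x * B.
Proof. by rewrite negb_exists => /forallP/(_ i); rewrite -ltNge. Qed.

Lemma not_deficient J (Q : {set {set T}} -> J -> {set {set T}}) (g x : R) S i :
  ~~ has_deficient_set p Q g x E -> S \subset E -> #|S|%:R <= g ->
  p * #|Q S i|%:R - x * B < #|E :&: Q S i|%:R.
Proof.
rewrite negb_exists => /forallP/(_ S); rewrite negb_exists => /forallP/(_ i) + SE Sg.
by rewrite SE Sg /= -ltNge.
Qed.

Hypothesis E_distr : well_distributed.

Lemma sum_deg_in_upper A K : A \subset K ->
  (\sum_(t in A) dE K t)%:R <= p * (#|A|%:R * #|K|%:R) + 3 * eta * B.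
Proof.
move=> AK; have /and3P[cut_ok in_ok _] := E_distr.
rewrite (eq_bigr _ (fun t _ => deg_in_setD _ t AK)) big_split /= addnC natrD.
have := not_excessive (A, K) cut_ok.
rewrite /cut_pairs /= card_setI_stars card_stars sum_nat_const natrM cardsDS //.
rewrite natrB ?subset_leq_card // => cut_lt; have := not_excessive A in_ok.
rewrite -edges_inE // => in_lt.
have handshake : (\sum_(t in A) dE A t)%:R <= 2 * #|edges_in E A|%:R :> R.
  by rewrite -natrM ler_nat sum_deg_in_le.
have := ler_wpM2l p_ge0 (bin2_le_half_sqr R #|A|); rewrite -card_edges_in_pairs expr2.
move: cut_lt in_lt handshake; move: (\sum_(t in A) dE (K :\: A) t)%:R (\sum_(t in A) dE A t)%:R.
by move: #|edges_in E A|%:R #|edges_in (pairs T) A|%:R B => *; lra.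
Qed.

Lemma sum_deg_in_lower A Y :
  p * (#|A|%:R * #|Y :\: A|%:R) - eta * B < (\sum_(t in A) dE (Y :\: A) t)%:R.
Proof.
have /and3P[_ _ deficient_ok] := E_distr.
have := not_deficient (A, Y) deficient_ok (sub0set _); rewrite cards0 => /(_ (lexx _)).
by rewrite /cut_pairs /= card_setI_stars card_stars sum_nat_const natrM.
Qed.

Lemma card_well_distributed_le : eta <= 1/2 -> #|E|%:R <= B.
Proof.
move=> eta_le; have /and3P[_ in_ok _] := E_distr.
have := not_excessive setT in_ok; rewrite -edges_inE // card_edges_in_pairs cardsT.
have -> : edges_in E setT = E by apply/setP=> e; rewrite inE subsetT andbT.
move=> /ltW E_le; apply: (le_trans E_le).
have := ler_wpM2l p_ge0 (bin2_le_half_sqr R n).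
have := ler_wpM2r (mulr_ge0 p_ge0 (sqr_ge0 n%:R)) eta_le.
by move: 'C(n, 2)%:R (n%:R ^+ 2) => *; lra.
Qed.

End WellDistributed.

(** * Expansion after a bounded deletion *)

Section BoundedDeletion.
Local Open Scope ring_scope.
Variables (R : realType) (T : finType).
Implicit Types (A K X Y : {set T}) (E F S : {set {set T}}) (v : T).
Notation n := #|T|.

(* [F] is what remains of [E] inside [K] after deleting at most a proportion [alpha] of the edges
   at each vertex. *)
Definition bounded_deletion (alpha : R) E F K : Prop :=
  [/\ F \subset E, {in F, forall e : {set T}, e \subset K} &
      {in K, forall v,
        (deg_in (edge_rel (E :\: F)) K v)%:R <= alpha * (deg_in (edge_rel E) K v)%:R}].

Lemma bounded_deletion_sub alpha E F K : bounded_deletion alpha E F K -> F \subset E.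
Proof. by case. Qed.

Lemma bounded_deletion_rel_in alpha E F K x y : bounded_deletion alpha E F K ->
  edge_rel F x y -> x \in K.
Proof. by case=> _ FK _ /(edge_rel_in FK)/andP[]. Qed.

Lemma bounded_deletion_half alpha E F K v : bounded_deletion alpha E F K -> alpha <= 1/2 ->
  v \in K -> (deg_in (edge_rel E) K v <= 2 * deg_in (edge_rel F) K v)%N.
Proof.
move=> [sFE _ few] alpha_half vK; rewrite -(ler_nat R) natrM.
have := le_trans (few v vK) (ler_wpM2r (ler0n _ _) alpha_half).
by rewrite (deg_in_edge_setD _ _ sFE) natrD; lra.
Qed.

Variables (p eta alpha : R) (E F : {set {set T}}) (K : {set T}).
Hypothesis p_gt0 : 0 < p.
Hypothesis sE : E \subset pairs T.
Hypothesis E_distr : well_distributed p eta E.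
Hypothesis alpha_ge0 : 0 <= alpha.
Hypothesis delEF : bounded_deletion alpha E F K.
Notation B := (p * n%:R ^+ 2 : R).
Notation deleted := (deg_in (edge_rel (E :\: F))).

Lemma sum_deleted_le A : A \subset K ->
  (\sum_(t in A) deleted K t)%:R <= alpha * (p * (#|A|%:R * #|K|%:R) + 3 * eta * B).
Proof.
move=> AK; have [_ _ few] := delEF.
apply: le_trans (ler_wpM2l alpha_ge0 (sum_deg_in_upper (ltW p_gt0) sE E_distr AK)).
by rewrite !natr_sum mulr_sumr; apply: ler_sum => t /(subsetP AK)/few.
Qed.

(* Whatever part of the stars is absent from [F] has been deleted. *)
Lemma card_setI_stars_le A (X : T -> {set T}) : (forall t, t \in A -> X t \subset K) ->
  (#|E :&: stars A X| <= #|F :&: stars A X| + \sum_(t in A) deleted K t)%N.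
Proof.
move=> XK; have [sFE _ _] := delEF; rewrite !card_setI_stars -big_split /=.
apply: leq_sum => t tA; rewrite (deg_in_edge_setD _ _ sFE) leq_add2l deg_inS //.
exact: subset_trans (subsetDl _ _) (XK t tA).
Qed.

Lemma cut_remaining_gt A Y : A \subset K -> Y \subset K -> 0 <= eta -> alpha <= 1/2 ->
  p * (#|A|%:R * #|Y :\: A|%:R) - alpha * (p * (#|A|%:R * #|K|%:R)) - 5/2 * eta * B <
  #|F :&: cut_pairs (A, Y)|%:R.
Proof.
move=> AK YK eta0 alpha_half.
have etaB : 0 <= eta * B by rewrite !mulr_ge0 ?sqr_ge0 ?(ltW p_gt0).
have := ler_wpM2r etaB alpha_half.
have := sum_deg_in_lower E_distr A Y; have := sum_deleted_le AK.
have := @card_setI_stars_le A (fun=> Y) (fun _ _ => YK); rewrite -(ler_nat R) natrD.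
rewrite card_setI_stars /cut_pairs /=.
move: (\sum_(t in A) _)%:R (\sum_(t in A) _)%:R #|_ :&: _|%:R.
by move: #|A|%:R #|K|%:R #|Y :\: A|%:R B => *; lra.
Qed.

Lemma exists_cut_edge A : A \subset K -> (2 * #|A| <= #|K|)%N -> 0 <= eta -> alpha <= 1/2 ->
  5/2 * eta * n%:R ^+ 2 <= (1/2 - alpha) * (#|A|%:R * #|K|%:R) ->
  exists t x, [/\ t \in A, x \in K :\: A & edge_rel F t x].
Proof.
move=> AK A_half eta0 alpha_half slack.
have : (0 < #|F :&: cut_pairs (A, K)|)%N.
  rewrite -(ltr_nat R); apply: le_lt_trans (cut_remaining_gt AK (subxx K) eta0 alpha_half).
  rewrite cardsDS // natrB ?subset_leq_card //; have := ler_wpM2l (ltW p_gt0) slack.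
  have : #|A|%:R * (2 * #|A|%:R) <= #|A|%:R * #|K|%:R :> R.
    by rewrite ler_wpM2l // -natrM ler_nat.
  move=> /(ler_wpM2l (ltW p_gt0)); move: #|A|%:R #|K|%:R (n%:R ^+ 2) => *; lra.
rewrite card_gt0 => /set0Pn[e]; rewrite inE => /andP[eF /imsetP[[t x]]].
by rewrite !inE /= => /and3P[tA xA xK] eE; exists t, x; rewrite /edge_rel -eE inE xA.
Qed.

End BoundedDeletion.

Section Expansion.
Variable T : finType.
Implicit Types (A K L : {set T}) (E F S : {set {set T}}) (v : T) (e : rel T).
Notation n := #|T|.

Definition incident S v : {set {set T}} := [set e in S | v \in e].

Lemma deg_in_incident F K v : F \subset pairs T -> {in F, forall e : {set T}, e \subset K} ->
  v \in K -> deg_in (edge_rel F) K v = #|incident F v|.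
Proof.
move=> sF FK vK; rewrite deg_in_edges //; apply: eq_card => e; rewrite !inE.
by case: (boolP (e \in F)) => //= /FK ->.
Qed.

Lemma exists_bounded_stars F (l : nat) : exists2 S : {set {set T}}, S \subset F &
  #|S| <= n * l /\ forall v, minn #|incident F v| l <= #|incident S v|.
Proof.
have /choice[C C_star] : forall v, exists C : {set {set T}},
    C \subset incident F v /\ #|C| = minn #|incident F v| l.
  move=> v; have /set0Pn[C] : [set C : {set {set T}} | C \subset incident F v
      & #|C| == minn #|incident F v| l] != set0.
    by rewrite -card_gt0 cards_draws bin_gt0 geq_minl.
  by rewrite inE => /andP[sC /eqP cC]; exists C.
exists (\bigcup_v C v).
  apply/bigcupsP => v _; have [/subset_trans sC _] := C_star v; apply: sC.
  by apply/subsetP=> e; rewrite inE => /andP[].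
split=> [|v]; last first.
  have [sC <-] := C_star v; apply/subset_leq_card/subsetP => e eC; rewrite inE.
  have := subsetP sC e eC; rewrite inE => /andP[_ ->]; rewrite andbT.
  by apply/bigcupP; exists v.
apply: leq_trans (_ : \sum_v #|C v| <= _); last first.
  by rewrite -sum_nat_const leq_sum // => v _; have [_ ->] := C_star v; rewrite geq_minr.
elim/big_rec2: _ => [|v m X _ IH]; first by rewrite cards0.
by apply: leq_trans (leq_card_setU _ _) _; rewrite leq_add2l.
Qed.

Lemma no_dense_subset_expands (R : realType) S E A (h c : R) (m : nat) (P : pred nat) :
  E \subset pairs T -> S \subset E -> A != set0 -> (0 <= h)%R ->
  (forall v, v \in A -> c <= #|incident S v|%:R)%R -> (2 * h * m%:R <= c)%R ->
  (forall j, j <= m * #|A| -> P j) -> ~~ has_dense_subset h P E ->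
  m * #|A| < #|closed_nbh (edge_rel S) A|.
Proof.
move=> sE sSE A0 h0 S_deg hc P_small; rewrite ltnNge; apply: contraNN => small.
have sS := subset_trans sSE sE.
apply/existsP; exists (closed_nbh (edge_rel S) A); rewrite P_small // andTb; apply/andP; split.
  by apply: contraNneq A0 => nbh0; rewrite -subset0 -nbh0 subsetUl.
have : (c * #|A|%:R <= 2 * #|edges_in E (closed_nbh (edge_rel S) A)|%:R)%R.
  rewrite mulr_natr -sumr_const -natrM; apply: le_trans (ler_sum _ S_deg) _.
  rewrite -natr_sum ler_nat; apply: sum_incident_le.
  - by apply: subset_trans sE; apply/subsetP=> e; rewrite inE => /andP[].
  - move=> v vA; apply/subsetP=> e; rewrite !inE => /andP[eS ve].
    by rewrite (subsetP sSE) // (sub_closed_nbh sS vA eS ve).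
  - by move=> v e _; rewrite inE => /andP[].
have := ler_wpM2r (ler0n R #|A|) hc.
move: small; rewrite -(ler_nat R) natrM => /(ler_wpM2l h0).
by move: #|A|%:R%R #|closed_nbh _ _|%:R%R #|edges_in _ _|%:R%R m%:R%R => *; lra.
Qed.

Lemma closed_nbh_by_parts e A L : 0 < #|A| ->
  (A :\: L != set0 -> 9 * #|A :\: L| < #|closed_nbh e (A :\: L)|) ->
  (A :&: L != set0 -> 5 * #|A :&: L| < #|closed_nbh e (A :&: L)|) ->
  3 * #|A| < #|closed_nbh e A|.
Proof.
rewrite -!card_gt0 => A0 nbhD nbhI; have cardA := cardsID L A.
have leD := subset_leq_card (closed_nbhS e (subsetDl A L)).
have leI := subset_leq_card (closed_nbhS e (subsetIl A L)).
by have [le_A|lt_A] := leqP #|A| (3 * #|A :\: L|); [have := nbhD|have := nbhI]; lia.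
Qed.

End Expansion.

Section ExpandingSubgraphs.
Local Open Scope ring_scope.
Variables (R : realType) (T : finType) (p alpha : R) (E F : {set {set T}}) (K : {set T}).
Implicit Types (A X : {set T}) (S : {set {set T}}).
Notation n := #|T|.
Notation B := (p * n%:R ^+ 2 : R).
Notation D := (p * n%:R : R).
Notation dE := (deg_in (edge_rel E) K).

Definition few_low_degrees : Prop :=
  #|[set v in K | (dE v)%:R < D / 100]|%:R * D ^+ 2 <= n%:R.

Hypothesis p_gt0 : 0 < p.
Hypothesis alpha_ge0 : 0 <= alpha.
Hypothesis alpha_half : alpha <= 1/2.
Hypothesis sE : E \subset pairs T.
Hypothesis delEF : bounded_deletion alpha E F K.

Lemma exists_small_set_expander (k l a : nat) (d : R) :
  0 < d <= 1 -> d * D <= l%:R <= D / 200 -> k%:R <= 6 * D ->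
  (forall v, v \in K -> (k <= dE v)%N) ->
  few_low_degrees ->
  ~~ has_dense_subset (d * D / 18) (fun s => s <= 9 * a)%N E ->
  ~~ has_dense_subset (d * k%:R / 60) (fun s => s%:R * D ^+ 2 <= 5 * n%:R) E ->
  exists2 S : {set {set T}}, S \subset F &
    (#|S| <= n * l)%N /\ expands (edge_rel S) K (fun m => 0 < m <= a)%N.
Proof.
move=> /andP[d0 d1] /andP[l_ge l_le] kD k_min few_low not_dense not_dense_low.
have [sFE FK _] := delEF; have [S SF [S_card S_star]] := exists_bounded_stars F l.
exists S; rewrite // S_card; split=> // A AK /andP[A0 Aa].
have D0 : 0 <= D by rewrite mulr_ge0 // ltW.
have dF v : v \in K -> (dE v)%:R <= 2 * #|incident F v|%:R :> R.
  move=> vK; rewrite -(deg_in_incident (subset_trans sFE sE) FK vK) -natrM ler_nat.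
  exact: bounded_deletion_half delEF alpha_half vK.
pose L := [set v | (dE v)%:R < D / 100]; apply: (closed_nbh_by_parts (L := L)) => // AL0.
- apply: (no_dense_subset_expands sE (subset_trans SF sFE) AL0 _ _ _ _ not_dense (c := d * D)).
  + by rewrite divr_ge0 // mulr_ge0 // ltW.
  + move=> v; rewrite !inE -leNgt => /andP[v_high vA]; apply: le_trans l_ge _.
    rewrite ler_nat; apply: leq_trans (S_star v); rewrite leq_min leqnn andbT -(ler_nat R).
    by have := dF v (subsetP AK v vA); lra.
  + by lra.
  + by move=> j /leq_trans; apply; rewrite leq_mul2l (leq_trans _ Aa) // subset_leq_card ?subsetDl.
- apply: (no_dense_subset_expands sE (subset_trans SF sFE) AL0 _ _ _ _ not_dense_low
    (c := d * k%:R / 6)).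
  + by rewrite divr_ge0 // mulr_ge0 // ltW.
  + move=> v; rewrite !inE => /andP[vA _]; have vK := subsetP AK v vA.
    have dk : d * k%:R <= k%:R by rewrite ler_piMl.
    have kv : k%:R <= (dE v)%:R :> R by rewrite ler_nat k_min.
    apply: le_trans (_ : (minn #|incident F v| l)%:R <= _); last by rewrite ler_nat.
    rewrite /minn; case: ifP => _; first by have := dF v vK; have := ler0n R k; lra.
    by apply: le_trans l_ge; rewrite -mulrA ler_wpM2l ?(ltW d0) //; lra.
  + by lra.
  + move=> j; rewrite -(ler_nat R) natrM => /(ler_wpM2r (sqr_ge0 D)) /le_trans; apply.
    rewrite -mulrA ler_wpM2l //; apply: le_trans few_low; rewrite ler_wpM2r ?sqr_ge0 // ler_nat.
    by apply/subset_leq_card/subsetP => v; rewrite !inE => /andP[/(subsetP AK) -> ->].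
Qed.

Variable eta : R.
Hypothesis E_distr : well_distributed p eta E.

Lemma outside_cut_ge A X (s g : R) : A \subset K -> A \subset X -> (#|X| <= 3 * #|A|)%N ->
  (16 * #|A| <= #|K|)%N -> 0 <= s -> 0 <= g -> s * n%:R <= #|A|%:R -> g * n%:R <= #|K|%:R ->
  0 <= eta <= s * g / 24 -> s * g / 8 * B <= #|F :&: cut_pairs (A, K :\: X)|%:R.
Proof.
move=> AK AX X3 A16 s0 g0 sA gK /andP[eta0 eta_le]; apply: le_trans (ltW (cut_remaining_gt
  p_gt0 sE E_distr alpha_ge0 delEF AK (subsetDl K X) eta0 alpha_half)).
have -> : K :\: X :\: A = K :\: X by rewrite setDDl (setUidPl AX).
have outside : 13/16 * #|K|%:R <= #|K :\: X|%:R :> R.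
  have : (#|K| <= #|K :\: X| + 3 * #|A|)%N.
    by rewrite -(cardsID X K) addnC leq_add2l (leq_trans _ X3) // subset_leq_card // subsetIr.
  by move: A16; rewrite -!(ler_nat R) natrD !natrM; lra.
have sgAK : s * n%:R * (g * n%:R) <= #|A|%:R * #|K|%:R by rewrite ler_pM // mulr_ge0.
have AK_half : 0 <= p * (#|A|%:R * #|K|%:R) by rewrite !mulr_ge0 // ltW.
have := ler_wpM2r AK_half alpha_half; have := ler_wpM2l (ltW p_gt0) sgAK.
have B_ge0 : 0 <= B by rewrite mulr_ge0 ?sqr_ge0 // ltW.
have := mulr_ge0 (mulr_ge0 s0 g0) B_ge0; have := ler_wpM2r B_ge0 eta_le.
have := ler_wpM2l (mulr_ge0 (ltW p_gt0) (ler0n R #|A|)) outside.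
by rewrite expr2; move: #|A|%:R #|K|%:R #|K :\: X|%:R n%:R => *; lra.
Qed.

Lemma sum_set_pairs_le_half (P : pred ({set T} * {set T})) (W : {set T} * {set T} -> {set {set T}})
    (q : R) : (0 < n)%N -> 0 < q -> q <= 1 -> (forall j, P j -> 3 * n%:R / q <= #|W j|%:R) ->
  \sum_(j | P j) (1 - q) ^+ #|W j| <= 1/2.
Proof.
move=> n0 q0 q1 W_large.
apply: (@le_trans _ _ (\sum_(j : {set T} * {set T}) expR (- (3 * n%:R)))).
  rewrite big_mkcond; apply: ler_sum => j _; case: ifP => [/W_large|_]; last exact: expR_ge0.
  by move=> /(exprn_subr_le_expR q0 q1); rewrite mulrC divfK // gt_eqF.
rewrite sumr_const -[#|_|]/#|{: {set T} * {set T}}| card_prod card_set_type.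
rewrite -[leLHS]mulr_natl natrM natrX.
apply: (@le_trans _ _ (expR n%:R * expR n%:R * expR (- (3 * n%:R)))).
  by rewrite ler_wpM2r ?expR_ge0 // ler_pM ?exprn_ge0 ?exprn2_le_expR.
rewrite -!expRD; apply: (@le_trans _ _ (expR (-1))).
  have n1 : 1 <= n%:R :> R by rewrite ler1n.
  by rewrite ler_expR; lra.
by rewrite expRN div1r lef_pV2 ?posrE ?expR_gt0 ?expR1_ge2.
Qed.

Lemma exists_large_set_expander (q s g : R) (a : nat) :
  0 < q -> q <= 1 -> 0 < s -> 0 < g -> 0 < eta <= s * g / 24 -> eta <= 1/2 -> (0 < n)%N ->
  g * n%:R <= #|K|%:R :> R -> (16 * a <= #|K|)%N -> 24 <= q * s * g * D ->
  exists2 S : {set {set T}}, S \subset F & #|S|%:R <= 3 * q * B /\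
    expands (edge_rel S) K (fun m => (s * n%:R <= m%:R) && (m <= a)%N).
Proof.
move=> q0 q1 s0 g0 /andP[eta0 eta_le] eta_half n0 gK aK D_large.
have nr0 : 0 < n%:R :> R by rewrite ltr0n.
have B0 : 0 < B by rewrite mulr_gt0 // exprn_gt0.
have [sFE _ _] := delEF.
pose P (j : {set T} * {set T}) := [&& j.1 \subset K, s * n%:R <= #|j.1|%:R, (#|j.1| <= a)%N,
   j.1 \subset j.2 & (#|j.2| <= 3 * #|j.1|)%N].
pose W (j : {set T} * {set T}) := F :&: cut_pairs (j.1, K :\: j.2).
have W_large j : P j -> 3 * n%:R / q <= #|W j|%:R.
  case: j => A X /and5P[/= AK sA Aa AX X3].
  have A16 : (16 * #|A| <= #|K|)%N by apply: leq_trans aK; rewrite leq_mul2l Aa.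
  apply: le_trans (outside_cut_ge AK AX X3 A16 (ltW s0) (ltW g0) sA gK _); last first.
    by rewrite (ltW eta0).
  by rewrite ler_pdivrMr //; have := ler_wpM2r (ltW nr0) D_large; rewrite expr2; lra.
have FB : #|F|%:R <= B.
  apply: le_trans (card_well_distributed_le (ltW p_gt0) sE E_distr eta_half).
  by rewrite ler_nat subset_leq_card.
have [|S [SF SB missed0]] := exists_hitting_subset q0 q1 (W := W) (P := P)
    (fun j _ => subsetIl _ _) B0 FB (_ : 0 < 1/2) (sum_set_pairs_le_half n0 q0 q1 W_large).
  by lra.
exists S; rewrite // SB; split=> // A AK /andP[sA Aa]; rewrite ltnNge; apply/negP => X3.
have : missed W P S = set0.
  apply/eqP; rewrite -cards_eq0 -leqn0 -ltnS -(ltr_nat R); apply: lt_le_trans missed0 _; lra.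
move/setP/(_ (A, closed_nbh (edge_rel S) A)); rewrite !inE /P /= AK sA Aa X3 subsetUl /=.
move/negP; apply; apply/eqP/setP=> e; rewrite !inE; apply/negbTE/negP => /and3P[eS _].
case/imsetP=> -[t x]; rewrite !inE /= => /and3P[tA _ /andP[]]; rewrite negb_or.
move=> /andP[_ /negP no_nbr] _ eE; apply: no_nbr; apply/exists_inP; exists t => //.
by rewrite /edge_rel -eE.
Qed.

End ExpandingSubgraphs.

(** * A Hamiltonian cycle in the remaining graph *)

Section RotationFamilies.
Variable T : finType.
Implicit Types (S : {set {set T}}).

(* Pairs [{t, x}] whose presence lets the Hamiltonian path of [S[V]] from [s] to [t] be rotated
   to end in [Y], or extended outside [V]. *)
Definition rotation_targets S (s : T) (Y V K : {set T}) (t : T) : {set T} :=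
  [set prev (s :: ham_tail (edge_rel S) V s t) y | y in Y] :|: (K :\: V).

Definition rotation_pairs S (i : T * {set T} * {set T} * {set T} * {set T}) : {set {set T}} :=
  let: (s, A, Y, V, K) := i in stars A (rotation_targets S s Y V K).

Definition closing_targets S (V : {set T}) (s : T) : {set T} :=
  [set y | `[< ham_path (edge_rel S) V s y >]].

Definition closing_pairs S (i : {set T} * {set T}) : {set {set T}} :=
  stars i.1 (closing_targets S i.2).

End RotationFamilies.

Section ResilientCycle.
Local Open Scope ring_scope.
Variables (R : realType) (T : finType) (p eps eta eta0 delta q : R) (a : nat).
Variables (E F S0 : {set {set T}}) (K : {set T}).
Implicit Types (A Y S V : {set T}) (G : {set {set T}}) (s t x y : T).
Notation n := #|T|.
Notation b := a.+1.
Notation B := (p * n%:R ^+ 2 : R).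
Notation D := (p * n%:R : R).
Notation deleted := (deg_in (edge_rel (E :\: F))).
Hypothesis p_gt0 : 0 < p.
Hypothesis eps_gt0 : 0 < eps.
Hypothesis eps_le : eps <= 1/4.
Hypothesis eta0_ge0 : 0 <= eta0.
Hypothesis eta0_le_eta : eta0 <= eta.
Hypothesis eta_gt0 : 0 < eta.
Hypothesis eta0_half : eta0 <= 1/2.
Hypothesis q_gt0 : 0 < q.
Hypothesis q_le1 : q <= 1.
Hypothesis eta_small : 100 * (eta * n%:R ^+ 2) <= eps * (b%:R * #|K|%:R).
Hypothesis b_small : 40 * b%:R <= eps * #|K|%:R.
Hypothesis K_large : 10 <= eps * #|K|%:R.
Hypothesis miss_small : 20 * n%:R * expR (- (q * (eta * D / 2))) <= eps * #|K|%:R.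
Hypothesis sE : E \subset pairs T.
Hypothesis E_distr : well_distributed p eta0 E.
Hypothesis E_rotations : ~~ has_deficient_set p (@rotation_pairs T) (delta * B) eta E.
Hypothesis E_closing : ~~ has_deficient_set p (@closing_pairs T) (delta * B) eta E.
Hypothesis delEF : bounded_deletion (1/2 - eps) E F K.
Hypothesis S0F : S0 \subset F.
Hypothesis S0_exp : expands (edge_rel S0) K (fun m => 0 < m <= a)%N.
Hypothesis budget : #|S0|%:R + n%:R + 3 * q * B <= delta * B.

Let sFE : F \subset E. Proof. exact: bounded_deletion_sub delEF. Qed.
Let F_in_K x y : edge_rel F x y -> x \in K.
Proof. exact: bounded_deletion_rel_in delEF. Qed.
Let p_ge0 : 0 <= p. Proof. exact: ltW. Qed.
Let alpha_ge0 : 0 <= 1/2 - eps. Proof. by move: eps_le; lra. Qed.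
Let alpha_half : 1/2 - eps <= 1/2. Proof. by move: eps_gt0; lra. Qed.
Let b_gt0 : 0 < b%:R :> R. Proof. by rewrite ltr0n. Qed.

Let K_gt0 : 0 < #|K|%:R :> R.
Proof. by rewrite -(pmulr_rgt0 _ eps_gt0); apply: lt_le_trans K_large. Qed.

Let n_gt0 : 0 < n%:R :> R.
Proof. by apply: lt_le_trans K_gt0 _; rewrite ler_nat max_card. Qed.

Let B_gt0 : 0 < B. Proof. by rewrite mulr_gt0 // exprn_gt0. Qed.

Lemma half_set_leaves A : A \subset K -> A != set0 -> (2 * #|A| <= #|K|)%N ->
  exists t x, [/\ t \in A, x \in K :\: A & edge_rel F t x].
Proof.
move=> AK A0 A_half; have [Aa|aA] := leqP #|A| a.
  have A1 : (0 < #|A|)%N by rewrite card_gt0.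
  have /subsetPn[x] : ~~ (closed_nbh (edge_rel S0) A \subset A).
    apply/negP => /subset_leq_card; have := S0_exp AK (introT andP (conj A1 Aa)).
    by move: A1; clear; lia.
  rewrite inE => /orP[->//|]; rewrite inE => /exists_inP[t tA S0tx] xA.
  have Ftx := edge_rel_sub S0F S0tx; exists t, x; split=> //.
  by rewrite inE xA; apply: F_in_K; rewrite edge_rel_sym; apply: Ftx.
apply: (exists_cut_edge p_gt0 sE E_distr alpha_ge0 delEF AK A_half eta0_ge0 alpha_half).
have bA : b%:R * #|K|%:R <= #|A|%:R * #|K|%:R :> R by rewrite ler_wpM2r // ler_nat.
have eta0n : eta0 * n%:R ^+ 2 <= eta * n%:R ^+ 2 by rewrite ler_wpM2r // exprn_ge0.
have := ler_wpM2l (ltW eps_gt0) bA; have := mulr_ge0 (ltW eta_gt0) (sqr_ge0 n%:R).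
by move: eta_small eta0n; move: (#|A|%:R * _) (b%:R * _) (n%:R ^+ 2) => *; lra.
Qed.

Lemma remaining_connected A : A \proper K -> A != set0 ->
  exists t x, [/\ t \in A, x \in K :\: A & edge_rel F t x].
Proof.
move=> AK A0; have AK' := proper_sub AK.
have [A_half|A_large] := leqP (2 * #|A|) #|K|; first exact: half_set_leaves.
have [|||t [x [tKA xA Ftx]]] := @half_set_leaves (K :\: A).
- exact: subsetDl.
- by rewrite setD_eq0; case/properP: AK => _ [x xK xA]; apply/subsetPn; exists x.
- by rewrite cardsDS //; move: A_large; clear; lia.
exists x, t; rewrite edge_rel_sym Ftx tKA; split=> //.
by move: xA; rewrite setDDS.
Qed.

Lemma sum_targets_lt A (X : T -> {set T}) : A \subset K -> #|A| = b ->
  (forall t, t \in A -> X t \subset K) ->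
  p * #|stars A X|%:R - eta * B < #|E :&: stars A X|%:R ->
  #|F :&: stars A X|%:R <= eta * B ->
  (\sum_(t in A) #|X t|)%:R < (1/2 - 9/10 * eps) * (b%:R * #|K|%:R) :> R.
Proof.
move=> AK A_card XK many_E few_F.
have deleted_le := sum_deleted_le p_gt0 sE E_distr alpha_ge0 delEF AK.
have := card_setI_stars_le delEF XK; rewrite -(ler_nat R) natrD => E_le.
have := card_stars_ge A X; rewrite -(ler_nat R) natrD natrM A_card => sum_le.
rewrite -(ltr_pM2l p_gt0); apply: le_lt_trans (ler_wpM2l p_ge0 sum_le) _.
have bb := ler_wpM2l (ler0n R b) b_small.
have slack := mulr_gt0 eps_gt0 (mulr_gt0 p_gt0 (mulr_gt0 b_gt0 K_gt0)).
have eta0B : eta0 * B <= eta * B by rewrite ler_wpM2r // ltW.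
have alphaB : (1/2 - eps) * (eta0 * B) <= 1/2 * (eta0 * B).
  by rewrite ler_wpM2r // mulr_ge0 // ltW.
move: (ler_wpM2l p_ge0 bb) (ler_wpM2l p_ge0 eta_small) many_E few_F E_le deleted_le.
rewrite A_card; move: (n%:R ^+ 2) slack eta0B alphaB (\sum_(t in A) _)%:R => N.
by move: #|stars A X|%:R #|E :&: _|%:R #|F :&: _|%:R b%:R #|K|%:R => *; lra.
Qed.

Section FixedVertexSet.
Variable V : {set T}.
Hypothesis V_longest : longest (edge_rel F) K V.

Let VK : V \subset K. Proof. by case: V_longest. Qed.

Lemma ham_path_in_F G s t : G \subset F -> ham_path (edge_rel G) V s t ->
  ham_path (edge_rel F) V s t.
Proof. by move=> GF; apply/ham_path_subrel/edge_rel_sub. Qed.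

Lemma F_nbr_of_end G s t x : G \subset F -> ham_path (edge_rel G) V s t -> edge_rel F t x ->
  x \in V.
Proof.
move=> GF /(ham_path_in_F GF); exact: (longest_end_nbr (@edge_rel_sym _ F) F_in_K V_longest).
Qed.

Definition rotation_witnesses G S s y : {set T} :=
  [set t in S | edge_rel F t (prev (s :: ham_tail (edge_rel G) V s t) y)].

Definition good_ends G S s : {set T} :=
  [set y in V :\ s | eta * D <= #|rotation_witnesses G S s y|%:R].

Section FixedStart.
Variables (G : {set {set T}}) (S : {set T}) (s : T).
Hypothesis GF : G \subset F.
Hypothesis S_ham : forall t, t \in S -> ham_path (edge_rel G) V s t.

Local Notation targets Y := (rotation_targets G s Y V K).

Lemma rotation_targets_sub Y t : Y \subset V -> t \in S -> targets Y t \subset K.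
Proof.
move=> YV tS; rewrite subUset subsetDl andbT; apply: subset_trans VK.
by apply/subsetP => _ /imsetP[y /(subsetP YV) yV ->]; apply: prev_ham_tail_in (S_ham tS) yV.
Qed.

Lemma card_rotation_targets Y t : Y \subset V -> t \in S ->
  #|targets Y t| = (#|Y| + #|K :\: V|)%N.
Proof.
move=> YV tS; have [_ up _ _] := ham_tailP (S_ham tS).
rewrite /rotation_targets cardsU (_ : _ :&: _ = set0) ?cards0 ?subn0; last first.
  apply/setP=> u; rewrite !inE; apply/negbTE/negP => /andP[/imsetP[y yY ->]].
  by rewrite prev_ham_tail_in ?(subsetP YV) //; apply: S_ham.
by rewrite card_imset //; apply: can_inj (next_prev up).
Qed.

Lemma card_rotation_edges_le Y : Y \subset V ->
  (#|F :&: stars S (targets Y)| <= \sum_(y in Y) #|rotation_witnesses G S s y|)%N.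
Proof.
move=> YV; rewrite card_setI_stars.
rewrite -(sum_card_exchange S Y
  (fun t y => edge_rel F t (prev (s :: ham_tail (edge_rel G) V s t) y))).
apply: leq_sum => t tS; rewrite -(card_imset _ (can_inj (next_prev
  (let: And4 _ up _ _ := ham_tailP (S_ham tS) in up)))).
apply/subset_leq_card/subsetP => x; rewrite !inE => /andP[/andP[_ x_target] Ftx].
case/orP: x_target => [/imsetP[y yY xE]|/andP[/negP[]]].
  by apply/imsetP; exists y; rewrite // inE yY -xE.
exact: F_nbr_of_end (S_ham tS) Ftx.
Qed.

Lemma many_good_ends : #|G|%:R <= delta * B -> #|S| = b ->
  (1/2 + 4/5 * eps) * #|K|%:R <= #|good_ends G S s|%:R.
Proof.
move=> G_small S_card; pose Y := (V :\ s) :\: good_ends G S s.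
have YV : Y \subset V by rewrite (subset_trans (subsetDl _ _)) // subsetDl.
have SK : S \subset K by apply/subsetP=> t /S_ham/ham_path_end/(subsetP VK).
have few_edges : #|F :&: stars S (targets Y)|%:R <= eta * B.
  apply: le_trans (_ : (\sum_(y in Y) #|rotation_witnesses G S s y|)%:R <= _).
    by rewrite ler_nat card_rotation_edges_le.
  rewrite natr_sum; apply: (@le_trans _ _ (\sum_(y in Y) eta * D)).
    apply: ler_sum => y; rewrite in_setD => /andP[]; rewrite inE => + yVs.
    by rewrite yVs -ltNge => /ltW.
  rewrite sumr_const -[leLHS]mulr_natr -mulrA ler_wpM2l ?(ltW eta_gt0) //.
  by rewrite expr2 mulrA ler_wpM2l ?mulr_ge0 ?ler_nat ?max_card.
have := not_deficient (s, S, Y, V, K) E_rotations (subset_trans GF sFE) G_small.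
move/(sum_targets_lt SK S_card (fun t => rotation_targets_sub YV))/(_ few_edges).
rewrite (eq_bigr _ (fun t => card_rotation_targets YV)) sum_nat_const S_card natrM natrD mulrCA.
rewrite ltr_pM2l // => few_targets.
have : (#|K| <= #|good_ends G S s| + #|Y| + 1 + #|K :\: V|)%N.
  have := cardsD1 s V; have := leq_b1 (s \in V); have := subset_leq_card VK.
  have := cardsID (good_ends G S s) (V :\ s); rewrite -/Y (cardsDS VK).
  have : (#|(V :\ s) :&: good_ends G S s| <= #|good_ends G S s|)%N.
    by rewrite subset_leq_card // subsetIr.
  by clear; lia.
rewrite -(ler_nat R) !natrD; move: few_targets K_large.
by move: #|good_ends G S s|%:R #|Y|%:R #|K :\: V|%:R #|K|%:R => *; lra.
Qed.

End FixedStart.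

(* [starts] and [ends s] are the outcome of Posa's argument in the sparse subgraph [G]; one more
   rotation, along an edge of [F], yields paths ending in more than half of [K]. *)
Section Closing.
Variables (G : {set {set T}}) (starts : {set T}) (ends : T -> {set T}).
Hypothesis GF : G \subset F.
Hypothesis G_budget : #|G|%:R + 3 * q * B <= delta * B.
Hypothesis starts_card : #|starts| = b.
Hypothesis startsK : starts \subset K.
Hypothesis ends_card : forall s, s \in starts -> #|ends s| = b.
Hypothesis ends_ham : forall s t, s \in starts -> t \in ends s -> ham_path (edge_rel G) V s t.

Definition good_pair (j : T * T) : bool :=
  (j.1 \in starts) && (j.2 \in good_ends G (ends j.1) j.1).

Definition rotation_edges (j : T * T) : {set {set T}} :=
  [set [set t; prev (j.1 :: ham_tail (edge_rel G) V j.1 t) j.2] |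
     t in rotation_witnesses G (ends j.1) j.1 j.2].

Lemma rotation_edges_sub j : rotation_edges j \subset F.
Proof. by apply/subsetP=> e /imsetP[t]; rewrite inE => /andP[_ Ft] ->. Qed.

Lemma rotation_edges_large j : good_pair j -> eta * D / 2 <= #|rotation_edges j|%:R.
Proof.
case: j => s y /andP[/= _]; rewrite inE => /andP[_ many].
have : (#|rotation_witnesses G (ends s) s y| <= 2 * #|rotation_edges (s, y)|)%N.
  rewrite -[leqLHS]muln1 -sum_nat_const.
  pose edge_at t : {set {set T}} := [set [set t; prev (s :: ham_tail (edge_rel G) V s t) y]].
  rewrite (eq_bigr (fun t => #|edge_at t|)) => [|t _]; last by rewrite cards1.
  apply: sum_incident_le.
  - by apply: subset_trans (rotation_edges_sub _) (subset_trans sFE sE).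
  - by move=> t tW; rewrite sub1set; apply/imsetP; exists t.
  - by move=> t e _; rewrite inE => /eqP ->; rewrite !inE eqxx.
by rewrite -(ler_nat R) natrM; move: many; lra.
Qed.

Lemma card_good_pair : (#|good_pair| <= b * n)%N.
Proof.
rewrite -starts_card -cardsT -cardsX; apply/subset_leq_card/subsetP=> j.
by rewrite unfold_in => /andP[j1 _]; rewrite inE j1 inE.
Qed.

Lemma exists_rotation_edges : exists F' : {set {set T}}, [/\ F' \subset F,
  #|F'|%:R <= 3 * q * B &
  #|missed rotation_edges good_pair F'|%:R < 2 * (b%:R * (eps * #|K|%:R) / 20)].
Proof.
apply: (exists_hitting_subset q_gt0 q_le1) => //.
- by move=> j _; apply: rotation_edges_sub.
- apply: le_trans (card_well_distributed_le p_ge0 sE E_distr eta0_half).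
  by rewrite ler_nat subset_leq_card.
- by rewrite divr_gt0 // !mulr_gt0.
apply: (@le_trans _ _ (\sum_(j | good_pair j) expR (- (q * (eta * D / 2))))).
  by apply: ler_sum => j /rotation_edges_large/(exprn_subr_le_expR q_gt0 q_le1).
rewrite sumr_const -[leLHS]mulr_natl ler_pdivlMr //.
apply: le_trans (ler_wpM2l (ler0n R b) miss_small).
have : #|good_pair|%:R <= b%:R * n%:R :> R by rewrite -natrM ler_nat card_good_pair.
move=> /(ler_wpM2r (expR_ge0 (- (q * (eta * D / 2))))).
by move: #|good_pair|%:R b%:R n%:R (expR _) => *; lra.
Qed.

Lemma ham_path_good_end (F' : {set {set T}}) s y : good_pair (s, y) ->
  (s, y) \notin missed rotation_edges good_pair F' -> ham_path (edge_rel (G :|: F')) V s y.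
Proof.
move=> good_sy; rewrite inE good_sy /= => /set0Pn[e]; rewrite inE => /andP[eF' /imsetP[t]].
have /andP[/= sA] := good_sy; rewrite !inE => /andP[/andP[ys yV] _] /andP[/= tS _] eE.
have [tail_path tail_uniq tail_last tailV] := ham_tailP (ends_ham sA tS).
apply: (ham_path_rotate (@edge_rel_sym _ _) _ tail_path tail_uniq tailV yV ys).
  exact/edge_rel_sub/subsetUl.
by rewrite tail_last /edge_rel -eE inE eF' orbT.
Qed.

Lemma sum_good_ends_le (F' : {set {set T}}) :
  (\sum_(s in starts) #|good_ends G (ends s) s| <=
   \sum_(s in starts) #|closing_targets (G :|: F') V s| +
   #|missed rotation_edges good_pair F'|)%N.
Proof.
set ms := missed _ _ _; have ms_le : (\sum_(s in starts) #|[set y | (s, y) \in ms]| <= #|ms|)%N.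
  rewrite -card_star_pairs; apply/subset_leq_card/subsetP=> -[s y].
  by rewrite inE /= inE => /andP[].
apply: leq_trans (leq_add (leqnn _) ms_le); rewrite -big_split /=; apply: leq_sum => s sA.
apply: leq_trans (leq_card_setU _ _); apply/subset_leq_card/subsetP=> y y_good.
rewrite in_setU ![y \in [set _ | _]]in_set; have [|hit] := boolP ((s, y) \in ms).
  by rewrite orbT.
by rewrite orbF; apply/asboolP/ham_path_good_end; rewrite // /good_pair sA.
Qed.

Lemma exists_closing_edge : exists s t, ham_path (edge_rel F) V s t /\ edge_rel F t s.
Proof.
apply: contrapT => no_closing; have [F' [F'F F'_small missed_lt]] := exists_rotation_edges.
have GF'F : G :|: F' \subset F by rewrite subUset GF.
have GF'_small : #|G :|: F'|%:R <= delta * B.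
  apply: le_trans G_budget; apply: (@le_trans _ _ (#|G|%:R + #|F'|%:R)); last by rewrite lerD2l.
  by rewrite -natrD ler_nat leq_card_setU.
have targets_sub s : s \in starts -> closing_targets (G :|: F') V s \subset K.
  by move=> _; apply/subsetP => y; rewrite inE => /asboolP/ham_path_end/(subsetP VK).
have no_edges : F :&: stars starts (closing_targets (G :|: F') V) = set0.
  apply/eqP/set0Pn => -[e]; rewrite inE => /andP[eF /imsetP[[s y]]].
  rewrite !inE /= => /and3P[_ _ /asboolP/(ham_path_in_F GF'F) path_sy] eE.
  by apply: no_closing; exists s, y; rewrite edge_rel_sym /edge_rel -eE.
have := not_deficient (starts, V) E_closing (subset_trans GF'F sFE) GF'_small.
move/(sum_targets_lt startsK starts_card targets_sub); rewrite no_edges cards0.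
rewrite mulr_ge0 ?(ltW eta_gt0) ?(ltW B_gt0) // => /(_ isT) few_targets.
have : b%:R * ((1/2 + 4/5 * eps) * #|K|%:R) <=
    (\sum_(s in starts) #|good_ends G (ends s) s|)%:R :> R.
  rewrite natr_sum -starts_card mulr_natl -sumr_const; apply: ler_sum => s sA.
  apply: many_good_ends => //; [by move=> t; apply: ends_ham| |exact: ends_card].
  by apply: le_trans G_budget; rewrite lerDl !mulr_ge0 ?(ltW q_gt0) // ltW.
have := sum_good_ends_le F'; rewrite -(ler_nat R) natrD; move: few_targets missed_lt.
have := mulr_gt0 eps_gt0 (mulr_gt0 b_gt0 K_gt0).
move: (\sum_(s in _) _)%:R (\sum_(s in _) _)%:R #|missed _ _ _|%:R b%:R #|K|%:R => *; lra.
Qed.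

End Closing.

Lemma exists_ends G s t : S0 \subset G -> G \subset F -> ham_path (edge_rel G) V s t ->
  exists2 S : {set T}, #|S| = b & forall t', t' \in S -> ham_path (edge_rel G) V s t'.
Proof.
move=> S0G GF path_st; apply: (Posa_endpoints (@edge_rel_sym _ G) path_st).
  by move=> t' x path_st' /(edge_rel_sub GF); apply: F_nbr_of_end path_st'.
move=> A AV; apply: expands_subrel S0_exp _ (subset_trans AV VK); exact: edge_rel_sub.
Qed.

Lemma longest_path_closes s0 c0 : path (edge_rel F) s0 c0 -> uniq (s0 :: c0) -> s0 :: c0 =i V ->
  exists s t, ham_path (edge_rel F) V s t /\ edge_rel F t s.
Proof.
move=> path_c0 uniq_c0 c0V.
have [P PF [P_size P_path]] := path_edges_sparse path_c0; pose G := S0 :|: P.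
have GF : G \subset F by rewrite subUset S0F.
have S0G : S0 \subset G by apply: subsetUl.
have path_G : ham_path (edge_rel G) V s0 (last s0 c0).
  by exists c0; split=> //; apply: sub_path P_path; apply/edge_rel_sub/subsetUr.
have [starts starts_card starts_ham] := exists_ends S0G GF path_G.
have /choice[ends ends_spec] : forall s, exists S : {set T}, s \in starts ->
    #|S| = b /\ forall t, t \in S -> ham_path (edge_rel G) V s t.
  move=> s; have [sA|sA] := boolP (s \in starts); last by exists set0.
  have [S S_card S_ham] := exists_ends S0G GF (ham_path_sym (@edge_rel_sym _ G) (starts_ham s sA)).
  by exists S.
apply: (@exists_closing_edge G starts ends) => //.
- apply: le_trans budget; rewrite lerD2r -natrD ler_nat; apply: leq_trans (leq_card_setU _ _) _.
  rewrite leq_add2l (leq_trans P_size) // -ltnS (leq_trans _ (leqW (max_card (mem (s0 :: c0))))) //.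
  by rewrite (card_uniqP uniq_c0).
- by apply/subsetP=> t /starts_ham/ham_path_end/(subsetP VK).
- by move=> s /ends_spec[].
- by move=> s t /ends_spec[_]; apply.
Qed.

End FixedVertexSet.

Theorem resilient_cycle : exists c : seq T, [/\ (2 < size c)%N, ucycle (edge_rel F) c & c =i K].
Proof.
have K0 : K != set0 by rewrite -card_gt0 -(ltr_nat R).
have [s0 [c0 [path_c0 uniq_c0 V_longest]]] := exists_longest_path (edge_rel F) K0.
have c0V : s0 :: c0 =i [set x in s0 :: c0] by move=> x; rewrite in_set.
have [s [t [path_st Fts]]] := longest_path_closes V_longest path_c0 uniq_c0 c0V.
have VK := longest_cycle_spans (@edge_rel_sym _ F) F_in_K V_longest path_st Fts remaining_connected.
have [r [path_r uniq_r last_r rV]] := path_st.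
exists (s :: r); split; last by move=> x; rewrite rV VK.
  rewrite (size_uniq_mem uniq_r rV) VK -(ltr_nat R).
  have := ler_wpM2r (ltW K_gt0) eps_le; move: K_large; lra.
by rewrite /ucycle uniq_r andbT /= rcons_path path_r last_r.
Qed.

End ResilientCycle.

(** * The random graph process at a fixed time *)

Section FinfunCons.
Variables (X : Type) (m : nat).

Definition fcons (u : X * {ffun 'I_m.+1 -> X}) : {ffun 'I_m.+2 -> X} :=
  [ffun i => if unlift ord0 i is Some j then u.2 j else u.1].

Lemma fcons0 u : fcons u ord0 = u.1.
Proof. by rewrite ffunE unlift_none. Qed.

Lemma fconsS u i : fcons u (lift ord0 i) = u.2 i.
Proof. by rewrite ffunE liftK. Qed.

Lemma fcons_bij : bijective fcons.
Proof.
exists (fun g : {ffun 'I_m.+2 -> X} => (g ord0, [ffun i => g (lift ord0 i)])).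
  by move=> [x g]; rewrite fcons0; congr (_, _); apply/ffunP => i; rewrite ffunE fconsS.
move=> g; apply/ffunP => i; rewrite ffunE /=; case: unliftP => [j ->|->//].
by rewrite ffunE.
Qed.

End FinfunCons.

Section MarkovChain.
Local Open Scope ring_scope.
Variables (R : realType) (X : finType) (k : X -> X -> R).
Implicit Types (a f : X -> R) (bad : nat -> pred X).

Definition chain_weight m a (G : {ffun 'I_m.+1 -> X}) : R :=
  a (G ord0) * \prod_(i < m) k (G (widen_ord (leqnSn _) i)) (G (lift ord0 i)).

Definition push a : X -> R := fun y => \sum_x a x * k x y.

Lemma chain_weight_fcons m a x (G : {ffun 'I_m.+1 -> X}) :
  chain_weight a (fcons (x, G)) = a x * k x (G ord0) *
     \prod_(i < m) k (G (widen_ord (leqnSn _) i)) (G (lift ord0 i)).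
Proof.
rewrite /chain_weight fcons0 big_ord_recl /= fconsS mulrA; congr (_ * k _ _ * _).
  have -> : widen_ord (leqnSn m.+1) ord0 = ord0 by apply: val_inj.
  by rewrite fcons0.
apply: eq_bigr => i _; rewrite fconsS.
have -> : widen_ord (leqnSn m.+1) (lift ord0 i) = lift ord0 (widen_ord (leqnSn m) i).
  exact: val_inj.
by rewrite fconsS.
Qed.

Lemma sum_fcons m (h : {ffun 'I_m.+2 -> X} -> R) :
  \sum_G h G = \sum_(G : {ffun 'I_m.+1 -> X}) \sum_x h (fcons (x, G)).
Proof.
rewrite (reindex (@fcons X m)) /=; last by apply: onW_bij; apply: fcons_bij.
by rewrite exchange_big /= pair_bigA /=; apply: eq_bigr => -[x G].
Qed.

Lemma sum_ffun1 (h : {ffun 'I_1 -> X} -> R) : \sum_G h G = \sum_x h [ffun=> x].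
Proof.
rewrite (reindex (fun x : X => [ffun _ : 'I_1 => x])) //=.
apply: onW_bij; exists (fun g : {ffun 'I_1 -> X} => g ord0) => [x|g]; first by rewrite ffunE.
by apply/ffunP => i; rewrite ffunE ord1.
Qed.

Lemma sum_chain_weight_fcons m a (h : {ffun 'I_m.+1 -> X} -> R) :
  \sum_(G : {ffun 'I_m.+1 -> X}) \sum_x chain_weight a (fcons (x, G)) * h G =
  \sum_G chain_weight (push a) G * h G.
Proof.
apply: eq_bigr => G _; rewrite -mulr_suml; congr (_ * _).
rewrite /chain_weight /push mulr_suml; apply: eq_bigr => x _.
exact: chain_weight_fcons.
Qed.

Lemma sum_chain_weightS m a :
  \sum_G chain_weight (m := m.+1) a G = \sum_G chain_weight (m := m) (push a) G.
Proof.
rewrite sum_fcons; have := sum_chain_weight_fcons (m := m) a (fun=> 1).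
under eq_bigr do under eq_bigr do rewrite mulr1.
by move=> ->; under eq_bigr do rewrite mulr1.
Qed.

Lemma sum_chain_weight m a : \sum_G chain_weight (m := m) a G = \sum_x iter m push a x.
Proof.
elim: m a => [|m IH] a; last by rewrite sum_chain_weightS IH iterSr.
rewrite sum_ffun1; apply: eq_bigr => x _.
by rewrite /chain_weight big_ord0 ffunE mulr1.
Qed.

Hypothesis k_ge0 : forall x y, 0 <= k x y.
Hypothesis k_row : forall x, \sum_y k x y <= 1.

Lemma push_ge0 a : (forall x, 0 <= a x) -> forall y, 0 <= push a y.
Proof. by move=> a0 y; apply: sumr_ge0 => x _; rewrite mulr_ge0. Qed.

Lemma chain_weight_ge0 m a G : (forall x, 0 <= a x) -> 0 <= chain_weight (m := m) a G.
Proof. by move=> a0; rewrite mulr_ge0 // prodr_ge0. Qed.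

Lemma sum_chain_weight_le m a : (forall x, 0 <= a x) ->
  \sum_G chain_weight (m := m) a G <= \sum_x a x.
Proof.
move=> a0; rewrite sum_chain_weight; elim: m a a0 => [|m IH] a a0 //.
rewrite iterSr; apply: le_trans (IH _ (push_ge0 a0)) _.
rewrite /push exchange_big /=; apply: ler_sum => x _; rewrite -mulr_sumr.
by rewrite ler_piMr.
Qed.

Lemma chain_marginal_le m a f (i : 'I_m.+1) : (forall x, 0 <= a x) -> (forall x, 0 <= f x) ->
  \sum_G chain_weight a G * f (G i) <= \sum_x iter i push a x * f x.
Proof.
move=> + f0; elim: m a i => [|m IH] a i a0; case: (unliftP ord0 i) => [j ->|->].
- by case: j.
- under eq_bigr => G _ do rewrite mulrAC.
  exact: (@sum_chain_weight_le 0 (fun x => a x * f x)) (fun x => mulr_ge0 (a0 x) (f0 x)).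
- rewrite sum_fcons; under eq_bigr do under eq_bigr do rewrite fconsS.
  rewrite (sum_chain_weight_fcons a (fun G => f (G j))) lift0 iterSr.
  exact: IH (push_ge0 a0).
- under eq_bigr => G _ do rewrite mulrAC.
  exact: (@sum_chain_weight_le _ (fun x => a x * f x)) (fun x => mulr_ge0 (a0 x) (f0 x)).
Qed.

Lemma chain_exists_le m a bad : (forall x, 0 <= a x) ->
  \sum_G chain_weight (m := m) a G * [exists i : 'I_m.+1, bad i (G i)]%:R <=
  \sum_(i < m.+1) \sum_(x | bad i x) iter i push a x.
Proof.
move=> a0; apply: (@le_trans _ _ (\sum_G \sum_(i < m.+1) chain_weight a G * (bad i (G i))%:R)).
  apply: ler_sum => G _; rewrite -mulr_sumr ler_wpM2l ?chain_weight_ge0 //.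
  case: existsP => [[i bad_i]|_]; last by rewrite sumr_ge0.
  by rewrite (bigD1 i) //= bad_i lerDl sumr_ge0.
rewrite exchange_big; apply: ler_sum => i _.
apply: le_trans (chain_marginal_le i a0 (f := fun x => (bad i x)%:R) _) _ => //.
by rewrite [leRHS]big_mkcond; apply: ler_sum => x _; case: ifP; rewrite ?mulr1 ?mulr0.
Qed.

End MarkovChain.

Section BinomialMode.

Lemma binomial_mode N M j : M <= N -> j <= N ->
  'C(N, j) * M ^ j * (N - M) ^ (N - j) <= 'C(N, M) * M ^ M * (N - M) ^ (N - M).
Proof.
move=> MN jN; pose t j := 'C(N, j) * M ^ j * (N - M) ^ (N - j); rewrite -/(t j) -/(t M).
have ratio i : i < N -> t i.+1 * (i.+1 * (N - M)) = t i * ((N - i) * M).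
  move=> iN; have Ni : N - i = (N - i.+1).+1 by move: iN; clear; lia.
  have := mul_bin_left N i; rewrite /t !Ni !expnS => binS.
  have -> : 'C(N, i.+1) * (M * M ^ i) * (N - M) ^ (N - i.+1) * (i.+1 * (N - M)) =
     (i.+1 * 'C(N, i.+1)) * (M * M ^ i * (N - M) ^ (N - i.+1) * (N - M)) by clear; lia.
  by rewrite binS; clear; lia.
have [NM|MltN] := leqP N M.
  rewrite /t; have -> : M = N by apply/eqP; rewrite eqn_leq MN.
  have [->//|jN'] := eqVneq j N; rewrite subnn [X in _ * X]exp0n ?muln0 //.
  by rewrite subn_gt0 ltn_neqAle jN'.
have NM : 0 < N - M by rewrite subn_gt0.
have up i : i < M -> t i <= t i.+1.
  move=> iM; have iN : i < N by apply: ltn_trans iM MltN.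
  rewrite -(@leq_pmul2r (i.+1 * (N - M))) ?muln_gt0 // ratio // leq_mul2l; apply/orP; right.
  by rewrite mulnC leq_mul // leq_sub2l // ltnW.
have down i : M <= i -> i < N -> t i.+1 <= t i.
  move=> iM iN; rewrite -(@leq_pmul2r (i.+1 * (N - M))) ?muln_gt0 // ratio // leq_mul2l.
  by apply/orP; right; rewrite mulnC leq_mul ?leq_sub2l // leqW.
have [jM|Mj] := leqP j M.
  rewrite -(subKn jM); elim: (M - j) (leq_subr j M) => [|d IH] dM; first by rewrite subn0.
  apply: leq_trans (IH (ltnW dM)); have -> : M - d = (M - d.+1).+1 by move: dM; clear; lia.
  by apply: up; move: dM; clear; lia.
rewrite -(subnKC (ltnW Mj)) in jN *; elim: (j - M) jN => [|d IH] dN; first by rewrite addn0.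
by rewrite addnS in dN *; apply: leq_trans (IH (ltnW dN)); apply: down => //; apply: leq_addr.
Qed.

Lemma binomial_mode_prob (R : realType) N M : 0 < N -> M <= N ->
  (1 <= N.+1%:R * ('C(N, M)%:R * ((M%:R / N%:R) ^+ M * (1 - M%:R / N%:R) ^+ (N - M))) :> R)%R.
Proof.
move=> N0 MN; set p := (M%:R / N%:R : R)%R.
have Nr : (N%:R != 0 :> R)%R by rewrite pnatr_eq0 -lt0n.
have qE : (1 - p = (N - M)%:R / N%:R)%R by rewrite natrB // mulrBl mulfV.
have termE j : j <= N -> ('C(N, j)%:R * (p ^+ j * (1 - p) ^+ (N - j)) =
    ('C(N, j) * M ^ j * (N - M) ^ (N - j))%:R / N%:R ^+ N)%R.
  move=> jN; rewrite qE /p !expr_div_n !natrM !natrX.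
  have -> : (N%:R ^+ N = N%:R ^+ j * N%:R ^+ (N - j) :> R)%R by rewrite -exprD subnKC.
  by field; rewrite !expf_neq0.
have total : (1 = (p + (1 - p)) ^+ N :> R)%R by rewrite addrC subrK expr1n.
rewrite [leLHS]total exprDn -[N.+1 in leRHS]card_ord mulr_natl -sumr_const.
apply: ler_sum => i _; have iN : i <= N by rewrite -ltnS.
rewrite -mulr_natl (termE M MN) -bin_sub //.
have := termE (N - i) (leq_subr _ _); rewrite subKn // => ->.
rewrite ler_wpM2r ?invr_ge0 ?exprn_ge0 // ler_nat.
by have := binomial_mode MN (leq_subr i N); rewrite subKn.
Qed.

End BinomialMode.

Lemma eset_pairs (T : finType) (G : graph T) : eset G \subset pairs T.
Proof. by apply/subsetP => e /edgeP/andP[_ e2]; rewrite inE. Qed.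

Section Process.
Local Open Scope ring_scope.
Variables (R : realType) (n : nat).
Notation N := 'C(n, 2).
Notation T := 'I_n.
Implicit Types (x y : graph 'I_n) (e : {set 'I_n}) (E : {set {set 'I_n}}).

Lemma card_pairs_ord : #|pairs T| = N.
Proof. by rewrite card_pairs card_ord. Qed.

Definition spanning_with (j : nat) : pred (graph 'I_n) :=
  fun x => (vset x == setT) && (#|eset x| == j)%N.

Definition uniform_weight (j : nat) x : R := if spanning_with j x then 'C(N, j)%:R^-1 else 0.

Lemma spanning_eq i j x y : spanning_with i x -> spanning_with j y -> eset x = eset y -> x = y.
Proof. by move=> /andP[/eqP vx _] /andP[/eqP vy _]; apply: graph_eq; rewrite vx vy. Qed.

Lemma uniform_weight_ge0 j x : 0 <= uniform_weight j x.
Proof. by rewrite /uniform_weight; case: ifP => // _; rewrite invr_ge0. Qed.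

Lemma step_prob_ge0 x y : 0 <= step_prob R x y.
Proof. by rewrite /step_prob; case: ifP => // _; rewrite invr_ge0. Qed.

Lemma step_prob_row x : \sum_y step_prob R x y <= 1.
Proof.
pose next := [set y | [exists e in nonedges x, adds_edge x e y]].
have -> : \sum_y step_prob R x y = \sum_(y in next) #|nonedges x|%:R^-1.
  by rewrite [RHS]big_mkcond; apply: eq_bigr => y _; rewrite inE.
have : (#|next| <= #|nonedges x|)%N.
  rewrite -(card_in_imset (f := @eset 'I_n) (D := next)).
    apply: leq_trans (leq_imset_card (fun e => e |: eset x) (nonedges x)).
    apply/subset_leq_card/subsetP => E /imsetP[y]; rewrite inE.
    by move=> /exists_inP[e ne /andP[_ /eqP ->]] ->; apply/imsetP; exists e.
  move=> y z; rewrite !inE => /exists_inP[e _ /andP[/eqP vy _]].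
  by case/exists_inP=> e' _ /andP[/eqP vz _]; apply: graph_eq; rewrite vy vz.
rewrite sumr_const; case: #|nonedges x| => [|m] next_le.
  by move: next_le; rewrite leqn0 => /eqP ->; rewrite mulr0n ler01.
by rewrite -[leLHS]mulr_natl ler_pdivrMr ?mul1r ?ltr0n // ler_nat.
Qed.

Fact wf_delete_edge y e : wf_graph (vset y, eset y :\ e).
Proof. by apply/forall_inP => f /=; rewrite inE => /andP[_]; apply: edgeP. Qed.

Definition delete_edge y e : graph 'I_n := Graph (wf_delete_edge y e).

Lemma card_nonedges x j : spanning_with j x -> #|nonedges x| = (N - j)%N.
Proof.
case/andP => /eqP vx /eqP <-; rewrite -card_pairs_ord -cardsDS ?eset_pairs //.
by apply: eq_card => e; rewrite !inE vx subsetT /= andbC.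
Qed.

Lemma adds_edgeP j x y : reflect
  (spanning_with j.+1 y /\ exists2 e, e \in eset y & x = delete_edge y e)
  (spanning_with j x && [exists e in nonedges x, adds_edge x e y]).
Proof.
apply: (iffP andP) => [[/andP[/eqP vx /eqP cx] /exists_inP[e]]|].
  rewrite inE => /and3P[_ _ ex] /andP[/eqP vy /eqP ey]; split.
    by rewrite /spanning_with vy vx eqxx ey cardsU1 ex cx add1n eqxx.
  exists e; first by rewrite ey setU11.
  apply: graph_eq; rewrite [RHS]/= /delete_edge /vset /eset /= -/(vset y) -/(eset y) ?vy ?ey //.
  by rewrite setU1K.
move=> [/andP[/eqP vy /eqP cy] [e ey ->]]; have /andP[e1 e2] := edgeP ey; split.
  rewrite /spanning_with /vset /eset /= -/(vset y) -/(eset y) vy eqxx /=.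
  by move: cy; rewrite (cardsD1 e) ey add1n => -[->].
apply/exists_inP; exists e; first by rewrite inE /vset /eset /= -/(vset y) e1 e2 !inE eqxx.
by rewrite /adds_edge /vset /eset /= -/(vset y) -/(eset y) eqxx setD1K //= eqxx.
Qed.

Lemma card_predecessors j y : spanning_with j.+1 y ->
  #|[pred x | spanning_with j x && [exists e in nonedges x, adds_edge x e y]]| = j.+1.
Proof.
move=> y_size; have /andP[_ /eqP cy] := y_size; rewrite -[RHS]cy.
rewrite -[RHS](card_in_imset (f := delete_edge y)); last first.
  move=> e f ey fy del_eq.
  have : eset (delete_edge y e) = eset (delete_edge y f) by rewrite del_eq.
  rewrite /eset /= -/(eset y) => /setP/(_ e); rewrite !inE eqxx ey andbT /=.
  by rewrite andbT => /esym/negbFE/eqP.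
apply: eq_card => x; rewrite unfold_in; apply/adds_edgeP/imsetP => [[_ [e ey ->]]|[e ey ->]].
  by exists e.
by split=> //; exists e.
Qed.

Lemma push_uniform_weight j : (j < N)%N ->
  push (@step_prob R n) (uniform_weight j) =1 uniform_weight j.+1.
Proof.
move=> jN y; rewrite /push.
pose pre := [pred x | spanning_with j x && [exists e in nonedges x, adds_edge x e y]].
transitivity (\sum_(x | pre x) ('C(N, j)%:R^-1 * (N - j)%:R^-1 : R)).
  rewrite [RHS]big_mkcond; apply: eq_bigr => x _; rewrite /uniform_weight /step_prob /pre /=.
  case: ifP => [/card_nonedges ->|_]; last by rewrite mul0r.
  by case: ifP => _; rewrite ?mulr0.
rewrite sumr_const /uniform_weight; case: ifP => y_size; last first.
  by rewrite eq_card0 // => x; apply/negP => /adds_edgeP[]; rewrite y_size.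
rewrite (card_predecessors y_size) -[LHS]mulr_natl.
have C0 : 'C(N, j)%:R != 0 :> R by rewrite pnatr_eq0 -lt0n bin_gt0 ltnW.
have CS0 : 'C(N, j.+1)%:R != 0 :> R by rewrite pnatr_eq0 -lt0n bin_gt0.
have Nj0 : (N - j)%:R != 0 :> R by rewrite pnatr_eq0 -lt0n subn_gt0.
have : j.+1%:R * 'C(N, j.+1)%:R = (N - j)%:R * 'C(N, j)%:R :> R by rewrite -!natrM mul_bin_left.
by move=> binS; apply: (mulIf CS0); rewrite mulVf // mulrAC binS; field; rewrite C0 Nj0.
Qed.

Lemma iter_push_uniform_weight j : (j <= N)%N ->
  iter j (push (@step_prob R n)) (uniform_weight 0) =1 uniform_weight j.
Proof.
elim: j => //= j IH jN y; rewrite -push_uniform_weight // /push.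
by apply: eq_bigr => x _; rewrite IH // ltnW.
Qed.

Lemma process_weightE (G : process n) :
  process_weight R G = chain_weight (@step_prob R n) (uniform_weight 0) G.
Proof.
rewrite /process_weight /chain_weight; congr (_ * _).
rewrite /uniform_weight /spanning_with bin0 invr1; case: eqP => [->|neq].
  by rewrite /vset /eset /= eqxx cards0.
case: ifP => // /andP[/eqP v /eqP /cards0_eq e]; case: neq.
by apply: graph_eq; rewrite ?v ?e.
Qed.

Lemma process_weight_ge0 (G : process n) : 0 <= process_weight R G.
Proof.
rewrite process_weightE; apply: chain_weight_ge0; first exact: step_prob_ge0.
exact: uniform_weight_ge0.
Qed.

Lemma sum_process_weight : \sum_(G : process n) process_weight R G = 1.
Proof.
rewrite (eq_bigr _ (fun G _ => process_weightE G)) sum_chain_weight.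
rewrite (eq_bigr _ (fun x _ => iter_push_uniform_weight (leqnn N) x)).
rewrite /uniform_weight -big_mkcond sumr_const binn invr1.
have wfT : wf_graph (setT : {set 'I_n}, pairs T).
  by apply/forall_inP => e /=; rewrite inE => ->; rewrite subsetT.
rewrite (_ : #|_| = 1%N) //; apply/eqP/fintype.card1P; exists (Graph wfT) => x.
rewrite unfold_in inE; apply/idP/eqP => [/andP[/eqP v /eqP c]|->]; last first.
  by rewrite /spanning_with /vset /eset /= card_pairs_ord !eqxx.
apply: graph_eq; rewrite ?v //; apply/eqP; rewrite eqEcard eset_pairs c.
by rewrite /eset /= card_pairs_ord.
Qed.

Lemma bernoulli_weight_pairs E (p : R) : E \subset pairs T ->
  bernoulli_weight p (pairs T) E = p ^+ #|E| * (1 - p) ^+ (N - #|E|).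
Proof.
move=> sE; rewrite /bernoulli_weight (bigID (mem E)) /=; congr (_ * _).
  by rewrite -prodr_const; apply: eq_bigr => e eE; rewrite eE (subsetP sE).
rewrite (bigID (mem (pairs T))) /= [X in _ * X]big1 ?mulr1; last first.
  by move=> e /andP[/negbTE -> /negbTE ->].
rewrite (eq_bigr (fun=> 1 - p)); last by move=> e /andP[/negbTE -> ->].
rewrite prodr_const -card_pairs_ord -cardsDS //; congr (_ ^+ _).
by apply: eq_card => e; rewrite in_setD.
Qed.

Lemma sum_uniform_weight_le j (bad : pred {set {set 'I_n}}) : (0 < N)%N -> (j <= N)%N ->
  \sum_(x | ~~ spanning_with j x || bad (eset x)) uniform_weight j x <=
  N.+1%:R * Pr (j%:R / N%:R : R) (pairs T) bad.
Proof.
move=> N0 jN; set p := j%:R / N%:R : R.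
have p01 : 0 <= p <= 1.
  by rewrite divr_ge0 //= ler_pdivrMr ?ltr0n // mul1r ler_nat.
pose weight E : R := N.+1%:R * bernoulli_weight p (pairs T) E.
have weight_ge0 E : 0 <= weight E by rewrite mulr_ge0 // bernoulli_weight_ge0.
apply: (@le_trans _ _ (\sum_(x | spanning_with j x && bad (eset x)) weight (eset x))).
  rewrite big_mkcond [leRHS]big_mkcond; apply: ler_sum => x _; rewrite /uniform_weight.
  case: (boolP (spanning_with j x)) => //= x_size.
  case: ifP => // _; have /andP[_ /eqP cx] := x_size.
  rewrite /weight bernoulli_weight_pairs ?eset_pairs // cx.
  have C0 : 0 < 'C(N, j)%:R :> R by rewrite ltr0n bin_gt0.
  by rewrite -(ler_pM2l C0) mulfV ?gt_eqF // mulrCA binomial_mode_prob.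
have eset_inj : {in [pred x | spanning_with j x && bad (eset x)] &, injective (@eset 'I_n)}.
  by move=> x y; rewrite !inE => /andP[x_size _] /andP[y_size _]; apply: spanning_eq x_size y_size.
rewrite -[leLHS](big_imset weight eset_inj) /Pr mulr_sumr big_mkcond [leRHS]big_mkcond /=.
apply: ler_sum => E _; case: ifP => [/imsetP[x]|_]; last first.
  by case: ifP => // _; apply: weight_ge0.
by rewrite inE => /andP[_ bad_x] ->; rewrite bad_x.
Qed.

Lemma process_prob_le1 (A : set (process n)) : process_prob R A <= 1.
Proof.
rewrite -sum_process_weight /process_prob [leLHS]big_mkcond /=; apply: ler_sum => G _.
by case: ifP => // _; apply: process_weight_ge0.
Qed.

Lemma process_prob_ge (A : set (process n)) (bad : nat -> pred {set {set 'I_n}}) : (0 < N)%N ->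
  (forall G : process n, (forall M : 'I_N.+1, vset (G M) = setT /\ ~~ bad M (eset (G M))) -> A G) ->
  1 - \sum_(M < N.+1) N.+1%:R * Pr (M%:R / N%:R : R) (pairs T) (bad M) <= process_prob R A.
Proof.
move=> N0 good_A; pose bad_graph M x := ~~ spanning_with M x || bad M (eset x).
have bad_le : \sum_G chain_weight (@step_prob R n) (uniform_weight 0) G *
      [exists i : 'I_N.+1, bad_graph i (G i)]%:R <=
    \sum_(M < N.+1) N.+1%:R * Pr (M%:R / N%:R : R) (pairs T) (bad M).
  apply: le_trans (chain_exists_le step_prob_ge0 step_prob_row N bad_graph
    (uniform_weight_ge0 0)) _.
  apply: ler_sum => M _; have MN : (M <= N)%N by rewrite -ltnS.
  rewrite (eq_bigr _ (fun x _ => iter_push_uniform_weight MN x)).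
  exact: sum_uniform_weight_le.
rewrite lerBlDr -[leLHS]sum_process_weight; apply: le_trans (lerD (lexx _) bad_le).
rewrite /process_prob [X in X + _]big_mkcond /= -big_split /=; apply: ler_sum => G _.
rewrite -process_weightE; have w0 := process_weight_ge0 G.
case: existsP => [_|no_bad]; first by rewrite mulr1 lerDr; case: ifP.
rewrite mulr0 addr0; case: ifP => // /negP[]; apply/mem_set/good_A => M.
have : ~~ bad_graph M (G M) by apply/negP => bad_M; apply: no_bad; exists M.
by rewrite negb_or negbK => /andP[/andP[/eqP -> _]].
Qed.

End Process.

(** * Cores and resilience *)

Section GraphDegrees.
Variable T : finType.
Implicit Types (G H K L : graph T) (A U Z : {set T}) (v : T).

Lemma degree_deg_in G v : v \in vset G ->
  degree G v = deg_in (edge_rel (eset G)) (vset G) v.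
Proof.
move=> vG; rewrite deg_in_incident ?eset_pairs // => e /edgeP/andP[eG _].
exact: eG.
Qed.

Lemma resiliently_hamiltonian_le (R : realType) (alpha beta : R) G : (alpha <= beta)%R ->
  resiliently_hamiltonian beta G -> resiliently_hamiltonian alpha G.
Proof.
move=> ab ham_beta H HG H_deg; apply: ham_beta => // v vG; apply: le_trans (H_deg v vG) _.
by rewrite ler_wpM2r.
Qed.

Fact wf_crossing G A :
  wf_graph (vset G, [set e in eset G | ~~ (e \subset A) && ~~ (e \subset vset G :\: A)]).
Proof. by apply/forall_inP => e /=; rewrite inE => /andP[/edgeP]. Qed.

Definition crossing G A : graph T := Graph (wf_crossing G A).

Lemma crossing_sub G A : subgraph (crossing G A) G.
Proof. by apply/andP; split; rewrite ?subxx //; apply/subsetP=> e; rewrite inE => /andP[]. Qed.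

Lemma crossingC G A : A \subset vset G -> crossing G (vset G :\: A) = crossing G A.
Proof.
move=> AG; apply: graph_eq => //; apply/setP => e.
by rewrite !inE setDDS // [X in _ && X]andbC.
Qed.

Lemma degree_crossing_le G A v : A \subset vset G -> v \in A ->
  degree (crossing G A) v <= deg_in (edge_rel (eset G)) (vset G :\: A) v.
Proof.
move=> AG vA; rewrite degree_deg_in ?(subsetP AG) //.
apply/subset_leq_card/subsetP => u; rewrite !inE => /andP[uG].
by rewrite /edge_rel inE subUset !sub1set vA /= uG andbT => /andP[-> /andP[-> _]].
Qed.

Lemma path_closed (e : rel T) A x p :
  (forall u v, e u v -> u \in A -> v \in A) -> path e x p -> x \in A -> {subset p <= A}.
Proof.
move=> e_closed; elim: p x => [|y p IH] x //= /andP[xy path_p] xA z.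
have yA := e_closed _ _ xy xA; rewrite in_cons => /predU1P[-> //|]; exact: IH yA _.
Qed.

Lemma cut_not_hamiltonian G A : A \subset vset G -> A != set0 -> vset G :\: A != set0 ->
  ~ hamiltonian (remove_edges G (crossing G A)).
Proof.
move=> AG /set0Pn[x xA] /set0Pn[y]; rewrite inE => /andP[yA yG] [c [_ /andP[cycle_c _] cG]].
set G' := remove_edges _ _ in cycle_c cG.
have A_closed u v : adj G' u v -> u \in A -> v \in A.
  rewrite /adj !inE => /andP[not_crossing uvG] uA; apply: contraR not_crossing => vA.
  by rewrite uvG !subUset !sub1set !inE uA (negbTE vA).
have [|i p rotE] := @rot_to _ c x; first by rewrite cG (subsetP AG).
have path_p : path (adj G') x (rcons p x) by move: cycle_c; rewrite -(rot_cycle i) rotE.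
have y_in : y \in rcons p x by rewrite mem_rcons -rotE mem_rot cG.
by have := path_closed A_closed path_p xA y_in; rewrite (negbTE yA).
Qed.

Lemma exists_balanced_crossing G : vset G != set0 -> min_degree_ge 3 G ->
  exists A, [/\ A \subset vset G, A != set0, vset G :\: A != set0 &
    forall v, v \in vset G -> 2 * degree (crossing G A) v <= degree G v + 3].
Proof.
move=> V0 deg3; pose f v := (degree G v).-1./2.
have r_irr : irreflexive (edge_rel (eset G)).
  by move=> x; apply/negP => /(edge_rel_neq (eset_pairs G)); rewrite eqxx.
have f_le v : (f v).*2 <= (degree G v).-1 by rewrite -[leqRHS]odd_double_half leq_addl.
have f_ge v : (degree G v).-1 <= (f v).*2.+1.
  by rewrite -[leqLHS]odd_double_half -add1n leq_add2r leq_b1.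
have f_gt0 : {in vset G, forall v, 0 < f v} by move=> v /deg3; have := f_ge v; lia.
have deg_lt : {in vset G, forall v, f v + f v < deg_in (edge_rel (eset G)) (vset G) v}.
  by move=> v vG; rewrite -degree_deg_in //; have := deg3 v vG; have := f_le v; lia.
have [A] := Stiebitz_partition (@edge_rel_sym _ _) r_irr V0 f_gt0 f_gt0 deg_lt.
case/and5P => A0 B0 AV BV /and3P[_ /forall_inP A_deg /forall_inP B_deg].
exists A; split=> // v vG; have := f_ge v; have := deg3 v vG.
rewrite degree_deg_in // (deg_in_setD _ v AV).
have [vA|vA] := boolP (v \in A).
  by move: (degree_crossing_le AV vA) (A_deg v vA); clear; lia.
have vB : v \in vset G :\: A by rewrite inE vA.
move: (degree_crossing_le BV vB) (B_deg v vB); rewrite crossingC // setDDS //.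
by clear; lia.
Qed.

Lemma not_resiliently_hamiltonian (R : realType) (eps : R) (k : nat) G :
  (0 <= eps)%R -> (3 <= 2 * eps * k%:R)%R -> 2 < k -> min_degree_ge k G -> vset G != set0 ->
  ~ resiliently_hamiltonian (1 / 2 + eps)%R G.
Proof.
move=> e0 ek k2 degk V0 ham_G.
have [A [AV A0 B0 cross_deg]] := exists_balanced_crossing V0 (fun v vG => leq_trans k2 (degk v vG)).
apply: (cut_not_hamiltonian AV A0 B0); apply: ham_G => [|v vG]; first exact: crossing_sub.
have e2 : (0 <= 2 * eps)%R by rewrite mulr_ge0.
have : (k%:R <= (degree G v)%:R :> R)%R by rewrite ler_nat degk.
move=> /(ler_wpM2l e2); have := cross_deg v vG.
by rewrite -(ler_nat R) natrM natrD; lra.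
Qed.

Fact wf_induced G Z : wf_graph (Z, edges_in (eset G) Z).
Proof. by apply/forall_inP => e /=; rewrite inE => /andP[/edgeP/andP[_ ->] ->]. Qed.

Definition induced G Z : graph T := Graph (wf_induced G Z).

Lemma induced_sub G Z : Z \subset vset G -> subgraph (induced G Z) G.
Proof. by move=> ZV; apply/andP; split=> //; apply/subsetP=> e; rewrite inE => /andP[]. Qed.

Lemma kcore_eset k G K : is_kcore k G K -> eset K = edges_in (eset G) (vset K).
Proof.
move=> [/andP[KV KE] Kd Kmax].
have K_sub : subgraph K (induced G (vset K)).
  apply/andP; split=> //; apply/subsetP=> e eK; rewrite inE (subsetP KE) //=.
  by have /andP[] := edgeP eK.
rewrite -[edges_in _ _]/(eset (induced G (vset K))) (Kmax _ _ _ K_sub) //.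
  exact: induced_sub.
by move=> v vK; apply: leq_trans (Kd v vK) _; apply: subgraph_degree.
Qed.

Lemma kcore_deg_in k G K v : is_kcore k G K -> v \in vset K ->
  deg_in (edge_rel (eset G)) (vset K) v = degree K v.
Proof.
move=> K_core vK; rewrite degree_deg_in // !deg_in_edges ?eset_pairs // (kcore_eset K_core).
by apply: eq_card => e; rewrite !inE; case: (e \subset vset K); rewrite ?andbT ?andbF.
Qed.

Lemma kcore_dense k G K : is_kcore k G K ->
  k * #|vset K| <= 2 * #|edges_in (eset G) (vset K)|.
Proof.
move=> K_core; have [_ Kd _] := K_core; rewrite mulnC -sum_nat_const.
apply: leq_trans (sum_deg_in_le _ (eset_pairs G)); apply: leq_sum => v vK.
by rewrite (kcore_deg_in K_core) // Kd.
Qed.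

Lemma kcore_absorbs k G K Z : is_kcore k G K -> vset K \subset Z -> Z \subset vset G ->
  (forall v, v \in Z :\: vset K -> k <= degree (induced G Z) v) -> Z \subset vset K.
Proof.
move=> K_core KZ ZG Z_deg; have [_ Kd _] := K_core.
have /andP[//] : subgraph (induced G Z) K.
apply: (is_kcore_max K_core); [exact: induced_sub|move=> v vZ].
have [vK|vK] := boolP (v \in vset K); last by apply: Z_deg; rewrite inE vK.
apply: leq_trans (Kd v vK) _; apply: subgraph_degree; apply/andP; split=> //.
rewrite (kcore_eset K_core); apply/subsetP=> e; rewrite !inE => /andP[-> eK].
exact: subset_trans eK KZ.
Qed.

Section Peeling.
Local Open Scope ring_scope.
Variables (R : realType) (x : R) (k : nat) (G K : graph T).
Hypothesis K_core : is_kcore k G K.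
Hypothesis G_spanning : vset G = setT.
Hypothesis k_le_x : k%:R <= x.

Definition weak_vertices : {set T} := [set v | (v \in vset K) ==> ((degree K v)%:R < x)].

Let weak_step U : (#|U| < #|weak_vertices|)%N -> U \subset weak_vertices ->
  exists2 v, v \in weak_vertices :\: U &
    #|[set e in incident (eset G) v | [disjoint e & U]]|%:R < x.
Proof.
move=> U_small sU; apply/exists_inP; apply: contraT; rewrite negb_exists_in => /forall_inP deg_ge.
have deg_sub v Z : ~: U \subset Z ->
    (#|[set e in incident (eset G) v | [disjoint e & U]]| <= #|incident (edges_in (eset G) Z) v|)%N.
  move=> UZ; apply/subset_leq_card/subsetP => e; rewrite !inE disjoints_subset.
  by move=> /andP[/andP[-> ->] /subset_trans ->].
have UK : ~: U \subset vset K.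
  apply: subset_trans (kcore_absorbs (Z := ~: U :|: vset K) K_core _ _ _).
  - exact: subsetUl.
  - exact: subsetUr.
  - by rewrite G_spanning subsetT.
  move=> v; rewrite !inE => /andP[vK]; rewrite (negbTE vK) orbF => vU.
  apply: leq_trans (deg_sub v _ (subsetUl _ (vset K))); rewrite -(ler_nat R).
  by apply: le_trans k_le_x _; rewrite leNgt deg_ge // !inE vU (negbTE vK).
have /set0Pn[v vUU] : weak_vertices :\: U != set0.
  by rewrite -card_gt0 cardsDS // subn_gt0.
have := deg_ge v vUU; move: vUU; rewrite !inE => /andP[vU].
rewrite (subsetP UK) ?inE //= => weak_v /negP[]; apply: le_lt_trans weak_v.
by rewrite ler_nat /degree (kcore_eset K_core) deg_sub.
Qed.

(* Removing the vertices outside the core, and then those of low degree, in a suitable order,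
   each removed vertex sends few edges to the remaining ones. *)
Lemma kcore_peel j : (j <= #|weak_vertices|)%N -> exists U : {set T},
  [/\ #|U| = j, U \subset weak_vertices & #|edges_meeting (eset G) U|%:R <= j%:R * x].
Proof.
elim: j => [|j IH] j_le.
  exists set0; rewrite cards0 sub0set mul0r (_ : edges_meeting _ _ = set0) ?cards0 //.
  by apply/setP=> e; rewrite !inE disjoint_sym disjoints_subset sub0set andbF.
have [U [U_card sU U_few]] := IH (ltnW j_le).
have [|v /setDP[v_weak vU] v_few] := @weak_step U _ sU; first by rewrite U_card.
exists (v |: U); split; first by rewrite cardsU1 vU U_card.
  by rewrite subUset sub1set v_weak.
rewrite -natr1 mulrDl mul1r; apply: le_trans (lerD U_few (ltW v_few)).
rewrite -natrD ler_nat; apply: leq_trans (leq_card_setU _ _).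
apply/subset_leq_card/subsetP => e; rewrite !inE => /andP[-> /=].
case: (boolP [disjoint e & U]) => //= eU; apply: contraR; rewrite andbT => ve.
by rewrite disjoint_sym disjoints_subset subUset sub1set inE ve -disjoints_subset disjoint_sym.
Qed.

End Peeling.

End GraphDegrees.

(** * Choice of constants *)

Section Constants.
Local Open Scope ring_scope.
Local Open Scope classical_set_scope.
Variables (R : realType) (eps : R).
Hypothesis eps_gt0 : 0 < eps.
Hypothesis eps_le : eps <= 1/4.

(* [core_ratio * n] bounds the core from below and [endset_ratio * n] is the number of endpoints
   given by rotations. The errors are in units of [p * n ^ 2], like [guess_density], which bounds
   the size of the guessed subgraphs; each guessed edge costs a factor [guess_weight]. Guessed
   subgraphs are built by keeping edges with probability [keep_prob] and about
   [star_ratio * p * n] edges at each vertex. *)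
Definition core_ratio : R := 1/(20 * 40).
Definition endset_ratio : R := eps * core_ratio / 80.
Definition rotation_error : R := eps * core_ratio * endset_ratio / 100.
Definition guess_weight : R := rotation_error ^+ 2 / 64.
Definition guess_density : R := Num.min (rotation_error / 4) (guess_weight / ln guess_weight^-1).
Definition keep_prob : R := guess_density / 24.
Definition star_ratio : R := Num.min (guess_density / 16) (1/(20 * 20)).
Definition small_set_ratio : R := (star_ratio / 36) ^+ 2 / 36.
Definition cut_error : R := Num.min rotation_error (small_set_ratio * core_ratio / 24).

Lemma core_ratio_gt0 : 0 < core_ratio. Proof. by rewrite divr_gt0 // mulr_gt0. Qed.

Lemma endset_ratio_gt0 : 0 < endset_ratio.
Proof. by rewrite divr_gt0 // mulr_gt0 ?core_ratio_gt0. Qed.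

Lemma rotation_error_gt0 : 0 < rotation_error.
Proof. by rewrite divr_gt0 // !mulr_gt0 ?core_ratio_gt0 ?endset_ratio_gt0. Qed.

Lemma rotation_error_half : rotation_error <= 1/2.
Proof.
have eps_core : eps * core_ratio <= 1/4 * 1.
  by rewrite ler_pM ?(ltW eps_gt0) ?(ltW core_ratio_gt0) // /core_ratio; lra.
have : eps * core_ratio * endset_ratio <= 1/4 * 1 * 1.
  rewrite ler_pM ?mulr_ge0 ?(ltW eps_gt0) ?(ltW core_ratio_gt0) ?(ltW endset_ratio_gt0) //.
  by rewrite /endset_ratio; lra.
by rewrite /rotation_error; lra.
Qed.

Lemma guess_weight_gt0 : 0 < guess_weight.
Proof. by rewrite divr_gt0 // exprn_gt0 // rotation_error_gt0. Qed.

Lemma guess_weight_lt1 : guess_weight < 1.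
Proof.
have rotation_le1 : rotation_error <= 1 by apply: le_trans rotation_error_half _; lra.
have := exprn_ile1 2 (ltW rotation_error_gt0) rotation_le1.
by rewrite /guess_weight; lra.
Qed.

Lemma ln_guess_weight_gt0 : 0 < ln guess_weight^-1.
Proof. by rewrite ln_gt0 // invf_gt1 ?guess_weight_gt0 ?guess_weight_lt1. Qed.

Lemma guess_density_gt0 : 0 < guess_density.
Proof.
rewrite lt_min divr_gt0 ?rotation_error_gt0 //=.
by rewrite divr_gt0 ?guess_weight_gt0 ?ln_guess_weight_gt0.
Qed.

Lemma guess_density_le : guess_density <= rotation_error / 4.
Proof. by rewrite ge_min lexx. Qed.

Lemma guess_entropy_le :
  guess_weight + guess_density * ln guess_weight^-1 <= rotation_error ^+ 2 / 16.
Proof.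
have : guess_density * ln guess_weight^-1 <= guess_weight.
  by rewrite -ler_pdivlMr ?ln_guess_weight_gt0 // ge_min lexx orbT.
have := sqr_ge0 rotation_error; rewrite {2 3}/guess_weight; lra.
Qed.

Lemma keep_prob_gt0 : 0 < keep_prob.
Proof. by rewrite divr_gt0 // guess_density_gt0. Qed.

Lemma keep_prob_le1 : keep_prob <= 1.
Proof. by have := guess_density_le; have := rotation_error_half; rewrite /keep_prob; lra. Qed.

Lemma star_ratio_gt0 : 0 < star_ratio.
Proof. by rewrite lt_min divr_gt0 ?guess_density_gt0 //= divr_gt0 ?mulr_gt0. Qed.

Lemma star_ratio_le : star_ratio <= 1/(20 * 20).
Proof. by rewrite ge_min lexx orbT. Qed.

Lemma star_ratio_le_guess : star_ratio <= guess_density / 16.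
Proof. by rewrite ge_min lexx. Qed.

Lemma small_set_ratio_gt0 : 0 < small_set_ratio.
Proof. by rewrite divr_gt0 // exprn_gt0 // divr_gt0 // star_ratio_gt0. Qed.

Lemma cut_error_gt0 : 0 < cut_error.
Proof.
by rewrite lt_min rotation_error_gt0 divr_gt0 // mulr_gt0 ?small_set_ratio_gt0 ?core_ratio_gt0.
Qed.

Lemma cut_error_le_rotation : cut_error <= rotation_error.
Proof. by rewrite ge_min lexx. Qed.

Lemma cut_error_le_small : cut_error <= small_set_ratio * core_ratio / 24.
Proof. by rewrite ge_min lexx orbT. Qed.

Definition large_mean_degree (D : R) : Prop :=
  [/\ 12 <= D, 4 <= guess_density * D, 24 <= keep_prob * small_set_ratio * core_ratio * D,
      26 * 18 <= star_ratio * D & 4 * D ^+ 2 <= expR (D / 30)] /\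
  [/\ 20 * expR (- (keep_prob * (rotation_error * D / 2))) <= eps * core_ratio,
      6 * 16 <= rotation_error ^+ 2 * D & 6 * 16 <= cut_error ^+ 2 * D].

Lemma near_pinfty_mul_ge (a b : R) : 0 < a -> \forall D \near +oo, b <= a * D.
Proof.
by move=> a0; near=> D; rewrite mulrC -ler_pdivrMr.
Unshelve. all: by end_near. Qed.

Lemma near_pinfty_expRN_le (a b : R) : 0 < a -> 0 < b -> \forall D \near +oo, expR (- (a * D)) <= b.
Proof.
move=> a0 b0; near=> D; rewrite expRN -[leRHS]invrK lef_pV2 ?posrE ?expR_gt0 ?invr_gt0 //.
apply: le_trans (expR_ge1Dx _); rewrite -[leLHS]add0r lerD //.
by near: D; apply: near_pinfty_mul_ge.
Unshelve. all: by end_near. Qed.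

Lemma near_pinfty_sqr_le_expR (a b : R) : 0 < b -> \forall D \near +oo, a * D ^+ 2 <= expR (b * D).
Proof.
move=> b0; near=> D; have D0 : 0 <= D by [].
have bD0 : 0 <= b * D by rewrite mulr_ge0 // ltW.
apply: (@le_trans _ _ ((b * D) ^+ 3 / 3`!%:R)); last first.
  by apply: le_trans (expR_ge1Dxn 2 bD0); rewrite lerDr.
have -> : (b * D) ^+ 3 / 3`!%:R = b ^+ 3 / 6 * D * D ^+ 2 by rewrite (_ : 3`! = 6)%N //; ring.
rewrite ler_wpM2r ?sqr_ge0 //; near: D; apply: near_pinfty_mul_ge.
by rewrite divr_gt0 // exprn_gt0.
Unshelve. all: by end_near. Qed.

Lemma near_large_mean_degree : \forall D \near +oo, large_mean_degree D.
Proof.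
have gt0 := (core_ratio_gt0, rotation_error_gt0, guess_density_gt0, keep_prob_gt0,
  small_set_ratio_gt0, star_ratio_gt0, cut_error_gt0).
near=> D; split; split.
- by [].
- by near: D; apply: near_pinfty_mul_ge; rewrite gt0.
- by near: D; apply: near_pinfty_mul_ge; rewrite !mulr_gt0 ?gt0.
- by near: D; apply: near_pinfty_mul_ge; rewrite gt0.
- by rewrite [D / 30]mulrC; near: D; apply: near_pinfty_sqr_le_expR.
- have -> : keep_prob * (rotation_error * D / 2) = keep_prob * rotation_error / 2 * D by ring.
  rewrite -ler_pdivlMl //; near: D; apply: near_pinfty_expRN_le.
    by rewrite divr_gt0 // mulr_gt0 ?gt0.
  by rewrite mulr_gt0 ?invr_gt0 // mulr_gt0 ?gt0.
- by near: D; apply: near_pinfty_mul_ge; rewrite exprn_gt0 ?gt0.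
- by near: D; apply: near_pinfty_mul_ge; rewrite exprn_gt0 ?gt0.
Unshelve. all: by end_near. Qed.

Definition large_core_degree (k : nat) : Prop :=
  [/\ 52 <= k%:R :> R, 26 * 60 <= star_ratio * k%:R &
      forall D, k%:R / 6 <= D -> large_mean_degree D].

Definition large_order (n : nat) : Prop :=
  2 <= endset_ratio * n%:R /\ 10 <= eps * (core_ratio * n%:R).

Lemma large_order_gt0 n : large_order n -> 0 < n%:R :> R.
Proof.
by case=> n_endset _; rewrite -(pmulr_rgt0 _ endset_ratio_gt0); apply: lt_le_trans n_endset.
Qed.

Lemma near_infty_mul_ge (a b : R) : 0 < a -> \forall n \near \oo, b <= a * n%:R.
Proof.
move=> a0; near=> n; rewrite mulrC -ler_pdivrMr //; near: n; exact: nbhs_infty_ger.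
Unshelve. all: by end_near. Qed.

Lemma near_large_core_degree : \forall k \near \oo, large_core_degree k.
Proof.
have [D0 [_ large_D]] := near_large_mean_degree.
near=> k; split; first by near: k; apply: nbhs_infty_ger.
- by near: k; apply: near_infty_mul_ge; apply: star_ratio_gt0.
move=> D kD; apply: large_D.
apply: lt_le_trans kD; rewrite ltr_pdivlMr // (@lt_le_trans _ _ (D0 * 6 + 1)) ?ltrDl //.
by near: k; apply: nbhs_infty_ger.
Unshelve. all: by end_near. Qed.

Lemma near_large_order : \forall n \near \oo, large_order n.
Proof.
near=> n; split; first by near: n; apply: near_infty_mul_ge; apply: endset_ratio_gt0.
rewrite mulrA; near: n; apply: near_infty_mul_ge.
by rewrite mulr_gt0 // core_ratio_gt0.
Unshelve. all: by end_near. Qed.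

End Constants.

(** * The bad event *)

Section BadEvent.
Local Open Scope ring_scope.
Variables (R : realType) (eps : R) (T : finType) (k : nat) (p : R).
Implicit Types (E F S : {set {set T}}) (G H K : graph T) (v : T).
Notation n := #|T|.
Notation B := (p * n%:R ^+ 2 : R).
Notation D := (p * n%:R : R).

Definition endset_size : nat := Num.truncn (endset_ratio eps * n%:R).
Definition small_set_size : nat := Num.truncn (small_set_ratio eps * n%:R).
Definition weak_set_size : nat := (Num.truncn (n%:R / D ^+ 2)).+1.

Definition not_pseudorandom E : bool :=
  [|| ~~ well_distributed p (cut_error eps) E,
      has_deficient_set p (@rotation_pairs T) (guess_density eps * B) (rotation_error eps) E,
      has_deficient_set p (@closing_pairs T) (guess_density eps * B) (rotation_error eps) E,
      has_dense_subset (star_ratio eps * D / 18) (fun s => s <= 9 * small_set_size)%N E |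
      has_dense_subset (star_ratio eps * k%:R / 60) (fun s => s%:R * D ^+ 2 <= 5 * n%:R) E].

Definition bad_core E : bool :=
  if D < 100 * k%:R then has_dense_subset (k%:R / 2 : R) (fun s => 20 * (40 * s) <= n)%N E
  else has_few_edges_at weak_set_size (weak_set_size%:R * D / 100) E.

(* If [D < k / 6], being good forces the k-core to be empty. *)
Definition bad E : bool :=
  if D < k%:R / 6 then has_dense_subset (k%:R / 2 : R) predT E
  else not_pseudorandom E || bad_core E.

Lemma kcore_size G K (P : pred nat) : is_kcore k G K ->
  ~~ has_dense_subset (k%:R / 2 : R) P (eset G) -> vset K != set0 -> ~~ P #|vset K|.
Proof.
move=> K_core; rewrite negb_exists => /forallP/(_ (vset K)) + K0; rewrite K0 /=.
apply: contraNN => ->; have := kcore_dense K_core; rewrite -(ler_nat R) !natrM.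
by move: #|edges_in _ _|%:R => x; lra.
Qed.

Lemma sparse_core_structure G K : is_kcore k G K -> vset K != set0 -> D < 100 * k%:R ->
  ~~ bad_core (eset G) ->
  few_low_degrees p (eset G) (vset K) /\ core_ratio R * n%:R <= #|vset K|%:R.
Proof.
move=> K_core K0 D_lt; rewrite /bad_core D_lt => not_dense; have [_ Kd _] := K_core; split.
  rewrite /few_low_degrees (_ : [set _ in _ | _] = set0) ?cards0 ?mul0r //.
  apply/setP=> v; rewrite !inE; apply/negbTE/negP => /andP[vK].
  by rewrite (kcore_deg_in K_core vK); have := Kd v vK; rewrite -(ler_nat R); move: D_lt; lra.
have := kcore_size K_core not_dense K0; rewrite -ltnNge => /ltnW; rewrite -(ler_nat R) !natrM.
by rewrite /core_ratio; lra.
Qed.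

Lemma dense_core_structure G K : is_kcore k G K -> vset G = setT -> 12 <= D ->
  100 * k%:R <= D -> ~~ bad_core (eset G) ->
  few_low_degrees p (eset G) (vset K) /\ core_ratio R * n%:R <= #|vset K|%:R.
Proof.
move=> K_core G_spanning D_ge12 kD; rewrite /bad_core ltNge kD /= => not_few.
have sqr_D_ge : 12 * 12 <= D ^+ 2 by rewrite expr2; apply: ler_pM.
have D2_gt0 : 0 < D ^+ 2 by lra.
pose U := weak_vertices (D / 100) K.
have U_lt : (#|U| < weak_set_size)%N.
  rewrite ltnNge; apply: contraNN not_few => U_large.
  have kx : k%:R <= D / 100 by move: kD; lra.
  have [U' [U'_card _ U'_few]] := kcore_peel K_core G_spanning kx U_large.
  by apply/existsP; exists U'; rewrite U'_card eqxx -mulrA.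
have U_few : #|U|%:R * D ^+ 2 <= n%:R.
  rewrite -ler_pdivlMr //; have /andP[+ _] := truncn_itv (divr_ge0 (ler0n R n) (ltW D2_gt0)).
  by apply: le_trans; rewrite ler_nat -ltnS.
split.
  apply: le_trans U_few; rewrite ler_wpM2r ?(ltW D2_gt0) // ler_nat subset_leq_card //.
  by apply/subsetP=> v; rewrite !inE => /andP[vK]; rewrite vK (kcore_deg_in K_core).
have : (n <= #|U| + #|vset K|)%N.
  rewrite -(cardsC (vset K)) addnC leq_add2r subset_leq_card //.
  by apply/subsetP=> v; rewrite !inE => /negbTE ->.
rewrite -(ler_nat R) natrD; have := ler_wpM2l (ler0n R #|U|) sqr_D_ge; move: U_few.
by rewrite /core_ratio; have := ler0n R n; move: (D ^+ 2) => *; lra.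
Qed.

Lemma remaining_bounded_deletion (alpha : R) G K H : is_kcore k G K -> subgraph H K ->
  (forall v, v \in vset K -> (degree H v)%:R <= alpha * (degree K v)%:R) ->
  bounded_deletion alpha (eset G) (eset K :\: eset H) (vset K).
Proof.
move=> K_core HK H_deg; have KE := kcore_eset K_core; split=> [|e|v vK].
- by apply/subsetP=> e; rewrite KE !inE => /andP[_ /andP[]].
- by rewrite KE !inE => /andP[_ /andP[]].
rewrite (kcore_deg_in K_core vK); apply: le_trans (H_deg v vK); rewrite ler_nat.
rewrite deg_in_edges // ?(subset_trans (subsetDl _ _)) ?eset_pairs //.
apply/subset_leq_card/subsetP=> e; rewrite KE !inE => /andP[/andP[+ eK] ve].
by rewrite eK ve !andbT negb_and negbK => /andP[/orP[|/negP]].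
Qed.

Hypothesis eps_gt0 : 0 < eps.
Hypothesis eps_le : eps <= 1/4.
Hypothesis p_gt0 : 0 < p.
Hypothesis D_large : large_mean_degree eps D.
Hypothesis n_endset : 2 <= endset_ratio eps * n%:R.
Hypothesis n_core : 10 <= eps * (core_ratio R * n%:R).

Let n_gt0 : 0 < n%:R :> R.
Proof. exact: (large_order_gt0 eps_gt0 (conj n_endset n_core)). Qed.

Let D_gt0 : 0 < D. Proof. exact: mulr_gt0. Qed.
Let B_gt0 : 0 < B. Proof. by rewrite mulr_gt0 // exprn_gt0. Qed.

Section Deletion.
Variables (E F : {set {set T}}) (K : {set T}).
Hypothesis sE : E \subset pairs T.
Hypothesis delEF : bounded_deletion (1/2 - eps) E F K.
Hypothesis E_good : ~~ not_pseudorandom E.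
Hypothesis kD : k%:R / 6 <= D.
Hypothesis k_min : forall v, v \in K -> (k <= deg_in (edge_rel E) K v)%N.
Hypothesis few_low : few_low_degrees p E K.
Hypothesis K_size : core_ratio R * n%:R <= #|K|%:R.

Let endset_itv : endset_size%:R <= endset_ratio eps * n%:R < endset_size.+1%:R.
Proof. by apply: truncn_itv; rewrite mulr_ge0 // ltW // endset_ratio_gt0. Qed.

Lemma exists_small_expander : exists2 S : {set {set T}}, S \subset F &
  #|S|%:R <= guess_density eps * B / 8 /\
  expands (edge_rel S) K (fun m => 0 < m <= small_set_size)%N.
Proof.
have [[_ _ _ star_D _] _] := D_large; have star0 := star_ratio_gt0 eps_gt0 eps_le.
have star_le := star_ratio_le eps; have star_guess := star_ratio_le_guess eps.
have := E_good; rewrite !negb_or => /and5P[_ _ _ not_dense not_dense_low].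
pose l := (Num.truncn (star_ratio eps * D)).+1.
have /andP[l_le l_gt] := truncn_itv (mulr_ge0 (ltW star0) (ltW D_gt0)).
have l2 : l%:R <= 2 * (star_ratio eps * D).
  by rewrite /l -natr1; move: l_le star_D; move: (star_ratio eps * D) => x; lra.
have star_D_le := ler_wpM2r (ltW D_gt0) star_le.
have [S SF [S_card S_exp]] : exists2 S : {set {set T}}, S \subset F & (#|S| <= n * l)%N /\
    expands (edge_rel S) K (fun m => 0 < m <= small_set_size)%N.
  apply: (exists_small_set_expander p_gt0 (alpha := 1/2 - eps) _ sE delEF
    (d := star_ratio eps) (k := k)) => //.
  - by move: eps_gt0; lra.
  - by rewrite star0 /=; move: star_le; lra.
  - by rewrite (ltW l_gt) /=; move: l2 star_D_le; move: (l%:R) D => *; lra.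
  - by move: kD; lra.
exists S => //; split=> //; move: S_card; rewrite -(ler_nat R) natrM => /le_trans; apply.
have := ler_wpM2l (ltW n_gt0) l2; have := ler_wpM2r (ltW B_gt0) star_guess; rewrite expr2.
by move: (l%:R) => x; lra.
Qed.

Lemma exists_large_expander : exists2 S : {set {set T}}, S \subset F &
  #|S|%:R <= guess_density eps * B / 8 /\
  expands (edge_rel S) K (fun m => (small_set_ratio eps * n%:R <= m%:R) && (m <= endset_size)%N).
Proof.
have [[_ _ keep_D _ _] _] := D_large; have := E_good; rewrite !negb_or negbK => /andP[E_distr _].
have [S SF [S_card S_exp]] : exists2 S : {set {set T}}, S \subset F &
    #|S|%:R <= 3 * keep_prob eps * B /\
    expands (edge_rel S) K (fun m => (small_set_ratio eps * n%:R <= m%:R) && (m <= endset_size)%N).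
  apply: (exists_large_set_expander p_gt0 (alpha := 1/2 - eps) _ _ sE delEF E_distr
    (g := core_ratio R)) => //.
  - by move: eps_le; lra.
  - by move: eps_gt0; lra.
  - exact: keep_prob_gt0.
  - exact: keep_prob_le1.
  - exact: small_set_ratio_gt0.
  - exact: core_ratio_gt0.
  - by rewrite cut_error_gt0 ?cut_error_le_small.
  - exact: le_trans (cut_error_le_rotation eps) (rotation_error_half eps_gt0 eps_le).
  - by rewrite -(ltr_nat R).
  - rewrite -(ler_nat R) natrM; apply: le_trans K_size; have /andP[a_le _] := endset_itv.
    have core_n := mulr_gt0 (core_ratio_gt0 R) n_gt0.
    move: core_n (ler_wpM2r (ltW core_n) eps_le); move: endset_size%:R a_le; rewrite /endset_ratio.
    by move: (core_ratio R) => *; lra.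
exists S => //; split=> //; apply: le_trans S_card _.
by rewrite /keep_prob; move: (guess_density eps) (n%:R ^+ 2) => *; lra.
Qed.

Lemma good_deletion_has_cycle :
  exists c : seq T, [/\ (2 < size c)%N, ucycle (edge_rel F) c & c =i K].
Proof.
have [[_ guess_D _ _ _] [miss_D _ _]] := D_large.
have := E_good; rewrite !negb_or negbK => /and5P[E_distr E_rotations E_closing _ _].
have [S1 S1F [S1_card S1_exp]] := exists_small_expander.
have [S2 S2F [S2_card S2_exp]] := exists_large_expander.
have /andP[a_le a_gt] := endset_itv; have eps_K := ler_wpM2l (ltW eps_gt0) K_size.
have a_le2 : endset_size.+1%:R <= 2 * (endset_ratio eps * n%:R).
  by rewrite -natr1; move: a_le n_endset; move: (endset_ratio eps * n%:R) endset_size%:R => *; lra.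
apply: (resilient_cycle (eta := rotation_error eps) (eta0 := cut_error eps)
  (delta := guess_density eps) (q := keep_prob eps) (a := endset_size) (S0 := S1 :|: S2)
  p_gt0 eps_gt0 eps_le _ _ _ _ _ _ _ _ _ _ sE E_distr E_rotations E_closing delEF) => //.
- by rewrite ltW // cut_error_gt0.
- exact: cut_error_le_rotation.
- exact: rotation_error_gt0.
- exact: le_trans (cut_error_le_rotation eps) (rotation_error_half eps_gt0 eps_le).
- exact: keep_prob_gt0.
- exact: keep_prob_le1.
- have : endset_ratio eps * n%:R * (core_ratio R * n%:R) <= endset_size.+1%:R * #|K|%:R.
    by rewrite ler_pM ?(ltW a_gt) // mulr_ge0 // ltW // ?endset_ratio_gt0 ?core_ratio_gt0.
  move=> /(ler_wpM2l (ltW eps_gt0)); rewrite /rotation_error expr2.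
  by move: (endset_ratio eps) (core_ratio R) #|K|%:R endset_size.+1%:R => *; lra.
- apply: le_trans eps_K; move: endset_size.+1%:R a_le2; rewrite /endset_ratio.
  by move: (core_ratio R) => *; lra.
- exact: le_trans n_core eps_K.
- apply: le_trans eps_K; have := ler_wpM2r (ltW n_gt0) miss_D.
  by move: (expR _) (core_ratio R) => *; lra.
- by rewrite subUset S1F.
- move=> A AK /andP[A0 Aa]; have [A_small|A_large] := leqP #|A| small_set_size.
    apply: (expands_subrel _ S1_exp AK); last by rewrite A0.
    exact/edge_rel_sub/subsetUl.
  apply: (expands_subrel _ S2_exp AK); first exact/edge_rel_sub/subsetUr.
  rewrite Aa andbT; have small0 := mulr_ge0 (ltW (small_set_ratio_gt0 eps_gt0 eps_le)) (ltW n_gt0).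
  by have /andP[_ /ltW/le_trans] := truncn_itv small0; apply; rewrite ler_nat.
- have : #|S1 :|: S2|%:R <= #|S1|%:R + #|S2|%:R :> R by rewrite -natrD ler_nat leq_card_setU.
  have := ler_wpM2r (ltW n_gt0) guess_D.
  have := mulr_gt0 (guess_density_gt0 eps_gt0 eps_le) B_gt0; rewrite /keep_prob expr2.
  move: S1_card S2_card; rewrite expr2.
  by move: #|S1|%:R #|S2|%:R #|_ :|: _|%:R (guess_density eps) => *; lra.
Qed.

End Deletion.

Theorem supercritical_kcore_resilient G K : vset G = setT -> ~~ bad (eset G) -> k%:R / 6 <= D ->
  is_kcore k G K -> vset K != set0 -> resiliently_hamiltonian (1 / 2 - eps) K.
Proof.
move=> G_spanning; rewrite /bad ltNge => + kD; rewrite kD negb_or => /andP[pseudo core_good].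
move=> K_core K0 H HK H_deg; have [_ Kd _] := K_core; have [[D_ge12 _ _ _ _] _] := D_large.
have [few_low K_size] :
    few_low_degrees p (eset G) (vset K) /\ core_ratio R * n%:R <= #|vset K|%:R.
  have [D_lt|kD100] := ltP D (100 * k%:R); first exact: sparse_core_structure core_good.
  exact: dense_core_structure core_good.
apply: good_deletion_has_cycle pseudo kD _ few_low K_size.
- exact: eset_pairs.
- exact: remaining_bounded_deletion.
- by move=> v vK; rewrite (kcore_deg_in K_core) // Kd.
Qed.

End BadEvent.

Theorem kcore_resilient (R : realType) (eps p : R) (T : finType) (k : nat) (G K : graph T) :
  (0 < eps)%R -> (eps <= 1/4)%R -> (0 <= p)%R -> large_core_degree eps k ->
  large_order eps #|T| -> vset G = setT -> ~~ bad eps k p (eset G) ->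
  is_kcore k G K -> vset K != set0 -> resiliently_hamiltonian (1 / 2 - eps)%R K.
Proof.
move=> eps_gt0 eps_le p_ge0 [k_large _ D_large] [n_endset n_core] G_spanning G_good K_core K0.
have [D_lt|kD] := ltP (p * #|T|%:R)%R (k%:R / 6)%R.
  by move: G_good; rewrite /bad D_lt => /(kcore_size K_core)/(_ K0).
have p_gt0 : (0 < p)%R.
  rewrite lt_neqAle p_ge0 andbT; apply: contraTneq kD => <-; rewrite mul0r -ltNge.
  by move: k_large; lra.
exact: (supercritical_kcore_resilient eps_gt0 eps_le p_gt0 (D_large _ kD) n_endset n_core
  G_spanning G_good kD K_core K0).
Qed.

(** * Probability of the bad event *)

Section BadEventProbability.
Local Open Scope ring_scope.
Variables (R : realType) (eps : R) (T : finType) (k : nat) (p : R).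
Notation n := #|T|.
Notation B := (p * n%:R ^+ 2 : R).
Notation D := (p * n%:R : R).
Notation Pr := (Pr p (pairs T)).
Notation small_size := (small_set_size eps T).
Notation weak_size := (weak_set_size T p).
Hypothesis eps_gt0 : 0 < eps.
Hypothesis eps_le : eps <= 1/4.
Hypothesis p01 : 0 <= p <= 1.
Hypothesis k_large : large_core_degree eps k.
Hypothesis n_large : large_order eps n.

Let p_ge0 : 0 <= p. Proof. by case/andP: p01. Qed.
Let D_ge0 : 0 <= D. Proof. by rewrite mulr_ge0. Qed.
Let k_ge52 : 52 <= k%:R :> R. Proof. by case: k_large. Qed.
Let star_gt0 : 0 < star_ratio eps. Proof. exact: star_ratio_gt0. Qed.
Let rotation_gt0 : 0 < rotation_error eps. Proof. exact: rotation_error_gt0. Qed.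
Let cut_gt0 : 0 < cut_error eps. Proof. exact: cut_error_gt0. Qed.

Let n_gt0 : 0 < n%:R :> R. Proof. exact: (large_order_gt0 eps_gt0 n_large). Qed.

Let rotation_le1 : rotation_error eps <= 1.
Proof. by have := rotation_error_half eps_gt0 eps_le; lra. Qed.

Let cut_le1 : cut_error eps <= 1.
Proof. exact: le_trans (cut_error_le_rotation eps) rotation_le1. Qed.

Lemma family_union_le (J : finType) (x : R) : (#|J| <= 2 ^ (5 * n))%N -> x <= - 6 ->
  #|J|%:R * expR (x * n%:R) <= expR (- n%:R).
Proof.
move=> J_small x_le.
have J_le : #|J|%:R <= expR (5 * n%:R) :> R.
  apply: (@le_trans _ _ ((2 ^ (5 * n))%:R)); first by rewrite ler_nat.
  by rewrite natrX -natrM exprn2_le_expR.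
apply: le_trans (ler_wpM2r (expR_ge0 _) J_le) _; rewrite -expRD ler_expR.
by have := ler_wpM2r (ltW n_gt0) x_le; lra.
Qed.

Lemma dense_exponent_le (s : nat) (A h : R) : (2 * D / h) ^+ 2 * (s%:R / n%:R) <= A ->
  (2 * s%:R * p / h) ^+ 2 <= A * s%:R / n%:R.
Proof.
move=> A_ge; have -> : 2 * s%:R * p / h = 2 * D / h * (s%:R / n%:R).
  by rewrite [RHS]mulrAC; congr (_ / _); field; rewrite gt_eqF.
rewrite exprMn [X in _ * X]expr2 mulrA -[leRHS]mulrA.
by rewrite ler_wpM2r // divr_ge0 // ltW.
Qed.

Lemma order_ratio_le1 (s : nat) : (s <= n)%N -> 0 <= (s%:R / n%:R : R) <= 1.
Proof. by move=> sn; rewrite divr_ge0 ?(ltW n_gt0) //= ler_pdivrMr // mul1r ler_nat. Qed.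

Lemma Pr_dense_subcritical : D < k%:R / 6 ->
  Pr (has_dense_subset (k%:R / 2 : R) predT) <= n%:R * (1/2 / n%:R) ^+ 6.
Proof.
move=> D_lt; have k_gt0 : 0 < k%:R :> R by move: k_ge52; lra.
apply: (Pr_has_dense_subset p01 (b := 1/2)) => //.
- by move: k_ge52; lra.
- by rewrite !exprS expr0; lra.
move=> s /andP[_ sn] _; have /andP[r_ge0 r_le1] := order_ratio_le1 sn; apply/andP; split.
  apply: dense_exponent_le; have slope_ge0 : 0 <= 2 * D / (k%:R / 2) by rewrite !divr_ge0 ?mulr_ge0.
  have slope_le : 2 * D / (k%:R / 2) <= 2/3 by rewrite ler_pdivrMr ?divr_gt0 //; lra.
  rewrite expr2; have := ler_pM (mulr_ge0 slope_ge0 slope_ge0) r_ge0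
    (ler_pM slope_ge0 slope_ge0 slope_le slope_le) r_le1; lra.
by rewrite -mulrA; move: (s%:R / n%:R) r_le1 => r; lra.
Qed.

Lemma Pr_dense_core : D < 100 * k%:R ->
  Pr (has_dense_subset (k%:R / 2 : R) (fun s => 20 * (40 * s) <= n)%N) <=
  n%:R * (2 * (10 * 10) / n%:R) ^+ 6.
Proof.
move=> D_lt; have k_gt0 : 0 < k%:R :> R by move: k_ge52; lra.
apply: (Pr_has_dense_subset p01 (b := 1/4)) => //.
- by move: k_ge52; lra.
- lra.
- by rewrite !exprS expr0; lra.
move=> s /andP[_ sn] s_small; have /andP[r_ge0 _] := order_ratio_le1 sn.
have r_small : 20 * (40 * (s%:R / n%:R)) <= 1 :> R.
  by rewrite !mulrA ler_pdivrMr // mul1r -!mulrA -!natrM ler_nat.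
apply/andP; split; last by rewrite -mulrA; move: (s%:R / n%:R) r_small => r; lra.
apply: dense_exponent_le; have slope_ge0 : 0 <= 2 * D / (k%:R / 2) by rewrite !divr_ge0 ?mulr_ge0.
have slope_le : 2 * D / (k%:R / 2) <= 4 * 100 by rewrite ler_pdivrMr ?divr_gt0 //; lra.
have := ler_wpM2r r_ge0 (ler_pM slope_ge0 slope_ge0 slope_le slope_le); rewrite expr2.
by move: (_ / n%:R) r_small (2 * D / _) => *; lra.
Qed.

Section LargeMeanDegree.
Hypothesis D_large : large_mean_degree eps D.

Let D_ge12 : 12 <= D. Proof. by case: D_large => -[]. Qed.
Let D_gt0 : 0 < D. Proof. exact: lt_le_trans D_ge12. Qed.
Let sqr_D_ge : 12 * 12 <= D ^+ 2. Proof. by rewrite expr2; apply: ler_pM. Qed.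

Lemma Pr_not_well_distributed :
  Pr (fun E => ~~ well_distributed p (cut_error eps) E) <= 3 * expR (- n%:R).
Proof.
have [_ [_ _ cut_D]] := D_large; have cut01 : 0 < cut_error eps <= 1 by rewrite cut_gt0.
have pairs_small : (#|{: {set T} * {set T}}| <= 2 ^ (5 * n))%N.
  by rewrite card_prod card_set_type -expnD leq_exp2l // addnn -mul2n leq_mul2r orbT.
have sets_small : (#|{: {set T}}| <= 2 ^ (5 * n))%N.
  by rewrite card_set_type leq_exp2l // leq_pmull.
have BE x : B * x = D * x * n%:R by rewrite expr2; ring.
have excessive (J : finType) (Q : J -> {set {set T}}) : (forall i, Q i \subset pairs T) ->
    (#|J| <= 2 ^ (5 * n))%N -> Pr (has_excessive_set p Q (cut_error eps)) <= expR (- n%:R).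
  move=> sQ J_small; apply: le_trans (Pr_has_excessive_set p01 sQ cut01) _.
  rewrite -mulrA -mulrN BE; apply: family_union_le => //.
  by rewrite mulrN mulrA; move: cut_D; rewrite [_ * D]mulrC; move: (D * _) => x; lra.
have deficient : Pr (has_deficient_set p (fun=> @cut_pairs T) 0 (cut_error eps)) <= expR (- n%:R).
  rewrite -[0](mul0r B); apply: le_trans (Pr_has_deficient_set (z := cut_error eps ^+ 2 / 16)
    p01 _ _ cut01 _) _.
  - by move=> _ i; apply: stars_sub_pairs.
  - have : cut_error eps ^+ 2 <= 1 by rewrite exprn_ile1 // ltW.
    by rewrite divr_gt0 ?exprn_gt0 //=; lra.
  - by rewrite lexx divr_ge0 // ltW.
  rewrite mul0r addr0 BE; apply: family_union_le => //.
  by move: cut_D; rewrite mulrBr [_ * D]mulrC !mulrA; move: (D * _) => x; lra.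
have -> : 3 * expR (- n%:R) = expR (- n%:R) + (expR (- n%:R) + expR (- n%:R)) :> R by ring.
apply: le_trans (Pr_le (B := fun E => has_excessive_set p (@cut_pairs T) (cut_error eps) E ||
    (has_excessive_set p (@edges_in T (pairs T)) (cut_error eps) E ||
     has_deficient_set p (fun=> @cut_pairs T) 0 (cut_error eps) E)) p01 _) _.
  by move=> E _; rewrite /well_distributed !negb_and !negbK.
apply: le_trans (Pr_or _ p01 _ _) (lerD _ _).
  by apply: excessive => // i; apply: stars_sub_pairs.
apply: le_trans (Pr_or _ p01 _ _) (lerD _ deficient).
by apply: excessive => // X; apply: edges_in_pairs.
Qed.

Lemma Pr_guess_deficient (J : finType) (Q : {set {set T}} -> J -> {set {set T}}) :
  (forall S i, Q S i \subset pairs T) -> (#|J| <= 2 ^ (5 * n))%N ->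
  Pr (has_deficient_set p Q (guess_density eps * B) (rotation_error eps)) <= expR (- n%:R).
Proof.
move=> sQ J_small; have [_ [_ rotation_D _]] := D_large.
apply: le_trans (Pr_has_deficient_set (z := guess_weight eps) p01 sQ _ _ _) _.
- by rewrite guess_weight_gt0 ?(ltW (guess_weight_lt1 _ _)).
- by rewrite rotation_gt0.
- by rewrite (ltW (guess_density_gt0 _ _)) ?guess_density_le.
rewrite (_ : B * _ = D * (guess_weight eps + guess_density eps * ln (guess_weight eps)^-1 -
  rotation_error eps ^+ 2 / 8) * n%:R); last by rewrite expr2; ring.
apply: family_union_le => //; have := ler_wpM2l D_ge0 (guess_entropy_le eps_gt0 eps_le).
by move: rotation_D; move: (guess_density eps * _) (_ ^+ 2) => *; lra.
Qed.

Lemma Pr_rotations_deficient :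
  Pr (has_deficient_set p (@rotation_pairs T) (guess_density eps * B) (rotation_error eps)) <=
  expR (- n%:R).
Proof.
apply: Pr_guess_deficient => [S [[[[s A] Y] V] K]|]; first exact: stars_sub_pairs.
rewrite !card_prod !card_set_type.
apply: leq_trans (_ : 2 ^ n * 2 ^ n * 2 ^ n * 2 ^ n * 2 ^ n <= _)%N.
  by rewrite !leq_mul2r (ltnW (ltn_expl _ _)) ?orbT.
by rewrite -!expnD leq_exp2l //; clear; lia.
Qed.

Lemma Pr_closing_deficient :
  Pr (has_deficient_set p (@closing_pairs T) (guess_density eps * B) (rotation_error eps)) <=
  expR (- n%:R).
Proof.
apply: Pr_guess_deficient => [S i|]; first exact: stars_sub_pairs.
by rewrite card_prod card_set_type -expnD leq_exp2l // addnn -mul2n leq_mul2r orbT.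
Qed.

Lemma Pr_dense_small :
  Pr (has_dense_subset (star_ratio eps * D / 18) (fun s => s <= 9 * small_size)%N) <=
  n%:R * (36 / star_ratio eps / n%:R) ^+ 6.
Proof.
have [[_ _ _ star_D _] _] := D_large; have star_le := star_ratio_le eps.
apply: (Pr_has_dense_subset p01 (b := star_ratio eps / (2 * (8 * 9)))).
- by move: star_D; lra.
- by rewrite divr_gt0.
- by move: star_le; lra.
- rewrite [_ ^+ 6]exprS; have -> : 4 * (36 / star_ratio eps) *
      (star_ratio eps / (2 * (8 * 9)) * (star_ratio eps / (2 * (8 * 9))) ^+ 5) =
      (star_ratio eps / (2 * (8 * 9))) ^+ 5 by field; rewrite gt_eqF.
  by rewrite exprn_ile1 // ?divr_ge0 ?(ltW star_gt0) ?mulr_ge0 //; move: star_le; lra.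
move=> s /andP[_ sn] s_small; have /andP[r_ge0 _] := order_ratio_le1 sn.
have r_small : s%:R / n%:R <= 9 * small_set_ratio eps :> R.
  rewrite ler_pdivrMr //.
  have small_ge0 := mulr_ge0 (ltW (small_set_ratio_gt0 eps_gt0 eps_le)) (ltW n_gt0).
  have /andP[size_le _] := truncn_itv small_ge0.
  have : s%:R <= 9 * small_size%:R :> R by rewrite -natrM ler_nat.
  by rewrite /small_set_size; lra.
have Ar_le : 36 / star_ratio eps * (s%:R / n%:R) <= star_ratio eps / (2 * (8 * 9)).
  rewrite mulrAC ler_pdivrMr //; move: r_small; rewrite /small_set_ratio expr_div_n !expr2; lra.
apply/andP; split; last by rewrite -mulrA.
apply: dense_exponent_le; have -> : 2 * D / (star_ratio eps * D / 18) = 36 / star_ratio eps.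
  by move: D D_gt0 => d d_gt0; field; rewrite !gt_eqF.
rewrite expr2 -mulrA ler_piMr ?divr_ge0 ?(ltW star_gt0) //; apply: le_trans Ar_le _.
by move: star_le; lra.
Qed.

Lemma Pr_dense_tiny : k%:R / 6 <= D ->
  Pr (has_dense_subset (star_ratio eps * k%:R / 60) (fun s => s%:R * D ^+ 2 <= 5 * n%:R)) <=
  n%:R * (1 / n%:R) ^+ 6.
Proof.
move=> kD; have [_ star_k _] := k_large; set h := star_ratio eps * k%:R / 60.
have h_ge26 : 26 <= h by rewrite /h; lra.
apply: (Pr_has_dense_subset p01 (b := 1/2)) => //; first by rewrite !exprS expr0; lra.
move=> s /andP[_ sn]; rewrite -ler_pdivlMr ?exprn_gt0 // => s_small.
have /andP[r_ge0 _] := order_ratio_le1 sn.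
have rD2_le : s%:R / n%:R * D ^+ 2 <= 5 by rewrite mulrAC ler_pdivrMr // -ler_pdivlMr ?exprn_gt0.
have := ler_wpM2l r_ge0 sqr_D_ge => /le_trans/(_ rD2_le) r_le.
apply/andP; split; last first.
  by rewrite -mulrA; move: (s%:R / n%:R) r_le => *; lra.
apply: dense_exponent_le.
have h2_ge : 26 * 26 <= h ^+ 2 by rewrite expr2 ler_pM.
rewrite expr_div_n exprMn mulrAC ler_pdivrMr ?(lt_le_trans _ h2_ge) // mul1r.
by move: rD2_le h2_ge; rewrite [_ * (s%:R / n%:R)]mulrC; move: (s%:R / n%:R) (D ^+ 2) => *; lra.
Qed.

Lemma Pr_few_edges :
  Pr (has_few_edges_at weak_size (weak_size%:R * D / 100)) <= expR (- (Num.sqrt n%:R / 30)).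
Proof.
have [[_ _ _ _ exp_D] _] := D_large; have D2_gt0 : 0 < D ^+ 2 by rewrite exprn_gt0.
have /andP[weak_le weak_gt] := truncn_itv (divr_ge0 (ler0n R n) (ltW D2_gt0)).
have n_le : n%:R <= weak_size%:R * D ^+ 2 by rewrite -ler_pdivrMr // ltW.
have weak_ge0 : 0 <= weak_size%:R * D by rewrite mulr_ge0.
have sqrt_le : Num.sqrt n%:R <= weak_size%:R * D.
  rewrite -(ger0_norm weak_ge0) -sqrtr_sqr ler_wsqrtr // exprMn; apply: le_trans n_le _.
  by rewrite ler_wpM2r ?(ltW D2_gt0) // -natrX ler_nat leq_pmull.
apply: le_trans (Pr_has_few_edges_at p01 _ _ (erefl D) n_le exp_D) _ => //; last first.
  by rewrite ler_expR lerN2 ler_wpM2r.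
have n_ge10 : 10 <= n%:R :> R.
  have [_ /le_trans] := n_large; apply; rewrite /core_ratio.
  by have := ler_wpM2r (ltW n_gt0) eps_le; have := ltW n_gt0; lra.
have : n%:R / D ^+ 2 <= n%:R / (12 * 12) by rewrite ler_wpM2l // lef_pV2 // posrE mulr_gt0.
rewrite -(ler_nat R) natrM /weak_set_size -[(Num.truncn _).+1%:R]natr1.
by move: n_ge10 weak_le; move: (n%:R / D ^+ 2) => x; lra.
Qed.

End LargeMeanDegree.

Lemma Pr_bad : Pr (bad eps k p) <= 5 * expR (- n%:R) +
  n%:R * ((1/2 / n%:R) ^+ 6 + (2 * (10 * 10) / n%:R) ^+ 6 +
    (36 / star_ratio eps / n%:R) ^+ 6 + (1 / n%:R) ^+ 6) + expR (- (Num.sqrt n%:R / 30)).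
Proof.
have exp_ge0 (x : R) : 0 <= expR x by exact: expR_ge0.
have pow_ge0 (A : R) : 0 <= A -> 0 <= n%:R * (A / n%:R) ^+ 6.
  by move=> A_ge0; rewrite mulr_ge0 // exprn_ge0 // divr_ge0.
have exp_n_ge0 := exp_ge0 (- n%:R); have exp_sqrt_ge0 := exp_ge0 (- (Num.sqrt n%:R / 30)).
have subcritical_ge0 := pow_ge0 (1/2) (divr_ge0 ler01 (ler0n R 2)).
have small_ge0 := pow_ge0 (36 / star_ratio eps) (divr_ge0 (ler0n R 36) (ltW star_gt0)).
have tiny_ge0 := pow_ge0 1 ler01.
have core_ge0 : 0 <= n%:R * (2 * (10 * 10) / n%:R) ^+ 6 :> R.
  by rewrite pow_ge0 // !mulr_ge0.
rewrite !mulrDr /bad; case: ltP => [D_lt|kD].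
  by apply: le_trans (Pr_dense_subcritical D_lt) _; lra.
have [_ _ /(_ _ kD) D_large] := k_large.
have core : Pr (bad_core k p) <= n%:R * (2 * (10 * 10) / n%:R) ^+ 6 + expR (- (Num.sqrt n%:R / 30)).
  rewrite /bad_core; case: ltP => [D_lt|_].
    by apply: le_trans (Pr_dense_core D_lt) _; rewrite lerDl.
  by apply: le_trans (Pr_few_edges D_large) _; rewrite lerDr.
apply: le_trans (Pr_or _ p01 _ _) _; apply: le_trans (lerD _ core) _.
  apply: le_trans (Pr_or _ p01 _ _) (lerD (Pr_not_well_distributed D_large) _).
  apply: le_trans (Pr_or _ p01 _ _) (lerD (Pr_rotations_deficient D_large) _).
  apply: le_trans (Pr_or _ p01 _ _) (lerD (Pr_closing_deficient D_large) _).
  exact: le_trans (Pr_or _ p01 _ _) (lerD (Pr_dense_small D_large) (Pr_dense_tiny D_large kD)).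
lra.
Qed.

End BadEventProbability.

Local Open Scope ring_scope.

Lemma exists_Pr_bad_le (R : realType) (eps : R) : 0 < eps -> eps <= 1/4 ->
  exists c : R, forall (T : finType) (k : nat) (p : R),
    0 <= p <= 1 -> large_core_degree eps k -> large_order eps #|T| ->
    Pr p (pairs T) (bad eps k p) <= c / #|T|%:R ^+ 5.
Proof.
move=> eps_gt0 eps_le; have [c1 exp_le] := expRN_le_divX R 4.
have [c2 exp_sqrt_le] := @expRN_sqrt_le_divX R 30 4 (ltr0n R 30).
pose S : R := (1/2) ^+ 6 + (2 * (10 * 10)) ^+ 6 + (36 / star_ratio eps) ^+ 6 + 1 ^+ 6.
exists (5 * c1 + S + c2) => T k p p01 k_large n_large.
have n_gt0 := large_order_gt0 eps_gt0 n_large.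
have powers_sum (a b c d : R) : #|T|%:R * ((a / #|T|%:R) ^+ 6 + (b / #|T|%:R) ^+ 6 +
    (c / #|T|%:R) ^+ 6 + (d / #|T|%:R) ^+ 6) = (a ^+ 6 + b ^+ 6 + c ^+ 6 + d ^+ 6) / #|T|%:R ^+ 5.
  by field; rewrite gt_eqF.
apply: le_trans (Pr_bad eps_gt0 eps_le p01 k_large n_large) _; rewrite powers_sum -/S.
have := lerD (ler_wpM2l (ler0n R 5) (exp_le _ n_gt0)) (exp_sqrt_le _ n_gt0).
by move: (expR _) (expR _) S (_ ^+ 5)^-1 => *; lra.
Qed.

(** * Almost every process *)

Section AlmostEveryProcess.
Local Open Scope ring_scope.
Local Open Scope classical_set_scope.
Variable R : realType.

Lemma bin2_lt_sqr n : (1 < n)%N -> ('C(n, 2) < n ^ 2)%N.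
Proof.
move=> n_gt1; rewrite bin2 (leq_ltn_trans (half_leq (leq_mul (leqnn n) (leq_pred n)))) //.
by rewrite mulnn; move: n_gt1; clear; nia.
Qed.

Lemma almost_every_process_union (A : forall n, set (process n))
    (bad : forall n, R -> pred {set {set 'I_n}}) (c : R) :
  (\forall n \near \oo, forall p, 0 <= p <= 1 ->
    Pr p (pairs 'I_n) (bad n p) <= c / n%:R ^+ 5) ->
  (\forall n \near \oo, forall G : process n,
    (forall M, vset (G M) = finset.setT /\ ~~ bad n (M%:R / 'C(n, 2)%:R) (eset (G M))) -> A n G) ->
  almost_every_process R A.
Proof.
move=> near_bad near_A; apply/cvgrPdist_le => r r_gt0; near=> n.
rewrite ger0_norm ?subr_ge0 ?process_prob_le1 // lerBlDr -lerBlDl.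
have n_gt1 : (1 < n)%N by near: n; apply: nbhs_infty_gt.
have n_gt0 : 0 < n%:R :> R by rewrite ltr0n ltnW.
have c_le : c <= r * n%:R by near: n; apply: near_infty_mul_ge.
have A_good : forall G : process n, (forall M, vset (G M) = finset.setT /\
    ~~ bad n (M%:R / 'C(n, 2)%:R) (eset (G M))) -> A n G by near: n.
have bad_le p : 0 <= p <= 1 -> Pr p (pairs 'I_n) (bad n p) <= c / n%:R ^+ 5 by move: p; near: n.
have N_gt0 : (0 < 'C(n, 2))%N by rewrite bin_gt0.
apply: le_trans (process_prob_ge R (bad := fun M => bad n (M%:R / 'C(n, 2)%:R)) N_gt0 A_good).
rewrite lerD2l lerN2.
have N_le : 'C(n, 2).+1%:R <= n%:R ^+ 2 :> R by rewrite -natrX ler_nat bin2_lt_sqr.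
apply: (@le_trans _ _ (\sum_(M < 'C(n, 2).+1) n%:R ^+ 2 * (c / n%:R ^+ 5))).
  apply: ler_sum => M _; have density01 : 0 <= (M%:R / 'C(n, 2)%:R : R) <= 1.
    by rewrite divr_ge0 //= ler_pdivrMr ?ltr0n // mul1r ler_nat -ltnS.
  by rewrite ler_pM ?bad_le ?Pr_ge0.
have tail_ge0 : 0 <= c / n%:R ^+ 5.
  by apply: le_trans (Pr_ge0 _ _ _) (bad_le 0 _); rewrite lexx ler01.
rewrite sumr_const card_ord -[leLHS]mulr_natl.
apply: le_trans (ler_wpM2r (mulr_ge0 (sqr_ge0 _) tail_ge0) N_le) _.
have -> : n%:R ^+ 2 * (n%:R ^+ 2 * (c / n%:R ^+ 5)) = c / n%:R :> R by field; rewrite gt_eqF.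
by rewrite ler_pdivrMr.
Unshelve. all: by end_near. Qed.
End AlmostEveryProcess.

Theorem theorem1p3 (R : realType) (eps : R) (heps : 0 < eps) :
  exists k0 : nat, forall k : nat, (k0 <= k)%N ->
    almost_every_process R (fun (n : nat) (G : process n) =>
      forall (M : 'I_('C(n, 2)).+1) (K : graph 'I_n),
        is_kcore k (G M) K -> vset K <> finset.set0 ->
        resiliently_hamiltonian (1 / 2 - eps) K /\
        ~ resiliently_hamiltonian (1 / 2 + eps) K).
Proof.
pose eps' := Num.min eps (1/4); have eps'_le : eps' <= 1/4 by rewrite ge_min lexx orbT.
have eps'_gt0 : 0 < eps' by rewrite lt_min heps divr_gt0.
have [c Pr_bad_le] := exists_Pr_bad_le eps'_gt0 eps'_le.
have [k1 _ eps_k] := near_infty_mul_ge 3 (mulr_gt0 (ltr0n R 2) heps).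
have [k2 _ large_k] := near_large_core_degree eps'_gt0 eps'_le.
exists (maxn 3 (maxn k1 k2)) => k; rewrite !geq_max.
move=> /and3P[k_gt2 /eps_k{}eps_k /large_k{}large_k].
have near_order : (\forall n \near \oo, large_order eps' #|'I_n|)%classic.
  by near=> n; rewrite card_ord; near: n; apply: near_large_order.
apply: (almost_every_process_union (bad := fun n => @bad R eps' 'I_n k) (c := c)).
  by near=> n => p p01; rewrite -[X in X%:R ^+ 5]card_ord; apply: Pr_bad_le => //; near: n.
near=> n => G G_good M K K_core /eqP K0; have [G_spanning not_bad] := G_good M.
have [_ K_min _] := K_core; split; last exact: not_resiliently_hamiltonian (ltW heps) _ _ K_min K0.
apply: (@resiliently_hamiltonian_le _ _ _ (1/2 - eps')); first by rewrite lerB // ge_min lexx.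
apply: kcore_resilient eps'_gt0 eps'_le _ large_k _ G_spanning not_bad K_core K0.
  by rewrite divr_ge0.
by near: n.
Unshelve. all: by end_near. Qed.
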